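(* Let $E'\subset\mathbb T^d\times\mathbb Z_A^d$ be a Borel set and let $\lambda:\mathbb T^d\times\mathbb Z_A^d\to\mathbb C$ be a Borel function. Then $\lambda\cdot\chi_{E'}$ is a generalized MSF wavelet in $L^2(\mathbb T^d\times\mathbb Z_A^d,\widetilde\tau)$ if and only if the following three conditions are satisfied: (1) the sets $\{\widetilde\sigma^j(E'):j\in\mathbb Z\}$ are pairwise disjoint up to sets of $\widetilde\tau$-measure $0$, and $\widetilde\tau\big((\mathbb T^d\times\mathbb Z_A^d)\setminus\bigcup_{j\in\mathbb Z}\widetilde\sigma^j(E')\big)=0$; (2) $\int_{E'_z}|\lambda(z,a)|^2\,d\nu_z(a)=1$ for a.e. $z\in\mathbb T^d$; (3') for almost all $z\in\mathbb T^d$, $E'_z=\{a\in\mathbb Z_A^d:(z,a)\in E'\}$ has a single atom with respect to $\nu_z$, that is, for almost all $z$ there exists $a\in E'_z$ such that $\nu_z(\{a\})=\nu_z(E'_z)$.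
   Context: $A$ is a $d\times d$ diagonal matrix with diagonal entries integers $N_1,\dots,N_d>1$, $N=N_1\cdots N_d$, $e(\mathbf t)=(e^{2\pi i t_1},\dots,e^{2\pi i t_d})$, $\beta(z)=(z_1^{N_1},\dots,z_d^{N_d})$ on $\mathbb T^d$, $z^v=z_1^{v_1}\cdots z_d^{v_d}$ for $v\in\mathbb Z^d$, and $dz$ is normalized Haar measure on $\mathbb T^d$. $m:\mathbb T^d\to\mathbb C$ is a fixed Borel function whose zero set has Haar measure $0$ and which satisfies $\sum_{\beta(w)=z}|m(w)|^2=N$ for a.e. $z$. The solenoid is $\mathcal S_\beta=\{(z_n)_{n\ge0}:z_n\in\mathbb T^d,\ \beta(z_{n+1})=z_n\}$, $\pi_n((z_k)_k)=z_n$; $\tau$ is the unique probability measure on $\mathcal S_\beta$ with $\int f\circ\pi_n\,d\tau=\int_{\mathbb T^d}f(z)\prod_{j=0}^{n-1}|m(\beta^j(z))|^2\,dz$ for all $n\ge0$, $f\in C(\mathbb T^d)$. Product picture: $\mathbb Z_A^d=\prod_{j=0}^\infty\big(\{0,\dots,N_1-1\}\times\cdots\times\{0,\dots,N_d-1\}\big)$; the map $\Theta:\mathbb T^d\times\mathbb Z_A^d\to\mathcal S_\beta$, $\Theta(e(\mathbf t),(\mathbf a_j)_j)=\big(e(A^{-n}(\mathbf t+\sum_{j=0}^{n-1}A^j\mathbf a_j))\big)_{n\ge0}$ for $\mathbf t\in[0,1)^d$, is a Borel isomorphism; $\widetilde\tau=\tau\circ\Theta$, i.e. $\widetilde\tau(B)=\tau(\Theta(B))$.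 The shift becomes the Borel automorphism $\widetilde\sigma(e(\mathbf t),(\mathbf a_j)_{j\ge0})=(e(A^{-1}(\mathbf t+\mathbf a_0)),(\mathbf a_{j+1})_{j\ge0})$ for $\mathbf t\in[0,1)^d$. Fiber measures: for a.e. $z=e(\mathbf t)$ with $\mathbf t\in[0,1)^d$, $\nu_z$ is the Borel probability measure on $\mathbb Z_A^d$ giving the cylinder of sequences beginning with $\mathbf a_0,\dots,\mathbf a_{k-1}$ the mass $\frac1{N^k}\prod_{j=1}^k\big|m\big(e(A^{-j}(\mathbf t+\sum_{i=0}^{j-1}A^i\mathbf a_i))\big)\big|^2$; one has $\widetilde\tau=\int_{\mathbb T^d}\nu_z\,dz$. For $E'\subset\mathbb T^d\times\mathbb Z_A^d$, $E'_z=\{a:(z,a)\in E'\}$. Operators on $L^2(\mathbb T^d\times\mathbb Z_A^d,\widetilde\tau)$: $(\widetilde T_vf)(z,a)=z^vf(z,a)$ for $v\in\mathbb Z^d$, and $\widetilde D$ is the unitary whose inverse is $(\widetilde D^{-1}f)(z,a)=m(z)\,f(\widetilde\sigma^{-1}(z,a))$. Definition: $\lambda\cdot\chi_{E'}$ is a generalized MSF wavelet in $L^2(\mathbb T^d\times\mathbb Z_A^d,\widetilde\tau)$ if $\lambda\chi_{E'}\in L^2$, the family $\{\widetilde D^j\widetilde T_v(\lambda\chi_{E'}):j\in\mathbb Z,v\in\mathbb Z^d\}$ is an orthonormal basis of $L^2(\mathbb T^d\times\mathbb Z_A^d,\widetilde\tau)$, and $E'$ satisfies $\widetilde\tau(\widetilde\sigma^j(E')\cap\widetilde\sigma^k(E'))=0$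 for $j\ne k$ and $\widetilde\tau\big((\mathbb T^d\times\mathbb Z_A^d)\setminus\bigcup_{j\in\mathbb Z}\widetilde\sigma^j(E')\big)=0$. *)

(* Defs.v *)
From HB Require Import structures.
From mathcomp Require Import all_boot all_order all_algebra.
From mathcomp Require Import complex.
From mathcomp Require Import all_classical all_reals all_analysis.

Set Implicit Arguments.
Unset Strict Implicit.
Unset Printing Implicit Defensive.
Import Order.TTheory GRing.Theory Num.Theory.
Import numFieldNormedType.Exports.

Local Open Scope classical_set_scope.
Local Open Scope ring_scope.

HB.instance Definition _ (R : realType) := NormedModule.copy R[i] R[i]^o.
HB.instance Definition _ (R : realType) := Pointed.copy R[i] R[i]^o.
HB.instance Definition _ (R : realType) :=
  Measurable.copy R[i] (g_sigma_algebraType (@open R[i])).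

Notation normc := ComplexField.Normc.normc.

Definition cintegral (d : measure_display) (T : measurableType d) (R : realType)
    (mu : {measure set T -> \bar R}) (f : T -> R[i]) : R[i] :=
  ((\int[mu]_x complex.Re (f x)) +i* (\int[mu]_x complex.Im (f x)))%C.

(* Elements of L^2 are represented by functions; equality in L^2 is equality
   almost everywhere. *)
Definition L2 (d : measure_display) (T : measurableType d) (R : realType)
    (mu : {measure set T -> \bar R}) (f : T -> R[i]) : Prop :=
  measurable_fun setT f /\
  (\int[mu]_x ((normc (f x)) ^+ 2)%:E < +oo)%E.

Definition cinner (d : measure_display) (T : measurableType d) (R : realType)
    (mu : {measure set T -> \bar R}) (f g : T -> R[i]) : R[i] :=
  cintegral mu (fun x => f x * (g x)^*%C).

Definition orthonormal_basis (d : measure_display) (T : measurableType d)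
    (R : realType) (mu : {measure set T -> \bar R}) (I : eqType)
    (psi : I -> T -> R[i]) : Prop :=
  [/\ forall i, L2 mu (psi i),
      forall i j, cinner mu (psi i) (psi j) = (i == j)%:R &
      forall f, L2 mu f -> forall eps : R, 0 < eps ->
        exists (s : seq I) (c : I -> R[i]),
          (\int[mu]_x
             ((normc (f x - \sum_(i <- s) c i * psi i x)) ^+ 2)%:E
             < (eps ^+ 2)%:E)%E ].

Definition ziter (T : Type) (f finv : T -> T) (j : int) : T -> T :=
  match j with Posz n => iter n f | Negz n => iter n.+1 finv end.

Definition unit_torus (R : realType) (d : nat) :
    set (prod_topology (fun _ : 'I_d => R[i])) :=
  [set z | forall i, `|z i| = 1].

Definition torus (R : realType) (d : nat) : Type := set_type (@unit_torus R d).

Section Torus.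
Context (R : realType) (d : nat).
Implicit Types (z w : torus R d) (t : 'I_d -> R).

HB.instance Definition _ :=
  Topological.copy (torus R d) (set_type (@unit_torus R d)).

Definition torus_coord z : 'I_d -> R[i] := \val z.

Lemma norm_torus_coord z i : `|torus_coord z i| = 1.
Proof. exact: (set_valP z). Qed.

Definition mk_torus (u : 'I_d -> R[i]) (hu : forall i, `|u i| = 1) : torus R d :=
  exist _ (u : prod_topology _) (mem_set hu : u \in @unit_torus R d).

Lemma torus_coord_inj z w : torus_coord z =1 torus_coord w -> z = w.
Proof. by move=> zw; apply: val_inj; apply: funext. Qed.

Fact torus_mul_subproof z w i : `|torus_coord z i * torus_coord w i| = 1.
Proof. by rewrite normrM !norm_torus_coord mulr1. Qed.
Definition torus_mul z w : torus R d := mk_torus (torus_mul_subproof z w).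

Fact torus_one_subproof (i : 'I_d) : `|1 : R[i]| = 1.
Proof. exact: normr1. Qed.
HB.instance Definition _ :=
  isPointed.Build (torus R d) (mk_torus torus_one_subproof).

HB.instance Definition _ :=
  Measurable.copy (torus R d) (g_sigma_algebraType (@open (torus R d))).

(* On a compact metrizable group every finite Borel measure is regular, so
   invariance and total mass 1 define the normalized Haar measure. *)
Definition is_normalized_haar (mu : probability (torus R d) R) : Prop :=
  forall w (B : set (torus R d)), measurable B -> mu (torus_mul w @` B) = mu B.

Definition cexp (s : R) : R[i] := (cos (2 * pi * s) +i* sin (2 * pi * s))%C.

Lemma norm_cexp s : `|cexp s| = 1.
Proof. by rewrite normc_def /= cos2Dsin2 sqrtr1. Qed.

Definition torus_e t : torus R d := mk_torus (fun i => norm_cexp (t i)).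

(* the t in [0,1)^d with torus_e t = z *)
Definition torus_arg z : 'I_d -> R :=
  xget (fun=> 0) [set t | (forall i, 0 <= t i < 1) /\ torus_e t = z].

Definition torus_char (v : {ffun 'I_d -> int}) z : R[i] :=
  \prod_i (torus_coord z i) ^ (v i).

End Torus.

(* The diagonal entries of A. *)
Record dilation (d : nat) := Dilation {
  diag_entry :> 'I_d -> nat ;
  diag_entry_gt1 : forall i, (1 < diag_entry i)%N }.

Definition digit (d : nat) (N : dilation d) : Type :=
  {dffun forall i : 'I_d, 'I_(N i)}.
HB.instance Definition _ (d : nat) (N : dilation d) := Finite.on (digit N).

Definition ZA (d : nat) (N : dilation d) : Type :=
  prod_topology (fun _ : nat => discrete_topology (digit N)).
HB.instance Definition _ (d : nat) (N : dilation d) :=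
  Topological.copy (ZA N)
    (prod_topology (fun _ : nat => discrete_topology (digit N))).

Definition digit0 (d : nat) (N : dilation d) : digit N :=
  [ffun i => Ordinal (ltnW (diag_entry_gt1 N i))].
HB.instance Definition _ (d : nat) (N : dilation d) :=
  isPointed.Build (ZA N) (fun=> digit0 N).
HB.instance Definition _ (d : nat) (N : dilation d) :=
  Measurable.copy (ZA N) (g_sigma_algebraType (@open (ZA N))).

Section Solenoid.
Context (R : realType) (d : nat) (N : dilation d).
Local Notation T := (torus R d).
Implicit Types (z : T) (a : ZA N) (m : T -> R[i]).

Fact beta_subproof z i : `|torus_coord z i ^+ N i| = 1.
Proof. by rewrite normrX norm_torus_coord expr1n. Qed.
Definition beta z : T := mk_torus (beta_subproof z).

Definition solenoid_set : set (prod_topology (fun _ : nat => T)) :=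
  [set x | forall n, beta (x n.+1) = x n].
Definition solenoid : Type := set_type solenoid_set.
HB.instance Definition _ := Topological.copy solenoid (set_type solenoid_set).

Definition mk_solenoid (x : nat -> T) (hx : forall n, beta (x n.+1) = x n) :
    solenoid :=
  exist _ (x : prod_topology _) (mem_set hx : x \in solenoid_set).

Fact solenoid_one_subproof (n : nat) : beta point = point.
Proof. by apply: torus_coord_inj => i; rewrite /torus_coord /= expr1n. Qed.
HB.instance Definition _ :=
  isPointed.Build solenoid (mk_solenoid solenoid_one_subproof).
HB.instance Definition _ :=
  Measurable.copy solenoid (g_sigma_algebraType (@open solenoid)).

Definition solenoid_proj (n : nat) (x : solenoid) : T := (\val x : nat -> T) n.

Definition is_quadrature_filter (mu : probability T R) m : Prop :=
  [/\ measurable_fun setT m,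
      mu [set z | m z = 0] = 0%E &
      {ae mu, forall z,
        \sum_(w \in [set w | beta w = z]) (normc (m w)) ^+ 2
          = (\prod_i N i)%:R} ].

Definition is_solenoid_measure (mu : probability T R) m
    (tau : probability solenoid R) : Prop :=
  forall (n : nat) (f : T -> R[i]), continuous f ->
    cintegral tau (f \o solenoid_proj n) =
    cintegral mu (fun z =>
      f z * (\prod_(j < n) (normc (m (iter j beta z))) ^+ 2)%:C%C).

(* e(A^{-n}(t + \sum_{j < n} A^j a_j)) where z = e(t), t \in [0,1)^d *)
Definition branch z a (n : nat) : T :=
  torus_e (fun i =>
    (torus_arg z i + \sum_(j < n) (N i)%:R ^+ j * (a j i)%:R) / (N i)%:R ^+ n).

Lemma cexpD (s t : R) : cexp (s + t) = cexp s * cexp t.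
Proof. by rewrite /cexp mulrDr cosD sinD; simpc; rewrite [X in (_ +i* X)%C]addrC. Qed.

Lemma cexpMn (s : R) n : cexp (s * n%:R) = cexp s ^+ n.
Proof.
elim: n => [|n IHn]; first by rewrite mulr0 /cexp mulr0 cos0 sin0.
by rewrite -addn1 natrD mulrDr mulr1 cexpD IHn addn1 exprSr.
Qed.

Lemma cexp_nat (n : nat) : cexp (n%:R : R) = 1.
Proof.
by rewrite -[n%:R]mul1r cexpMn /cexp mulr1 mulrC mulr_natr cos2pi sin2pi expr1n.
Qed.

Fact branch_subproof z a n : beta (branch z a n.+1) = branch z a n.
Proof.
apply: torus_coord_inj => i; rewrite /torus_coord /= -cexpMn.
have N0 : (N i)%:R != 0 :> R by rewrite pnatr_eq0 -lt0n (ltnW (diag_entry_gt1 N i)).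
rewrite big_ord_recr /= addrA exprSr invfM mulrA divfK //.
rewrite mulrDl [X in _ + X]mulrAC divff ?expf_neq0 // mul1r.
by rewrite cexpD cexp_nat mulr1.
Qed.
Definition Theta (x : T * ZA N) : solenoid :=
  mk_solenoid (branch_subproof x.1 x.2).

Definition shift (x : T * ZA N) : T * ZA N :=
  (branch x.1 x.2 1, fun j => x.2 j.+1).

(* shift is a bijection, so this is its inverse *)
Definition shift_inv (x : T * ZA N) : T * ZA N :=
  xget point [set y | shift y = x].

Definition shift_image (E : set (T * ZA N)) (j : int) : set (T * ZA N) :=
  ziter shift shift_inv j @` E.

(* The spaces involved are second countable, so the product sigma-algebra on
   T * ZA N is the Borel sigma-algebra of the product topology. *)
Definition is_product_picture (tau : probability solenoid R)
    (taut : probability (T * ZA N)%type R) : Prop :=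
  forall B : set (T * ZA N), measurable B -> taut B = tau (Theta @` B).

Definition cylinder (k : nat) a : set (ZA N) :=
  [set b | forall j, (j < k)%N -> b j = a j].

Definition is_fiber_measure (mu : probability T R) m
    (nu : T -> probability (ZA N) R) : Prop :=
  {ae mu, forall z, forall (k : nat) (a : ZA N),
    nu z (cylinder k a) =
      ((((\prod_i N i) ^ k)%:R)^-1 *
         \prod_(1 <= j < k.+1) (normc (m (branch z a j))) ^+ 2)%:E}.

Definition op_T (v : {ffun 'I_d -> int}) (f : T * ZA N -> R[i]) :
    T * ZA N -> R[i] :=
  fun x => torus_char v x.1 * f x.

Definition op_Dinv m (f : T * ZA N -> R[i]) : T * ZA N -> R[i] :=
  fun x => m x.1 * f (shift_inv x).

(* a representative of the preimage of f in L^2 under op_Dinv *)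
Definition op_D (taut : probability (T * ZA N)%type R) m
    (f : T * ZA N -> R[i]) : T * ZA N -> R[i] :=
  xget (fun=> 0)
    [set g | L2 taut g /\ {ae taut, forall x, op_Dinv m g x = f x}].

Definition shifts_tile (taut : probability (T * ZA N)%type R)
    (E : set (T * ZA N)) : Prop :=
  (forall j k : int, j <> k ->
     taut (shift_image E j `&` shift_image E k) = 0%E) /\
  taut (~` \bigcup_j shift_image E j) = 0%E.

Definition generalized_MSF_wavelet (taut : probability (T * ZA N)%type R) m
    (lam : T * ZA N -> R[i]) (E : set (T * ZA N)) : Prop :=
  let psi := fun x => lam x * (\1_E x)%:C%C in
  [/\ L2 taut psi,
      orthonormal_basis taut (fun jv : int * {ffun 'I_d -> int} =>
        ziter (op_D taut m) (op_Dinv m) jv.1 (op_T jv.2 psi)) &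
      shifts_tile taut E].

End Solenoid.

(* Main.v *)
Require Import Defs.
From HB Require Import structures.
From mathcomp Require Import all_boot all_order all_algebra.
From mathcomp Require Import complex ring lra.
From mathcomp Require Import all_classical all_reals all_analysis.
From mathcomp Require Import measurable_realfun.

(** The idea of the proof.  Write X for the product of the torus and the
    digit sequences, psi for lam restricted to E, and disintegrate taut over
    Haar measure mu with fibre measures nu_z.

    The image of the measure |m|^2 taut under sigma^-1 is taut again: prefixing
    a digit multiplies the masses of cylinders by the weight of one further
    inverse branch of beta, and each inverse branch contracts Haar measure by
    the constant factor 1/N ([shift_isometry]).  Hence each D^j is, up to null
    sets, a weighted composition f |-> M_j * (f o sigma^j) with
    M_j nonzero almost everywhere ([ziter_wcomp]), and if the translates of
    E tile X, then D^j T_v psi lives on the tile sigma^-j(E).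

    So only the scale j = 0 matters.  There <T_v psi, psi> is the v-th
    Fourier coefficient of the image under (z, a) |-> z of the measure
    |psi|^2 taut, whose density against mu is the fibre integral
    z |-> int_{E_z} |lam|^2 dnu_z.  A finite measure on the torus is
    determined by its Fourier coefficients ([torus_measure_eq]), so the T_v psi
    are orthonormal exactly when this density is 1 almost everywhere.

    For the third condition, the span of the T_v psi consists of the functions
    p(z) psi(z, a), and completeness on E means that every square integrable
    function on E is a limit of such functions.  When E_z carries a single
    atom, a function on the fibre is determined up to null sets by one value,
    so every h supported on E is H(z) psi with
    H(z) = int_{E_z} h conj(lam) dnu_z square integrable over mu
    ([fiber_coefficient]), and H is a limit of trigonometric polynomials
    ([torus_char_dense]).  Conversely, if the constant 1 and all digit functions
    a |-> a_j are limits of p_n(z) lam(z, a), then on almost every fibre lam is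
    almost everywhere a nonzero constant and so is every digit; a fibre on
    which all digits are constant is one point ([fiber_atom]).

    Two tools are built along the way.  The L^2-density of characters for an
    arbitrary finite measure on the torus is obtained from polynomials in the
    coordinates converging to indicators of half spaces, without uniform
    approximation of continuous functions.  And since the fibre measures are
    only prescribed for almost every z, they are replaced by an everywhere
    defined measurable family ([regular_version]), for which Fubini-type
    formulas hold ([disintegration_ge0]). *)

Set Implicit Arguments.
Unset Strict Implicit.
Unset Printing Implicit Defensive.
Import Order.TTheory GRing.Theory Num.Theory.
Import numFieldNormedType.Exports.
Import HBNNSimple.

Local Open Scope classical_set_scope.
Local Open Scope ring_scope.

(** * Measurability of maps into the complex numbers *)

Lemma continuous_borel (R : realType) (T : ptopologicalType)
    (f : g_sigma_algebraType (@open T) -> R) :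
  continuous (f : T -> R) -> measurable_fun setT f.
Proof.
move=> /continuousP cf; apply: (measurability _ (RGenOpens.measurableE R)).
move=> _ [_ [a [b ->] <-]]; rewrite setTI; apply: sub_sigma_algebra.
exact/cf/interval_open.
Qed.

Lemma measurable_into_borel d (S : measurableType d) (T : ptopologicalType)
    (f : S -> g_sigma_algebraType (@open T)) :
  (forall U : set T, open U -> measurable (f @^-1` U)) -> measurable_fun setT f.
Proof.
move=> mf; apply: (@measurability _ _ S (g_sigma_algebraType (@open T)) _ _ (@open T)) => //.
by move=> _ [U oU <-]; rewrite setTI; exact: mf.
Qed.

Section Coordinates.
Context (R : realType) (J : finType) (T : topologicalType) (g : J -> T -> R).
Hypothesis nbhs_box : forall x U, nbhs x U ->
  exists2 e : R, 0 < e & [set y | forall i, `|g i y - g i x| < e] `<=` U.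

Let box (k : {ffun J -> rat} * nat) : set T :=
  [set y | forall i, `|g i y - ratr (k.1 i)| < k.2.+1%:R^-1].

(** The boxes with rational centre and radius 1/(n+1) are countably many; this
    is what turns open sets into measurable ones when only the finitely many
    real coordinates g of a map are known to be measurable. *)
Lemma open_coord_boxes (U : set T) : open U ->
  U = \bigcup_(k in [set k | box k `<=` U]) box k.
Proof.
move=> oU; apply/seteqP; split; last first.
  by move=> x [k kU kx]; exact: kU.
move=> x Ux; have [e e0 eU] := nbhs_box (open_nbhs_nbhs (conj oU Ux)).
have [n [r [rE r0 re]]] : exists n : nat, exists r : R,
    [/\ n.+1%:R^-1 = r, 0 < r & r < e / 2].
  have [n _ /(_ n (leqnn _)) ne] :=
    near_infty_natSinv_lt (PosNum (divr_gt0 e0 (ltr0n _ 2))).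
  by exists n, (n.+1%:R^-1); split => //; rewrite invr_gt0.
have q_ i : {q : rat | `|g i x - ratr q| < r}.
  apply: cid; have /rat_in_itvoo[q] : g i x - r < g i x + r by lra.
  by rewrite in_itv/= => /andP[q1 q2]; exists q; rewrite ltr_norml; lra.
exists ([ffun i => sval (q_ i)], n); last first.
  by move=> i /=; rewrite ffunE rE; exact: (svalP (q_ i)).
move=> y /= yk; apply: eU => i /=; have := yk i; rewrite ffunE rE.
by have := svalP (q_ i); rewrite !ltr_norml; lra.
Qed.

Lemma measurable_preimage_coords d' (S : measurableType d') (f : S -> T)
    (U : set T) :
  (forall i, measurable_fun setT (g i \o f)) -> open U -> measurable (f @^-1` U).
Proof.
move=> mf /open_coord_boxes ->; rewrite preimage_bigcup.
rewrite bigcup_mkcond; apply: countable_bigcupT_measurable => // k.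
case: ifP => // _.
rewrite (_ : _ @^-1` _ =
    \bigcap_(i in [set: J]) [set s | `|g i (f s) - ratr (k.1 i)| < k.2.+1%:R^-1]); last first.
  by apply/seteqP; split => [s ks i _|s ks i]; [exact: ks|exact: (ks i I)].
apply: fin_bigcap_measurable => // i _.
rewrite (_ : [set _ | _] = (g i \o f) @^-1` [set r | `|r - ratr (k.1 i)| < k.2.+1%:R^-1]) //.
rewrite -[X in measurable X]setTI; apply: mf => //.
rewrite (_ : [set _ | _] = ball (ratr (k.1 i) : R) (k.2.+1%:R^-1)); first exact: measurable_ball.
by apply/seteqP; split => r; rewrite /ball/= distrC.
Qed.

End Coordinates.

Section ComplexMeasurable.
Context (R : realType).

(** Both real coordinates are handled at once by indexing them with a boolean,
    true for the real part. *)
Definition cplx_coord (b : bool) (z : R[i]) : R :=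
  if b then complex.Re z else complex.Im z.

Lemma normr_normc (z : R[i]) : `|z| = (normc z)%:C%C.
Proof. by rewrite normc_def; case: z. Qed.

Lemma normc_sqr (z : R[i]) :
  normc z ^+ 2 = complex.Re z ^+ 2 + complex.Im z ^+ 2.
Proof. by case: z => a b /=; rewrite sqr_sqrtr // addr_ge0 // sqr_ge0. Qed.

Lemma normc_ge0 (z : R[i]) : 0 <= normc z.
Proof. by case: z => a b; exact: sqrtr_ge0. Qed.

Lemma normcNE (z : R[i]) : normc (- z) = normc z.
Proof. by case: z => a b /=; rewrite !sqrrN. Qed.

Lemma cplx_coord_le b (z : R[i]) : `|cplx_coord b z| <= normc z.
Proof.
rewrite -(@ler_pXn2r _ 2) ?nnegrE ?normc_ge0 // normc_sqr real_normK ?num_real //.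
by case: b; rewrite /= ?lerDl ?lerDr sqr_ge0.
Qed.

Lemma cplx_coordB b (z w : R[i]) :
  cplx_coord b (z - w) = cplx_coord b z - cplx_coord b w.
Proof. by case: z w b => [a1 b1] [a2 b2] []. Qed.

Lemma cplx_coord_continuous b : continuous (cplx_coord b).
Proof.
move=> x A /nbhs_ballP[e /= e0 eA]; apply/(@nbhs_ballP _ R[i]^o).
exists (e%:C%C); first by rewrite /= ltcR.
move=> y; rewrite /ball/= normr_normc ltcR => yx; apply: eA; rewrite /ball/= -cplx_coordB.
exact: le_lt_trans (cplx_coord_le _ _) yx.
Qed.

(** A box of half-width e/2 lies in the disc of radius e, since 1/4 + 1/4 <
    1. *)
Lemma nbhs_cplx_box (x : R[i]) (U : set R[i]) : nbhs x U ->
  exists2 e : R, 0 < e &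
    [set y | forall b, `|cplx_coord b y - cplx_coord b x| < e] `<=` U.
Proof.
move=> /(@nbhs_ballP _ R[i]^o)[e /= e0 eU].
exists (complex.Re e / 2).
  by move: e0; rewrite ltcE/= => /andP[_ ?]; rewrite divr_gt0.
move=> y /= yx; apply: eU; rewrite /ball/= normr_normc.
have -> : e = (complex.Re e)%:C%C.
  by move: e0; rewrite ltcE/= => /andP[/eqP]; case: e {yx} => a b /= ->.
have e0' : 0 < complex.Re e by move: e0; rewrite ltcE/= => /andP[].
rewrite ltcR -(@ltr_pXn2r _ 2) ?nnegrE ?normc_ge0 ?(ltW e0') //.
rewrite -opprB normcNE normc_sqr.
have := yx true; have := yx false; rewrite -!cplx_coordB /cplx_coord !ltr_norml.
move: (complex.Re (y - x)) (complex.Im (y - x)) => a b.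
move: (complex.Re e) e0' => r r0 /andP[h1 h2] /andP[h3 h4].
have : 0 < (r / 2 - a) * (r / 2 + a) by rewrite mulr_gt0//; lra.
have : 0 < (r / 2 - b) * (r / 2 + b) by rewrite mulr_gt0//; lra.
by nra.
Qed.

Lemma measurable_cplx_coord b : measurable_fun setT (cplx_coord b).
Proof.
exact: (@continuous_borel R R[i] _ (@cplx_coord_continuous b)).
Qed.

Lemma measurable_cplxP d (T : measurableType d) (f : T -> R[i]) :
  measurable_fun setT f <->
  (forall b, measurable_fun setT (cplx_coord b \o f)).
Proof.
split=> [mf b|mf].
  by apply: measurableT_comp => //; exact: measurable_cplx_coord.
apply: (@measurable_into_borel _ _ R[i]) => U oU.
exact: (measurable_preimage_coords nbhs_cplx_box).
Qed.

Context d (T : measurableType d).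
Implicit Types f g : T -> R[i].

Lemma measurable_cplx_mk (u v : T -> R) : measurable_fun setT u ->
  measurable_fun setT v -> measurable_fun setT (fun x => (u x +i* v x)%C).
Proof. by move=> mu mv; apply/measurable_cplxP => -[]. Qed.

Lemma measurable_Re f : measurable_fun setT f ->
  measurable_fun setT (fun x => complex.Re (f x)).
Proof. by move=> /measurable_cplxP /(_ true). Qed.

Lemma measurable_Im f : measurable_fun setT f ->
  measurable_fun setT (fun x => complex.Im (f x)).
Proof. by move=> /measurable_cplxP /(_ false). Qed.

Lemma measurable_cplxD f g : measurable_fun setT f -> measurable_fun setT g ->
  measurable_fun setT (fun x => f x + g x).
Proof.
move=> mf mg; apply/measurable_cplxP => b.
rewrite (_ : _ \o _ = (cplx_coord b \o f) \+ (cplx_coord b \o g)).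
  by apply: measurable_funD; [move/measurable_cplxP : mf|move/measurable_cplxP : mg]; exact.
by apply/funext => x; rewrite /=; case: b; rewrite /= raddfD.
Qed.

Lemma cReM (z w : R[i]) : complex.Re (z * w) =
  complex.Re z * complex.Re w - complex.Im z * complex.Im w.
Proof. by case: z w => [a b] [c e]. Qed.

Lemma cImM (z w : R[i]) : complex.Im (z * w) =
  complex.Re z * complex.Im w + complex.Im z * complex.Re w.
Proof. by case: z w => [a b] [c e]. Qed.

Lemma measurable_cplxM f g : measurable_fun setT f -> measurable_fun setT g ->
  measurable_fun setT (fun x => f x * g x).
Proof.
move=> mf mg; have [mf1 mf2] := (measurable_Re mf, measurable_Im mf).
have [mg1 mg2] := (measurable_Re mg, measurable_Im mg).
apply/measurable_cplxP => -[]; rewrite /comp /=.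
  under eq_fun do rewrite cReM.
  by apply: measurable_funB; exact: measurable_funM.
under eq_fun do rewrite cImM.
by apply: measurable_funD; exact: measurable_funM.
Qed.

Lemma measurable_cplxN f : measurable_fun setT f ->
  measurable_fun setT (fun x => - f x).
Proof.
move=> mf; under eq_fun do rewrite -mulN1r.
by apply: measurable_cplxM => //; exact: measurable_cst.
Qed.

Lemma measurable_cplxB f g : measurable_fun setT f -> measurable_fun setT g ->
  measurable_fun setT (fun x => f x - g x).
Proof. by move=> mf mg; apply: measurable_cplxD => //; exact: measurable_cplxN. Qed.

Lemma measurable_cplx_conj f : measurable_fun setT f ->
  measurable_fun setT (fun x => (f x)^*%C).
Proof.
move=> mf; rewrite (_ : (fun _ => _) =
  (fun x => complex.Re (f x) +i* - complex.Im (f x))%C); last first.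
  by apply/funext => x; case: (f x).
apply: measurable_cplx_mk; first exact: measurable_Re.
by apply: measurable_funN; exact: measurable_Im.
Qed.

Lemma measurable_normc2 f : measurable_fun setT f ->
  measurable_fun setT (fun x => normc (f x) ^+ 2).
Proof.
move=> mf; under eq_fun do rewrite normc_sqr.
by apply: measurable_funD; apply: measurable_funX; [exact: measurable_Re|exact: measurable_Im].
Qed.

Lemma measurable_cplx_real (u : T -> R) : measurable_fun setT u ->
  measurable_fun setT (fun x => (u x)%:C%C).
Proof. by move=> mu; exact: measurable_cplx_mk. Qed.

Lemma measurable_cplx_inv f : measurable_fun setT f ->
  measurable_fun setT (fun x => (f x)^-1).
Proof.
move=> mf; rewrite (_ : (fun _ => _) =
    (fun x => (f x)^*%C * ((normc (f x) ^+ 2) `^ (-1))%:C%C)).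
  (* Real inversion is written as the power of exponent -1, which is known to
     be measurable. *)
  apply: measurable_cplxM; first exact: measurable_cplx_conj.
  apply: measurable_cplx_real.
  exact: (measurableT_comp (measurable_powR (-1)) (measurable_normc2 mf)).
apply/funext => x; rewrite powR_inv1 ?sqr_ge0// normc_sqr.
case: (f x) => a b /=.
by rewrite /GRing.inv /=; simpc; rewrite -!mulNr.
Qed.

Lemma measurable_cplx_sum (I : Type) (s : seq I) (P : pred I) (h : I -> T -> R[i]) :
  (forall i, measurable_fun setT (h i)) ->
  measurable_fun setT (fun x => \sum_(i <- s | P i) h i x).
Proof.
move=> mh; elim: s => [|i s IH].
  by under eq_fun do rewrite big_nil; exact: measurable_cst.
under eq_fun do rewrite big_cons.
by case: (P i) => //; exact: measurable_cplxD.
Qed.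

Lemma measurable_cplx_prod (I : Type) (s : seq I) (P : pred I) (h : I -> T -> R[i]) :
  (forall i, measurable_fun setT (h i)) ->
  measurable_fun setT (fun x => \prod_(i <- s | P i) h i x).
Proof.
move=> mh; elim: s => [|i s IH].
  by under eq_fun do rewrite big_nil; exact: measurable_cst.
under eq_fun do rewrite big_cons.
by case: (P i) => //; exact: measurable_cplxM.
Qed.

Lemma measurable_cplxX f n : measurable_fun setT f ->
  measurable_fun setT (fun x => f x ^+ n).
Proof.
move=> mf; elim: n => [|n IH].
  by under eq_fun do rewrite expr0; exact: measurable_cst.
by under eq_fun do rewrite exprS; exact: measurable_cplxM.
Qed.

Lemma measurable_cplxXz f (n : int) : measurable_fun setT f ->
  measurable_fun setT (fun x => f x ^ n).
Proof.
move=> mf; case: n => n; first exact: measurable_cplxX.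
under eq_fun do rewrite NegzE -exprnN.
by apply: measurable_cplx_inv; exact: measurable_cplxX.
Qed.

End ComplexMeasurable.

(** * Borel sets of the torus and of the digit sequences *)

(** The product topology is a supremum of initial topologies, so a
    neighbourhood belongs to any filter that contains the preimages of
    coordinate neighbourhoods; this yields the bases of boxes and of cylinders
    below. *)
Lemma nbhs_prod_topology (J : Type) (K : J -> topologicalType)
    (x : prod_topology K) (F : set_system (prod_topology K)) (U : set (prod_topology K)) :
  Filter F ->
  (forall j (B : set (K j)), open B -> B (x j) -> F [set y | B (y j)]) ->
  nbhs x U -> F U.
Proof.
move=> FF FB; have : F --> x.
  apply/cvg_sup => j A /= [_ [[B oB <-] Bx sBA]].
  by rewrite nbhs_filterE; apply: filterS sBA _; exact: FB.
by move=> + nU => /(_ U nU); rewrite nbhs_filterE.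
Qed.

Section TorusMeasurable.
Context (R : realType) (d : nat).
Local Notation T := (torus R d).

(** The 2d real coordinates of a point of the torus, in complex d-space. *)
Definition torus_real (k : 'I_d * bool) (z : T) : R :=
  cplx_coord k.2 (torus_coord z k.1).

Lemma torus_coord_continuous i : continuous (fun z : T => torus_coord z i).
Proof.
move=> z; apply: (@continuous_comp _ _ _ (fun z : T => \val z : prod_topology _) (fun w => w i)).
  exact: initial_continuous.
exact: (@proj_continuous _ _ i).
Qed.

Lemma torus_real_continuous k : continuous (torus_real k).
Proof.
move=> z; apply: (@continuous_comp _ _ _ (fun z : T => torus_coord z k.1)).
  exact: torus_coord_continuous.
exact: cplx_coord_continuous.
Qed.

Lemma nbhs_torus_box (z : T) U : nbhs z U ->
  exists2 e : R, 0 < e &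
    [set y | forall k, `|torus_real k y - torus_real k z| < e] `<=` U.
Proof.
move=> [_ [[V oV <-] Vz sVU]].
pose bx (e : R) := [set w : prod_topology (fun _ : 'I_d => R[i]) |
  forall k : 'I_d * bool, `|cplx_coord k.2 (w k.1) - torus_real k z| < e].
have FF : Filter (filter_from [set e : R | 0 < e] bx).
  apply: filter_from_filter; first by exists 1 => /=.
  move=> e1 e2 /= e10 e20; exists (Num.min e1 e2); first by rewrite /= lt_min e10.
  by move=> w wb; split => k; have := wb k; rewrite lt_min => /andP[].
have : filter_from [set e : R | 0 < e] bx V.
  apply: (@nbhs_prod_topology _ _ (\val z)) => //; last exact: open_nbhs_nbhs.
  move=> j B oB Bz.
  have [e e0 eB] := nbhs_cplx_box (open_nbhs_nbhs (conj oB Bz)).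
  by exists e => // w wb; apply: eB => b; exact: (wb (j, b)).
by move=> [e e0 eV]; exists e => // y yb; apply: sVU; exact: eV.
Qed.

Lemma measurable_torus_coord i : measurable_fun setT (fun z : T => torus_coord z i).
Proof.
apply/measurable_cplxP => b.
exact: (@continuous_borel R T _ (@torus_real_continuous (i, b))).
Qed.

Lemma measurable_torusP d' (S : measurableType d') (f : S -> T) :
  measurable_fun setT f <->
  (forall i, measurable_fun setT (fun s => torus_coord (f s) i)).
Proof.
split=> [mf i|mf].
  by apply: (measurableT_comp (measurable_torus_coord i) mf).
apply: (@measurable_into_borel _ _ T) => U oU.
apply: (measurable_preimage_coords nbhs_torus_box) => // -[i b].
by have /measurable_cplxP /(_ b) := mf i.
Qed.

(** The identity from the torus with sigma-algebra G to the torus with its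
    Borel sigma-algebra is measurable, because its real coordinates are: the
    half lines generate the Borel sets of the line. *)
Lemma torus_sigma_algebra (G : set (set T)) : sigma_algebra setT G ->
  (forall k (c : R), G [set z | torus_real k z < c]) ->
  forall B : set T, measurable B -> G B.
Proof.
move=> sG Gc B mB; rewrite -(sigma_algebra_id sG).
have mid : measurable_fun setT (id : g_sigma_algebraType G -> T).
  apply/measurable_torusP => i; apply/measurable_cplxP => b.
  apply: (measurability _ (RGenInftyO.measurableE R)).
  move=> _ [_ [c ->] <-]; rewrite setTI; apply: sub_sigma_algebra.
  rewrite (_ : _ @^-1` _ = [set z | torus_real (i, b) z < c]); first exact: Gc.
  by apply/seteqP; split => z /=; rewrite in_itv.
by have := mid measurableT B mB; rewrite setTI.
Qed.

End TorusMeasurable.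

Section ZAMeasurable.
Context (d : nat) (N : dilation d).
Local Notation ZA := (ZA N).

Lemma nbhs_ZA_cylinder (a : ZA) U : nbhs a U -> exists k, cylinder k a `<=` U.
Proof.
move=> aU.
have FF : Filter (filter_from [set: nat] (fun k => cylinder k a)).
  apply: filter_from_filter; first by exists 0%N.
  move=> k1 k2 _ _; exists (maxn k1 k2) => // b ba; split => j jk;
    by apply: ba; rewrite leq_max jk ?orbT.
have [k _ kU] : filter_from [set: nat] (fun k => cylinder k a) U.
  apply: (@nbhs_prod_topology _ _ a) => // j B oB Ba.
  by exists j.+1 => // b /(_ j (ltnSn j)) /= ->.
by exists k.
Qed.

Lemma open_digit j (c : digit N) : open [set a : ZA | a j = c].
Proof.
have : continuous (fun a : ZA => a j) by exact: (@proj_continuous _ _ j).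
move=> /continuousP /(_ [set c]) h.
apply: h; exact: discrete_open.
Qed.

Lemma measurable_digit j (c : digit N) : measurable [set a : ZA | a j = c].
Proof. by apply: sub_sigma_algebra; exact: open_digit. Qed.

Lemma measurable_cylinder k (a : ZA) : measurable (cylinder k a).
Proof.
rewrite (_ : cylinder k a = \bigcap_(j in `I_k) [set b | b j = a j]).
  by apply: fin_bigcap_measurable => // j _; exact: measurable_digit.
by apply/seteqP; split => b h j; exact: h.
Qed.

(** Cylinders are named by finite words instead of sequences, so that there are
    visibly countably many of them. *)
Definition ext_digits (s : seq (digit N)) : ZA := fun j => nth (digit0 N) s j.

Lemma ZA_cylinder_ext k (a : ZA) :
  exists s : seq (digit N), size s = k /\ cylinder k a = cylinder (size s) (ext_digits s).
Proof.
exists (mkseq a k); rewrite size_mkseq; split => //.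
by apply/seteqP; split => b h j jk; rewrite h// /ext_digits nth_mkseq.
Qed.

Lemma open_ZA_cylinders (U : set ZA) : open U ->
  U = \bigcup_(s in [set s | cylinder (size s) (ext_digits s) `<=` U])
        cylinder (size s) (ext_digits s).
Proof.
move=> oU; apply/seteqP; split => [a Ua|a [s sU sa]]; last exact: sU.
have [k kU] := nbhs_ZA_cylinder (open_nbhs_nbhs (conj oU Ua)).
have [s [sk sE]] := ZA_cylinder_ext k a.
by exists s; rewrite /= -sE.
Qed.

Lemma measurable_ZAP d' (S : measurableType d') (f : S -> ZA) :
  (forall j c, measurable [set s | f s j = c]) -> measurable_fun setT f.
Proof.
move=> mf; apply: (@measurable_into_borel _ _ ZA) => U oU.
rewrite (open_ZA_cylinders oU) preimage_bigcup bigcup_mkcond.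
apply: countable_bigcupT_measurable => // s; case: ifP => // _.
rewrite (_ : _ @^-1` _ = \bigcap_(j in `I_(size s)) [set x | f x j = ext_digits s j]).
  by apply: fin_bigcap_measurable => // j _; exact: mf.
by apply/seteqP; split => b h j; exact: h.
Qed.

End ZAMeasurable.

(** * Closed linear spans in L^2 *)

Section NormSquare.
Context (R : realType).
Implicit Types z w : R[i].

(** All estimates use squared moduli and this parallelogram bound in place of
    Minkowski's inequality; the factor 2 is harmless for density arguments. *)
Lemma normc2D_le z w :
  normc (z + w) ^+ 2 <= 2 * normc z ^+ 2 + 2 * normc w ^+ 2.
Proof.
rewrite !normc_sqr !raddfD /=.
have := sqr_ge0 (complex.Re z - complex.Re w).
have := sqr_ge0 (complex.Im z - complex.Im w).
move: (complex.Re z) (complex.Im z) (complex.Re w) (complex.Im w) => a b c e.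
nra.
Qed.

Lemma normc2M z w : normc (z * w) ^+ 2 = normc z ^+ 2 * normc w ^+ 2.
Proof. by rewrite !normc_sqr cReM cImM; ring. Qed.

Lemma normc2_real (r : R) : normc (r%:C%C) ^+ 2 = r ^+ 2.
Proof. by rewrite normc_sqr /= expr0n addr0. Qed.

Lemma normc2_eq0 z : (normc z ^+ 2 == 0) = (z == 0).
Proof.
rewrite normc_sqr; case: z => a b /=; rewrite eq_complex /=.
by rewrite paddr_eq0 ?sqr_ge0// !sqrf_eq0.
Qed.

Lemma normc2_0 : normc (0 : R[i]) ^+ 2 = 0.
Proof. by rewrite Normc.normc0 expr0n. Qed.

Lemma normc2_1 : normc (1 : R[i]) ^+ 2 = 1.
Proof. by rewrite Normc.normc1 expr1n. Qed.

Lemma normc2X z n : normc (z ^+ n) ^+ 2 = (normc z ^+ 2) ^+ n.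
Proof.
elim: n => [|n IH]; last by rewrite (exprS z) normc2M IH -exprS.
by rewrite !expr0 Normc.normc1 expr1n.
Qed.

Lemma normc2V z : normc (z^-1) ^+ 2 = (normc z ^+ 2)^-1.
Proof. by rewrite Normc.normcV exprVn. Qed.

Lemma normc2_conj z : normc (z^*)%C ^+ 2 = normc z ^+ 2.
Proof. by case: z => a b; rewrite !normc_sqr /= sqrrN. Qed.

Lemma cplx_mul_conj z : z * (z^*)%C = (normc z ^+ 2)%:C%C.
Proof. by rewrite -sqr_normc normr_normc -rmorphXn. Qed.

Lemma esqn_ge0 z : (0 <= (normc z ^+ 2)%:E)%E.
Proof. by rewrite lee_fin sqr_ge0. Qed.

End NormSquare.

Lemma probability_lty d (X : measurableType d) (R : realType)
    (P : probability X R) : (P setT < +oo)%E.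
Proof. by apply: (@le_lt_trans _ _ 1%E); [exact: probability_le1|exact: ltry]. Qed.

(** The coefficients are a function of the index, as in the completeness clause
    of an orthonormal basis; with a repeated index in s the coefficient counts
    with multiplicity. *)
Definition lincomb (R : realType) (I X : Type) (psi : I -> X -> R[i])
    (g : X -> R[i]) : Prop :=
  exists s (c : I -> R[i]), forall x, g x = \sum_(i <- s) c i * psi i x.

Section LinComb.
Context (R : realType) (I : eqType) (X : Type) (psi : I -> X -> R[i]).

(** A repeated index can be absorbed in its coefficient. This is needed to add
    combinations: the coefficient functions of two combinations may differ on a
    common index. *)
Lemma lincomb_uniq g : lincomb psi g ->
  exists s (c : I -> R[i]), uniq s /\ forall x, g x = \sum_(i <- s) c i * psi i x.
Proof.
move=> [s [c gE]]; exists (undup s), (fun i => c i *+ count_mem i s).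
split=> [|x]; first exact: undup_uniq.
rewrite gE -big_undup_iterop_count; apply: eq_bigr => i _.
by rewrite Monoid.iteropE iter_addr_0 mulrnAl.
Qed.

Lemma lincombD g h : lincomb psi g -> lincomb psi h ->
  lincomb psi (fun x => g x + h x).
Proof.
move=> /lincomb_uniq[s1 [c1 [u1 gE]]] /lincomb_uniq[s2 [c2 [u2 hE]]].
exists (undup (s1 ++ s2)),
  (fun i => (if i \in s1 then c1 i else 0) + (if i \in s2 then c2 i else 0)) => x.
under eq_bigr do rewrite mulrDl.
rewrite big_split /= gE hE; congr (_ + _).
  under [RHS]eq_bigr do rewrite (fun_if (fun a => a * _)) mul0r.
  rewrite -big_mkcond -[RHS]big_filter; apply: perm_big; apply: uniq_perm => //.
    by rewrite filter_uniq// undup_uniq.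
  by move=> i; rewrite mem_filter mem_undup mem_cat; case: (i \in s1).
under [RHS]eq_bigr do rewrite (fun_if (fun a => a * _)) mul0r.
rewrite -big_mkcond -[RHS]big_filter; apply: perm_big; apply: uniq_perm => //.
  by rewrite filter_uniq// undup_uniq.
by move=> i; rewrite mem_filter mem_undup mem_cat; case: (i \in s2); rewrite ?orbT.
Qed.

Lemma lincombZ a g : lincomb psi g -> lincomb psi (fun x => a * g x).
Proof.
move=> [s [c gE]]; exists s, (fun i => a * c i) => x.
by rewrite gE mulr_sumr; apply: eq_bigr => i _; rewrite mulrA.
Qed.

Lemma lincomb0 : lincomb psi (fun=> 0).
Proof. by exists [::], (fun=> 0) => x; rewrite big_nil. Qed.

Lemma lincomb_gen i : lincomb psi (psi i).
Proof. by exists [:: i], (fun=> 1) => x; rewrite big_seq1 mul1r. Qed.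

Lemma lincomb_sum (J : Type) (s : seq J) (h : J -> X -> R[i]) :
  (forall j, lincomb psi (h j)) -> lincomb psi (fun x => \sum_(j <- s) h j x).
Proof.
move=> lh; elim: s => [|j s IH].
  by under eq_fun do rewrite big_nil; exact: lincomb0.
by under eq_fun do rewrite big_cons; exact: lincombD.
Qed.

End LinComb.

(** Membership in the L^2-closure of the span. *)
Definition in_span (d : measure_display) (X : measurableType d) (R : realType)
    (rho : {measure set X -> \bar R}) (I : eqType) (psi : I -> X -> R[i])
    (f : X -> R[i]) : Prop :=
  forall e : R, 0 < e -> exists2 g, lincomb psi g &
    (\int[rho]_x (normc (f x - g x) ^+ 2)%:E < e%:E)%E.

Section InSpan.
Context (dX : measure_display) (X : measurableType dX) (R : realType).
Context (rho : {measure set X -> \bar R}) (I : eqType) (psi : I -> X -> R[i]).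
Hypothesis mpsi : forall i, measurable_fun setT (psi i).
Implicit Types f g h : X -> R[i].

Let EFin_quarters (e : R) : (e%:E = 2%:E * (e / 4)%:E + 2%:E * (e / 4)%:E)%E.
Proof. by rewrite -!EFinM -EFinD; congr (_%:E); field. Qed.

Lemma measurable_sqn f : measurable_fun setT f ->
  measurable_fun setT (fun x => (normc (f x) ^+ 2)%:E).
Proof. by move=> mf; apply/measurable_EFinP; exact: measurable_normc2. Qed.

Lemma measurable_lincomb g : lincomb psi g -> measurable_fun setT g.
Proof.
move=> [s [c gE]]; rewrite (funext gE); apply: measurable_cplx_sum => i.
by apply: measurable_cplxM => //; exact: measurable_cst.
Qed.

Lemma sqnD_le f g : measurable_fun setT f -> measurable_fun setT g ->
  (\int[rho]_x (normc (f x + g x) ^+ 2)%:E <=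
   2%:E * \int[rho]_x (normc (f x) ^+ 2)%:E +
   2%:E * \int[rho]_x (normc (g x) ^+ 2)%:E)%E.
Proof.
move=> mf mg.
have [mf2 mg2] := (measurable_sqn mf, measurable_sqn mg).
have p0 (h : X -> R[i]) x : [set: X] x -> (0 <= (normc (h x) ^+ 2)%:E)%E.
  by move=> _; rewrite lee_fin sqr_ge0.
have q0 (h : X -> R[i]) x : [set: X] x -> (0 <= 2%:E * (normc (h x) ^+ 2)%:E)%E.
  by move=> _; rewrite mule_ge0// lee_fin sqr_ge0.
rewrite -(ge0_integralZl rho measurableT mf2 (p0 f))//.
rewrite -(ge0_integralZl rho measurableT mg2 (p0 g))//.
rewrite -(ge0_integralD rho measurableT (q0 f) _ (q0 g)) /=; last 2 first.
  exact: measurable_funeM.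
  exact: measurable_funeM.
apply: ge0_le_integral => //.
- by move=> x _; rewrite lee_fin sqr_ge0.
- by apply: measurable_sqn; exact: measurable_cplxD.
- by apply: emeasurable_funD; exact: measurable_funeM.
- by move=> x _; rewrite -!EFinM -EFinD lee_fin normc2D_le.
Qed.

Lemma sqnZ a f : measurable_fun setT f ->
  (\int[rho]_x (normc (a * f x) ^+ 2)%:E =
   (normc a ^+ 2)%:E * \int[rho]_x (normc (f x) ^+ 2)%:E)%E.
Proof.
move=> mf; rewrite -ge0_integralZl ?lee_fin ?sqr_ge0//.
- by apply: eq_integral => x _; rewrite normc2M EFinM.
- exact: measurable_sqn.
- by move=> x _; rewrite lee_fin sqr_ge0.
Qed.

(** Bounds by e and by eps^2 are interchangeable through square roots. *)
Lemma in_spanP f : in_span rho psi f <->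
  (forall eps : R, 0 < eps -> exists (s : seq I) (c : I -> R[i]),
     (\int[rho]_x (normc (f x - \sum_(i <- s) c i * psi i x) ^+ 2)%:E
        < (eps ^+ 2)%:E)%E).
Proof.
split=> [fs eps e0|fs e e0].
  have [g [s [c gE]] ge] := fs _ (exprn_gt0 2 e0).
  by exists s, c; move: ge; under eq_integral do rewrite gE.
have [|s [c sc]] := fs (Num.sqrt e); first by rewrite sqrtr_gt0.
exists (fun x => \sum_(i <- s) c i * psi i x); first by exists s, c.
by move: sc; rewrite sqr_sqrtr// ltW.
Qed.

Lemma lincomb_in_span g : lincomb psi g -> in_span rho psi g.
Proof.
move=> lg e e0; exists g => //; under eq_integral do rewrite subrr.
rewrite (_ : (fun _ => _) = cst 0%E).
  by rewrite integral_cst//= mul0e lte_fin.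
by apply/funext => x; rewrite Normc.normc0 expr0n.
Qed.

(** The closure is closed. *)
Lemma in_span_lim f : measurable_fun setT f ->
  (forall e : R, 0 < e -> exists2 g, measurable_fun setT g /\ in_span rho psi g &
    (\int[rho]_x (normc (f x - g x) ^+ 2)%:E < e%:E)%E) ->
  in_span rho psi f.
Proof.
move=> mf fg e e0; have e40 : 0 < e / 4 by rewrite divr_gt0.
have [g [mg gs] fge] := fg _ e40.
have [h lh gh] := gs _ e40; exists h => //.
have mh := measurable_lincomb lh.
rewrite (eq_integral (fun x => (normc ((f x - g x) + (g x - h x)) ^+ 2)%:E)); last first.
  by move=> x _; rewrite addrA subrK.
apply: le_lt_trans (sqnD_le (measurable_cplxB mf mg) (measurable_cplxB mg mh)) _.
by rewrite EFin_quarters lteD// lte_pmul2l.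
Qed.

Lemma in_spanD f g : measurable_fun setT f -> measurable_fun setT g ->
  in_span rho psi f -> in_span rho psi g -> in_span rho psi (fun x => f x + g x).
Proof.
move=> mf mg fs gs e e0; have e40 : 0 < e / 4 by rewrite divr_gt0.
have [f' lf' ff'] := fs _ e40; have [g' lg' gg'] := gs _ e40.
exists (fun x => f' x + g' x); first exact: lincombD.
have [mf' mg'] := (measurable_lincomb lf', measurable_lincomb lg').
under eq_integral => x _ do rewrite opprD addrACA.
apply: le_lt_trans (sqnD_le (measurable_cplxB mf mf') (measurable_cplxB mg mg')) _.
by rewrite EFin_quarters lteD// lte_pmul2l.
Qed.

Lemma in_spanZ a f : measurable_fun setT f ->
  in_span rho psi f -> in_span rho psi (fun x => a * f x).
Proof.
move=> mf fs e e0; have a0 : 0 < normc a ^+ 2 + 1 by rewrite ltr_wpDl ?sqr_ge0.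
have [g lg fg] := fs (e / (normc a ^+ 2 + 1)) (divr_gt0 e0 a0).
exists (fun x => a * g x); first exact: lincombZ.
under eq_integral do rewrite -mulrBr.
rewrite sqnZ; last by apply: measurable_cplxB => //; exact: measurable_lincomb.
apply: (@le_lt_trans _ _ ((normc a ^+ 2 + 1)%:E *
    \int[rho]_x (normc (f x - g x) ^+ 2)%:E)%E).
  apply: lee_wpmul2r; last by rewrite lee_fin lerDl.
  by apply: integral_ge0 => x _; rewrite lee_fin sqr_ge0.
rewrite (_ : e%:E = ((normc a ^+ 2 + 1)%:E * (e / (normc a ^+ 2 + 1))%:E)%E).
  by rewrite lte_pmul2l.
by rewrite -EFinM mulrC divfK// gt_eqF.
Qed.

Lemma in_span_sum (J : Type) (s : seq J) (h : J -> X -> R[i]) :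
  (forall j, measurable_fun setT (h j)) -> (forall j, in_span rho psi (h j)) ->
  in_span rho psi (fun x => \sum_(j <- s) h j x).
Proof.
move=> mh sh; elim: s => [|j s IH].
  by under eq_fun do rewrite big_nil; apply: lincomb_in_span; exact: lincomb0.
under eq_fun do rewrite big_cons; apply: in_spanD => //.
exact: measurable_cplx_sum.
Qed.

Lemma ae_in_span f g : measurable_fun setT f -> measurable_fun setT g ->
  {ae rho, forall x, f x = g x} -> in_span rho psi f -> in_span rho psi g.
Proof.
move=> mf mg fg fs e e0; have [h lh fh] := fs e e0; exists h => //.
have mh := measurable_lincomb lh.
rewrite (ae_eq_integral (fun x => (normc (f x - h x) ^+ 2)%:E))//.
- by apply: measurable_sqn; exact: measurable_cplxB.
- by apply: measurable_sqn; exact: measurable_cplxB.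
- by apply: filterS fg => x -> _.
Qed.

End InSpan.

(** * Density of algebras of bounded functions *)

Section BoundedAlgebra.
Context (dX : measure_display) (X : measurableType dX) (R : realType).
Context (rho : {measure set X -> \bar R}) (I : eqType) (psi : I -> X -> R[i]).
Hypothesis rho_fin : (rho setT < +oo)%E.
Hypothesis mpsi : forall i, measurable_fun setT (psi i).
Hypothesis psi_unit : forall i x, normc (psi i x) ^+ 2 = 1.
Hypothesis psiM : forall i j, exists k, forall x, psi i x * psi j x = psi k x.
Hypothesis psi1 : exists i, forall x, psi i x = 1.

(** The bounded functions in the closed span. Boundedness is what makes this
    class an algebra: multiplication by a bounded function is continuous in
    L^2. *)
Definition bspan (f : X -> R[i]) : Prop :=
  [/\ measurable_fun setT f, exists C : R, forall x, normc (f x) ^+ 2 <= C &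
      in_span rho psi f].

Lemma bspan_psi i : bspan (psi i).
Proof.
split=> //; first by exists 1 => x; rewrite psi_unit.
by apply: lincomb_in_span; exact: lincomb_gen.
Qed.

Lemma bspanD f g : bspan f -> bspan g -> bspan (fun x => f x + g x).
Proof.
move=> [mf [C fC] sf] [mg [D gD] sg]; split.
- exact: measurable_cplxD.
- exists (2 * C + 2 * D) => x; apply: le_trans (normc2D_le _ _) _.
  by rewrite lerD// ler_pM2l.
- exact: in_spanD.
Qed.

Lemma bspanZ a f : bspan f -> bspan (fun x => a * f x).
Proof.
move=> [mf [C fC] sf]; split.
- by apply: measurable_cplxM => //; exact: measurable_cst.
- by exists (normc a ^+ 2 * C) => x; rewrite normc2M ler_wpM2l// sqr_ge0.
- exact: in_spanZ.
Qed.

Lemma bspan_cst a : bspan (fun=> a).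
Proof.
have [i psi_i] := psi1; have := bspanZ a (bspan_psi i).
by under eq_fun do rewrite psi_i mulr1.
Qed.

Let in_span_psiM i g : measurable_fun setT g -> in_span rho psi g ->
  in_span rho psi (fun x => psi i x * g x).
Proof.
move=> mg sg e e0; have [h [s [c hE]] gh] := sg e e0.
exists (fun x => psi i x * h x).
  under eq_fun do rewrite hE mulr_sumr.
  apply: (@lincomb_sum _ _ _ _ _ _ (fun j x => psi i x * (c j * psi j x))) => j.
  have [k psik] := psiM i j.
  under eq_fun do rewrite mulrCA psik.
  by apply: lincombZ; exact: lincomb_gen.
by under eq_integral do rewrite -mulrBr normc2M psi_unit mul1r.
Qed.

(** First approximate f by a combination p of the psi_i, with an error that the
    bound D of g absorbs; then p * g is a combination of the psi_i * g, and
    multiplication by psi_i maps the closed span to itself because |psi_i| = 1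
    and the family is closed under products. *)
Lemma bspanM f g : bspan f -> bspan g -> bspan (fun x => f x * g x).
Proof.
move=> [mf [C fC] sf] [mg [D gD] sg]; split.
- exact: measurable_cplxM.
- exists (C * D) => x; rewrite normc2M.
  by apply: ler_pM => //; exact: sqr_ge0.
apply: in_span_lim => //; first exact: measurable_cplxM.
move=> e e0; have D0 : 0 < D + 1.
  rewrite ltr_wpDl//; apply: le_trans (gD point); exact: sqr_ge0.
have [p lp fp] := sf (e / (D + 1)) (divr_gt0 e0 D0).
have mp := measurable_lincomb mpsi lp.
exists (fun x => p x * g x).
  split; first exact: measurable_cplxM.
  have [s [c pE]] := lp.
  under eq_fun do rewrite pE mulr_suml.
  apply: (@in_span_sum _ _ _ _ _ _ mpsi _ _ (fun i x => c i * psi i x * g x)) => i.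
    by do 2 apply: measurable_cplxM => //; exact: measurable_cst.
  under eq_fun do rewrite -mulrA; apply: in_spanZ => //.
    exact: measurable_cplxM.
  exact: in_span_psiM.
have mfp := measurable_sqn (measurable_cplxB mf mp).
apply: (@le_lt_trans _ _ ((D + 1)%:E * \int[rho]_x (normc (f x - p x) ^+ 2)%:E)%E).
  rewrite -ge0_integralZl//; last 2 first.
    by move=> x _; rewrite lee_fin sqr_ge0.
    by rewrite lee_fin ltW.
  apply: ge0_le_integral => //.
  - by move=> x _; rewrite lee_fin sqr_ge0.
  - by apply: measurable_sqn; apply: measurable_cplxB; exact: measurable_cplxM.
  - exact: measurable_funeM.
  move=> x _; rewrite -EFinM lee_fin -mulrBl normc2M mulrC.
  by rewrite ler_wpM2r ?sqr_ge0// (le_trans (gD x))// lerDl.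
rewrite (_ : e%:E = ((D + 1)%:E * (e / (D + 1))%:E)%E).
  by rewrite lte_pmul2l.
by rewrite -EFinM mulrC divfK// gt_eqF.
Qed.

Lemma bspanX f n : bspan f -> bspan (fun x => f x ^+ n).
Proof.
move=> bf; elim: n => [|n IH].
  by under eq_fun do rewrite expr0; exact: bspan_cst.
by under eq_fun do rewrite exprS; exact: bspanM.
Qed.

(** Dominated convergence for the squared distances. *)
Lemma in_span_cvg (u : nat -> X -> R[i]) (f : X -> R[i]) (G : X -> R) :
  measurable_fun setT f -> (forall n, measurable_fun setT (u n)) ->
  (forall n, in_span rho psi (u n)) ->
  rho.-integrable setT (fun x => (G x)%:E) ->
  (forall n x, normc (f x - u n x) ^+ 2 <= G x) ->
  (forall x, (fun n => normc (f x - u n x) ^+ 2) @ \oo --> (0 : R)) ->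
  in_span rho psi f.
Proof.
move=> mf mu su iG uG uf; apply: in_span_lim => // e e0.
have [|||||_ + _] := @dominated_convergence _ X R rho setT measurableT
    (fun n x => (normc (f x - u n x) ^+ 2)%:E) (cst 0%E) (fun x => (G x)%:E).
- by move=> n; apply: measurable_sqn; exact: measurable_cplxB.
- exact: measurable_cst.
- apply: aeW => x _; apply: cvg_EFin; first exact: nearW.
  exact: uf.
- exact: iG.
- by apply: aeW => x n _; rewrite gee0_abs ?lee_fin ?sqr_ge0.
move=> cv.
have /cv[n _ /(_ n (leqnn _)) /= une] : nbhs (0 : \bar R)%E [set y | (y < e%:E)%E].
  by apply: open_nbhs_nbhs; split; [exact: open_ereal_lt_ereal|rewrite /= lte_fin].
exists (u n) => //; apply: le_lt_trans une.
rewrite le_eqVlt; apply/orP; left; apply/eqP; apply: eq_integral => x _.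
by rewrite subr0 ger0_norm ?sqr_ge0.
Qed.

Lemma bspan_lim (u : nat -> X -> R[i]) (f : X -> R[i]) (C : R) :
  (forall n, bspan (u n)) -> measurable_fun setT f ->
  (forall x, normc (f x) ^+ 2 <= C) -> (forall n x, normc (u n x) ^+ 2 <= C) ->
  (forall x, (fun n => normc (f x - u n x) ^+ 2) @ \oo --> (0 : R)) ->
  bspan f.
Proof.
move=> bu mf fC uC uf; split => //; first by exists C.
apply: (@in_span_cvg u _ (fun=> 2 * C + 2 * C)) => //.
- by move=> n; case: (bu n).
- by move=> n; case: (bu n).
- apply/integrableP; split; first exact: measurable_cst.
  by rewrite integral_cst//= lte_mul_pinfty.
- move=> n x; apply: le_trans (normc2D_le _ _) _.
  by rewrite lerD// ler_pM2l// normcNE.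
Qed.

(** The complex valued indicator, in the form in which it occurs in the
    definition of a wavelet. *)
Definition ind (B : set X) (x : X) : R[i] := (\1_B x)%:C%C.

Lemma indCE (B : set X) (x : X) : ind B x = if x \in B then 1 else 0.
Proof. by rewrite /ind indicE; case: (x \in B). Qed.

Lemma measurable_ind B : measurable B -> measurable_fun setT (ind B).
Proof. by move=> mB; apply: measurable_cplx_real; exact: measurable_indic. Qed.

(** Products and affine combinations of indicators give finite unions and
    complements; bounded pointwise limits give countable unions. *)
Lemma bspan_sigma_algebra :
  sigma_algebra setT [set B : set X | measurable B /\ bspan (ind B)].
Proof.
have ind0 : bspan (ind set0).
  rewrite (_ : ind set0 = fun=> 0); first exact: bspan_cst.
  by apply/funext => x; rewrite /ind indic0.
have indU A B : bspan (ind A) -> bspan (ind B) -> bspan (ind (A `|` B)).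
  move=> bA bB; rewrite (_ : ind _ = fun x => ind A x + (ind B x + (-1) * (ind A x * ind B x))).
    by apply: bspanD => //; apply: bspanD => //; apply: bspanZ; exact: bspanM.
  apply/funext => x; rewrite !indCE in_setU.
  by case: (x \in A); case: (x \in B); rewrite /=; ring.
split=> [||F mF] /=.
- by split.
- move=> A [mA bA]; split; first exact: measurableD.
  rewrite (_ : ind _ = fun x => 1 + (-1) * ind A x).
    by apply: bspanD; [exact: bspan_cst|exact: bspanZ].
  apply/funext => x; rewrite !indCE setTD in_setC.
  by case: (x \in A); rewrite /=; ring.
have mU : measurable (\bigcup_i F i) by apply: bigcup_measurable => k _; case: (mF k).
split=> //; have le1 A x : normc (ind A x) ^+ 2 <= 1.
  rewrite /ind normc2_real indicE; case: (x \in A); by rewrite ?expr1n// expr0n.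
apply: (@bspan_lim (fun n => ind (\big[setU/set0]_(i < n) F i)) _ 1) => //.
- elim=> [|n IH]; first by rewrite big_ord0.
  by rewrite big_ord_recr /=; apply: indU => //; case: (mF n).
- exact: measurable_ind.
move=> x; apply: cvg_near_cst.
have [[k _ Fkx]|nFx] := pselect ((\bigcup_i F i) x).
  exists k.+1 => // n kn; rewrite !indCE !mem_set ?subrr ?Normc.normc0 ?expr0n//.
    by rewrite -bigcup_mkord; exists k.
  by exists k.
apply: nearW => n; rewrite !indCE !memNset ?subrr ?Normc.normc0 ?expr0n//.
by rewrite -bigcup_mkord => -[k _ Fk]; apply: nFx; exists k.
Qed.

Hypothesis ind_span : forall B, measurable B -> bspan (ind B).

Lemma bspan_nnsfun (h : {nnsfun X >-> R}) : bspan (fun x => (h x)%:C%C).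
Proof.
have [s hE] : exists s : seq R, forall x, h x = \sum_(y <- s) y * \1_(h @^-1` [set y]) x.
  exists (finmap.enum_fset (fset_set (range h))) => x.
  by rewrite [in LHS](fimfunE h x) fsbig_finite.
under eq_fun do rewrite hE rmorph_sum /=.
elim: s {hE} => [|y s IH].
  by under eq_fun do rewrite big_nil; exact: bspan_cst.
under eq_fun do rewrite big_cons.
apply: bspanD => //; under eq_fun do rewrite rmorphM /=.
by apply: bspanZ; exact: ind_span.
Qed.

Lemma in_span_nonneg (f : X -> R) : measurable_fun setT f -> (forall x, 0 <= f x) ->
  (\int[rho]_x ((f x) ^+ 2)%:E < +oo)%E -> in_span rho psi (fun x => (f x)%:C%C).
Proof.
move=> mf f0 if2.
have mEf : measurable_fun setT (EFin \o f) by exact/measurable_EFinP.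
pose h := nnsfun_approx measurableT mEf.
have hf n x : h n x <= f x.
  by rewrite -lee_fin /h nnsfun_approxE; apply: le_approx => // y _; rewrite lee_fin.
apply: (@in_span_cvg (fun n x => (h n x)%:C%C) _ (fun x => f x ^+ 2)).
- exact: measurable_cplx_real.
- by move=> n; apply: measurable_cplx_real.
- by move=> n; case: (bspan_nnsfun (h n)).
- apply/integrableP; split; first by apply/measurable_EFinP; exact: measurable_funX.
  by under eq_integral do rewrite gee0_abs ?lee_fin ?sqr_ge0//.
- move=> n x; rewrite -raddfB normc2_real ler_sqr ?nnegrE ?subr_ge0//.
  by rewrite lerBlDr lerDl.
move=> x; rewrite (_ : (fun _ => _) = (fun n => (f x - h n x) * (f x - h n x))); last first.
  by apply/funext => n; rewrite -raddfB normc2_real expr2.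
have hx : (fun n => f x - h n x) @ \oo --> (0 : R).
  rewrite -(subrr (f x)); apply: cvgB; first exact: cvg_cst.
  have : (EFin \o (h ^~ x)) @ \oo --> (f x)%:E.
    by apply: (@cvg_nnsfun_approx _ _ _ _ measurableT _ mEf) => // y _; rewrite lee_fin.
  by move/fine_cvgP => [].
by rewrite -(mulr0 (0 : R)); exact: cvgM.
Qed.

(** Simple functions are in the span once indicators are; monotone
    approximation reaches the nonnegative functions, and a complex function is
    a combination of four of these. *)
Lemma L2_in_span (f : X -> R[i]) : measurable_fun setT f ->
  (\int[rho]_x (normc (f x) ^+ 2)%:E < +oo)%E -> in_span rho psi f.
Proof.
move=> mf if2.
have part (g : X -> R) : measurable_fun setT g -> (forall x, g x ^+ 2 <= normc (f x) ^+ 2) ->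
    in_span rho psi (fun x => (g x)%:C%C).
  move=> mg gf; rewrite (_ : (fun _ => _) =
    (fun x => (g^\+ x)%:C%C + (-1) * (g^\- x)%:C%C)); last first.
    apply/funext => x; rewrite mulN1r -raddfB /=.
    by rewrite -[in LHS](funrposBneg g).
  have i2 (k : X -> R) : measurable_fun setT k -> (forall x, k x ^+ 2 <= g x ^+ 2) ->
      (\int[rho]_x ((k x) ^+ 2)%:E < +oo)%E.
    move=> mk kg; apply: le_lt_trans if2; apply: ge0_le_integral => //.
    - by move=> x _; rewrite lee_fin sqr_ge0.
    - by apply/measurable_EFinP; exact: measurable_funX.
    - exact: measurable_sqn.
    - by move=> x _; rewrite lee_fin (le_trans (kg x)).
  have mp := measurable_funrpos mg; have mn := measurable_funrneg mg.
  apply: in_spanD => //; first exact: measurable_cplx_real.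
  - by apply: measurable_cplxM; [exact: measurable_cst|exact: measurable_cplx_real].
  - apply: in_span_nonneg => //; apply: i2 => // x.
    by rewrite /funrpos maxEle; case: ifP; rewrite ?expr0n ?sqr_ge0.
  - apply: in_spanZ => //; first exact: measurable_cplx_real.
    apply: in_span_nonneg => //; apply: i2 => // x.
    by rewrite /funrneg maxEle; case: ifP; rewrite ?sqrrN ?expr0n ?sqr_ge0.
have mR := measurable_Re mf; have mI := measurable_Im mf.
rewrite (_ : f = fun x => (complex.Re (f x))%:C%C + 'i%C * (complex.Im (f x))%:C%C).
  apply: in_spanD => //; first exact: measurable_cplx_real.
  - by apply: measurable_cplxM; [exact: measurable_cst|exact: measurable_cplx_real].
  - by apply: part => // x; rewrite normc_sqr lerDl sqr_ge0.
  - apply: in_spanZ => //; first exact: measurable_cplx_real.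
    by apply: part => // x; rewrite normc_sqr lerDr sqr_ge0.
by apply/funext => x; rewrite mulrC; case: (f x) => a b; simpc.
Qed.

End BoundedAlgebra.

(** * Integrals of complex functions and characters of the torus *)

Section StepLimit.
Context (R : realType).

Lemma bernoulli_ineq (y : R) n : -1 <= y -> 1 + n%:R * y <= (1 + y) ^+ n.
Proof.
move=> y1; elim: n => [|n IH]; first by rewrite mul0r addr0 expr0.
rewrite exprS; apply: (@le_trans _ _ ((1 + y) * (1 + n%:R * y))).
  rewrite -natr1; have : 0 <= n%:R * y ^+ 2 by rewrite mulr_ge0 ?sqr_ge0.
  move: (n%:R : R) => k; rewrite expr2; nra.
by rewrite ler_wpM2l//; lra.
Qed.

Lemma cvg_natM_exp (r : R) : 0 <= r < 1 ->
  (fun n => n%:R * r ^+ n) @ \oo --> (0 : R).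
Proof.
move=> /andP[r0 r1]; have [->|rn0] := eqVneq r 0.
  apply: cvg_near_cst; apply: nearW => -[|n]; first by rewrite mul0r.
  by rewrite expr0n mulr0.
pose t := Num.sqrt r.
have t0 : 0 < t by rewrite sqrtr_gt0 lt_neqAle eq_sym rn0.
have t1 : t < 1 by rewrite -sqrtr1 ltr_sqrt.
have tV : 0 < t^-1 - 1 by rewrite subr_gt0 invf_gt1.
apply: (@squeeze_cvgr _ _ _ _ (cst 0) (fun n => (t^-1 - 1)^-1 * t ^+ n)).
- apply: nearW => n; rewrite mulr_ge0 ?exprn_ge0//=.
  rewrite (_ : r = t * t); last by rewrite -expr2 sqr_sqrtr.
  rewrite exprMn mulrA ler_wpM2r ?exprn_ge0 ?(ltW t0)//.
  rewrite -[leRHS]mul1r ler_pdivlMr//.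
  have tn0 : 0 < t ^+ n by rewrite exprn_gt0.
  rewrite mulrAC -ler_pdivlMr// mul1r -exprVn.
  have := @bernoulli_ineq (t^-1 - 1) n; rewrite subrKC => B.
  by apply: le_trans (B _); rewrite ?lerDr//; lra.
- exact: cvg_cst.
rewrite -(mulr0 (t^-1 - 1)^-1); apply: cvgMl_tmp.
by apply: cvg_expr; rewrite ger0_norm// ltW.
Qed.

(** Polynomials in u that converge pointwise to the indicator of u < 1/2, also
    at the point u = 1/2 itself. Below 1/2, Bernoulli's inequality bounds the
    value below by 1 - n (2u)^n. From 1/2 on, u^n >= 2^-n, and (1 - y)^(1/y) <=
    1/2 at y = 2^-n, again by Bernoulli's inequality applied to (1 + y)^(1/y)
    >= 2. *)
Lemma cvg_step (u : R) : 0 <= u <= 1 ->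
  (fun n => (1 - u ^+ n) ^+ (n * 2 ^ n)) @ \oo --> ((u < 1 / 2)%R%:R : R).
Proof.
move=> /andP[u0 u1]; have un n : 0 <= u ^+ n <= 1 by rewrite exprn_ge0//= exprn_ile1.
have [u2|u2] := ltP u (1 / 2).
  apply: (@squeeze_cvgr _ _ _ _ (fun n => 1 - n%:R * (2 * u) ^+ n) (cst 1)).
  - apply: nearW => n; have /andP[a0 a1] := un n; apply/andP; split; last first.
      by rewrite exprn_ile1//; lra.
    have := @bernoulli_ineq (- u ^+ n) (n * 2 ^ n); rewrite mulrN.
    by rewrite exprMn mulrA natrM natrX; apply; lra.
  - rewrite -[X in _ --> X](subr0 1); apply: cvgB; first exact: cvg_cst.
    by apply: cvg_natM_exp; lra.
  - exact: cvg_cst.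
apply: (@squeeze_cvgr _ _ _ _ (cst 0) (fun n => (1 / 2) ^+ n)).
- apply: nearW => n; have /andP[a0 a1] := un n; apply/andP; split.
    by rewrite exprn_ge0//; lra.
  rewrite mulnC exprM; apply: lerXn2r; rewrite ?nnegrE ?exprn_ge0 ?divr_ge0//; first lra.
  have m0 : 0 < (2 ^ n)%:R :> R by rewrite ltr0n expn_gt0.
  pose y : R := ((2 ^ n)%:R)^-1.
  have y0 : 0 < y by rewrite invr_gt0.
  have yu : y <= u ^+ n.
    rewrite /y natrX -exprVn; apply: lerXn2r; rewrite ?nnegrE//.
    by move: u2; rewrite mul1r.
  apply: (@le_trans _ _ ((1 - y) ^+ (2 ^ n))).
    by apply: lerXn2r; rewrite ?nnegrE; lra.
  have B := @bernoulli_ineq y (2 ^ n); rewrite mulfV ?gt_eqF// in B.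
  have {}B := B (ltW (lt_trans (ltrN10 _) y0)).
  have P0 : 0 < (1 + y) ^+ (2 ^ n) by rewrite exprn_gt0//; lra.
  have : (1 - y) ^+ (2 ^ n) * (1 + y) ^+ (2 ^ n) <= 1.
    by rewrite -exprMn exprn_ile1//; nra.
  have : 0 <= (1 - y) ^+ (2 ^ n) by rewrite exprn_ge0//; lra.
  move: B P0; move: ((1 - y) ^+ _) ((1 + y) ^+ _) => p q; nra.
- exact: cvg_cst.
- by apply: cvg_expr; rewrite ger0_norm; lra.
Qed.

End StepLimit.

Section ComplexIntegral.
Context (dX : measure_display) (X : measurableType dX) (R : realType).
Implicit Types (rho : {measure set X -> \bar R}) (f g : X -> R[i]).

Definition cintegrable rho f : Prop :=
  rho.-integrable setT (EFin \o (fun x => complex.Re (f x))) /\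
  rho.-integrable setT (EFin \o (fun x => complex.Im (f x))).

Lemma cintegrable_le rho f (G : X -> R) : measurable_fun setT f ->
  measurable_fun setT G -> (\int[rho]_x (G x)%:E < +oo)%E ->
  (forall x, normc (f x) <= G x) -> cintegrable rho f.
Proof.
move=> mf mG iG fG.
have G0 x : 0 <= G x by apply: le_trans (fG x); exact: normc_ge0.
split; apply: (@le_integrable _ _ _ rho setT measurableT _ (EFin \o G)).
- by apply/measurable_EFinP; exact: measurable_Re.
- move=> x _ /=; rewrite lee_fin (ger0_norm (G0 x)); apply: le_trans (fG x).
  exact: (cplx_coord_le true).
- apply/integrableP; split; first exact/measurable_EFinP.
  by under eq_integral do rewrite gee0_abs ?lee_fin//.
- by apply/measurable_EFinP; exact: measurable_Im.
- move=> x _ /=; rewrite lee_fin (ger0_norm (G0 x)); apply: le_trans (fG x).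
  exact: (cplx_coord_le false).
- apply/integrableP; split; first exact/measurable_EFinP.
  by under eq_integral do rewrite gee0_abs ?lee_fin//.
Qed.

Lemma cintegrable_bounded rho f (C : R) : (rho setT < +oo)%E ->
  measurable_fun setT f -> (forall x, normc (f x) ^+ 2 <= C) -> cintegrable rho f.
Proof.
move=> rfin mf fC; apply: (@cintegrable_le _ _ (fun=> 1 + C)) => //.
  by rewrite integral_cst//= lte_mul_pinfty//= lee_fin addr_ge0// (le_trans (sqr_ge0 _) (fC point)).
move=> x; have := fC x; move: (normc_ge0 (f x)); move: (normc (f x)) => r; nra.
Qed.

Lemma cintegral_ext rho f g : f =1 g -> cintegral rho f = cintegral rho g.
Proof. by move=> fg; rewrite (funext fg). Qed.

Lemma cintegrableD rho f g : cintegrable rho f -> cintegrable rho g ->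
  cintegrable rho (fun x => f x + g x).
Proof.
move=> [f1 f2] [g1 g2]; split.
  rewrite (_ : _ \o _ = (EFin \o (fun x => complex.Re (f x))) \+ (EFin \o (fun x => complex.Re (g x)))).
    exact: integrableD.
  by apply/funext => x /=; rewrite raddfD.
rewrite (_ : _ \o _ = (EFin \o (fun x => complex.Im (f x))) \+ (EFin \o (fun x => complex.Im (g x)))).
  exact: integrableD.
by apply/funext => x /=; rewrite raddfD.
Qed.

Lemma cintegralD rho f g : cintegrable rho f -> cintegrable rho g ->
  cintegral rho (fun x => f x + g x) = cintegral rho f + cintegral rho g.
Proof.
move=> [f1 f2] [g1 g2]; rewrite /cintegral.
under eq_Rintegral do rewrite raddfD /=.
under [X in (_ +i* X)%C]eq_Rintegral do rewrite raddfD /=.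
by rewrite !RintegralD.
Qed.

Lemma integrable_cst_EFin rho (r : R) : (rho setT < +oo)%E ->
  rho.-integrable setT (fun=> r%:E).
Proof.
move=> rfin; apply/integrableP; split; first exact: measurable_cst.
by rewrite integral_cst//= lte_mul_pinfty.
Qed.

Lemma integrableZ_EFin rho (r : R) (u : X -> R) :
  rho.-integrable setT (EFin \o u) -> rho.-integrable setT (EFin \o (fun x => r * u x)).
Proof.
move=> iu; rewrite (_ : _ \o _ = (fun x => r%:E * (EFin \o u) x)%E).
  exact: integrableZl.
by apply/funext => x; rewrite /= EFinM.
Qed.

Lemma cintegrableZ rho a f : cintegrable rho f -> cintegrable rho (fun x => a * f x).
Proof.
move=> [f1 f2]; split.
  have := integrableB measurableT (integrableZ_EFin (complex.Re a) f1) (integrableZ_EFin (complex.Im a) f2).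
  by congr (_.-integrable _ _); apply/funext => x /=; rewrite cReM.
have := integrableD measurableT (integrableZ_EFin (complex.Re a) f2) (integrableZ_EFin (complex.Im a) f1).
by congr (_.-integrable _ _); apply/funext => x /=; rewrite cImM.
Qed.

Lemma cintegralZ rho a f : cintegrable rho f ->
  cintegral rho (fun x => a * f x) = a * cintegral rho f.
Proof.
move=> [f1 f2]; rewrite /cintegral.
under eq_Rintegral do rewrite cReM.
under [X in (_ +i* X)%C]eq_Rintegral do rewrite cImM.
rewrite RintegralB ?RintegralD ?RintegralZl//; try exact: integrableZ_EFin.
by case: a => a b; simpc.
Qed.

Lemma cintegrable_sum rho (J : Type) (s : seq J) (h : J -> X -> R[i]) :
  (forall j, cintegrable rho (h j)) ->
  cintegrable rho (fun x => \sum_(j <- s) h j x) /\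
  cintegral rho (fun x => \sum_(j <- s) h j x) = \sum_(j <- s) cintegral rho (h j).
Proof.
move=> ih; elim: s => [|j s [IH1 IH2]].
  split; first by under eq_fun do rewrite big_nil; split; exact: integrable0.
  under cintegral_ext do rewrite big_nil.
  by rewrite big_nil /cintegral !Rintegral_cst//= !mul0r.
split; first by under eq_fun do rewrite big_cons; exact: cintegrableD.
under cintegral_ext do rewrite big_cons.
by rewrite big_cons cintegralD// IH2.
Qed.

End ComplexIntegral.

Lemma cintegral_ae dX (X : measurableType dX) (R : realType)
    (rho : {measure set X -> \bar R}) (f g : X -> R[i]) :
  measurable_fun setT f -> measurable_fun setT g ->
  {ae rho, forall x, f x = g x} -> cintegral rho f = cintegral rho g.
Proof.
move=> mf mg fg; rewrite /cintegral /Rintegral; congr (fine _ +i* fine _)%C.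
  apply: ae_eq_integral => //.
  - exact/measurable_EFinP/measurable_Re.
  - exact/measurable_EFinP/measurable_Re.
  - by apply: filterS fg => x -> _.
apply: ae_eq_integral => //.
- exact/measurable_EFinP/measurable_Im.
- exact/measurable_EFinP/measurable_Im.
- by apply: filterS fg => x -> _.
Qed.

Section TorusCharacters.
Context (R : realType) (d : nat).
Local Notation T := (torus R d).
Implicit Types (z : T) (v w : {ffun 'I_d -> int}).

Lemma normc_torus_coord z i : normc (torus_coord z i) ^+ 2 = 1.
Proof.
have /eqP := norm_torus_coord z i; rewrite normr_normc => /eqP [->].
by rewrite expr1n.
Qed.

Lemma torus_coord_neq0 z i : torus_coord z i != 0.
Proof. by rewrite -normc2_eq0 normc_torus_coord oner_eq0. Qed.

Lemma normc_torus_char v z : normc (torus_char v z) ^+ 2 = 1.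
Proof.
rewrite /torus_char; elim/big_rec : _ => [|i x _ IH]; first by rewrite Normc.normc1 expr1n.
rewrite normc2M IH mulr1; case: (v i) => n.
  by rewrite /exprz normc2X normc_torus_coord expr1n.
by rewrite NegzE -exprnN normc2V normc2X normc_torus_coord expr1n invr1.
Qed.

Lemma measurable_torus_char v : measurable_fun setT (@torus_char R d v).
Proof.
apply: measurable_cplx_prod => i; apply: measurable_cplxXz.
exact: measurable_torus_coord.
Qed.

Lemma torus_charD v w z :
  torus_char v z * torus_char w z = torus_char [ffun i => v i + w i] z.
Proof.
rewrite /torus_char -big_split; apply: eq_bigr => i _ /=.
by rewrite ffunE expfzDr// torus_coord_neq0.
Qed.

Lemma torus_char0 z : torus_char [ffun=> 0] z = 1 :> R[i].
Proof. by rewrite /torus_char big1// => i _; rewrite ffunE. Qed.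

Lemma torus_char_delta i (n : int) z :
  torus_char [ffun j => if j == i then n else 0] z = torus_coord z i ^ n.
Proof.
rewrite /torus_char (bigD1 i)//= ffunE eqxx big1 ?mulr1// => j ji.
by rewrite ffunE (negbTE ji).
Qed.

Lemma torus_coordV z i : (torus_coord z i)^-1 = (torus_coord z i)^*%C.
Proof.
apply: (mulfI (torus_coord_neq0 z i)).
by rewrite mulfV ?torus_coord_neq0// -sqr_normc norm_torus_coord expr1n.
Qed.

Section Density.
Variable rho : {measure set T -> \bar R}.
Hypothesis rho_fin : (rho setT < +oo)%E.

Let mpsi := measurable_torus_char.
Let psi_unit v z := normc_torus_char v z.
Let psiM (v w : {ffun 'I_d -> int}) : exists u, forall z, torus_char v z * torus_char w z = torus_char u z.
Proof. by exists [ffun i => v i + w i] => z; exact: torus_charD. Qed.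
Let psi1 : exists v, forall z, torus_char v z = 1.
Proof. by exists [ffun=> 0] => z; exact: torus_char0. Qed.
Local Notation bspan := (bspan rho (@torus_char R d)).

(** The coordinates are characters, and so are their conjugates, because
    conjugation is inversion on the unit circle. *)
Lemma bspan_torus_real k : bspan (fun z => (torus_real k z)%:C%C).
Proof.
have bc i : bspan (fun z => torus_coord z i).
  have := bspan_psi rho mpsi psi_unit [ffun j => if j == i then 1 else 0].
  by rewrite (_ : torus_char _ = fun z => torus_coord z i)//; apply/funext => z;
    rewrite torus_char_delta expr1z.
have bcV i : bspan (fun z => (torus_coord z i)^*%C).
  have := bspan_psi rho mpsi psi_unit [ffun j => if j == i then -1 else 0].
  by rewrite (_ : torus_char _ = fun z => (torus_coord z i)^*%C)//; apply/funext => z;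
    rewrite torus_char_delta -torus_coordV exprN1.
case: k => i [].
  rewrite (_ : (fun _ => _) = (fun z => (2^-1)%:C%C * (torus_coord z i + (torus_coord z i)^*%C))).
    by apply: (bspanZ mpsi); exact: (bspanD mpsi).
  apply/funext => z; rewrite /torus_real /=.
  case: (torus_coord z i) => a b; apply/eqP; rewrite eq_complex /=.
  by apply/andP; split; apply/eqP; field.
rewrite (_ : (fun _ => _) = (fun z => (0 -i* 2^-1)%C * (torus_coord z i + (-1) * (torus_coord z i)^*%C))).
  by apply: (bspanZ mpsi); apply: (bspanD mpsi) => //; exact: (bspanZ mpsi).
apply/funext => z; rewrite /torus_real /=.
case: (torus_coord z i) => a b; apply/eqP; rewrite eq_complex /=.
by apply/andP; split; apply/eqP; field.
Qed.

Lemma torus_real_bound k z : -1 <= torus_real k z <= 1.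
Proof.
rewrite -ler_norml -(@ler_pXn2r _ 2)// ?nnegrE// expr1n.
rewrite -(normc_torus_coord z k.1); apply: lerXn2r; rewrite ?nnegrE ?normc_ge0//.
exact: cplx_coord_le.
Qed.

(** Rescale the real coordinate affinely into [0, 1] with the threshold c at
    1/2, and apply the polynomials of [cvg_step]; they are uniformly bounded by
    1. *)
Lemma bspan_halfspace k (c : R) : bspan (ind R [set z | torus_real k z < c]).
Proof.
(* The slope 1/K is small enough for u to stay in [0, 1]: the coordinate is
   bounded by 1, so it is within 1 + |c| of c. *)
pose K : R := 2 * (1 + `|c|).
have K0 : 0 < K by rewrite mulr_gt0// ltr_wpDr.
pose u z : R := 1 / 2 + K^-1 * (torus_real k z - c).
have uK z : u z * K = 1 + `|c| + (torus_real k z - c).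
  by rewrite /u mulrDl (mulrC K^-1) divfK ?gt_eqF// /K; field.
have u01 z : 0 <= u z <= 1.
  have := torus_real_bound k z; have := uK z; have := ler_norm c; have := ler_norm (- c).
  rewrite normrN /K; move: K0; rewrite /K.
  move: `|c| (torus_real k z) (u z) => C x y; nra.
have uc z : (u z < 1 / 2) = (torus_real k z < c).
  by rewrite /u gtrDl pmulr_rlt0 ?invr_gt0// subr_lt0.
have bu : bspan (fun z => (u z)%:C%C).
  rewrite (_ : (fun _ => _) = (fun z => (1 / 2 - K^-1 * c)%:C%C + (K^-1)%:C%C * (torus_real k z)%:C%C)).
    apply: (bspanD mpsi); first exact: (bspan_cst rho mpsi psi_unit psi1).
    by apply: (bspanZ mpsi); exact: bspan_torus_real.
  apply/funext => z; rewrite -rmorphM -rmorphD; congr (_%:C%C).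
  by rewrite /u mulrBr addrA addrAC.
pose p n z : R := (1 - u z ^+ n) ^+ (n * 2 ^ n).
have bp n : bspan (fun z => (p n z)%:C%C).
  rewrite (_ : (fun _ => _) = (fun z => (1 + (-1) * ((u z)%:C%C ^+ n)) ^+ (n * 2 ^ n))).
    apply: (bspanX mpsi psi_unit psiM psi1); apply: (bspanD mpsi).
      exact: (bspan_cst rho mpsi psi_unit psi1).
    by apply: (bspanZ mpsi); exact: (bspanX mpsi psi_unit psiM psi1).
  by apply/funext => z; rewrite mulN1r -rmorphXn -[1]/((1 : R)%:C%C) -rmorphB -rmorphXn.
have p01 n z : normc (p n z)%:C%C ^+ 2 <= 1.
  rewrite normc2_real; have /andP[a b] := u01 z.
  have a1 : 0 <= u z ^+ n by exact: exprn_ge0.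
  have b1 : u z ^+ n <= 1 by rewrite exprn_ile1.
  have a2 : 0 <= p n z by rewrite exprn_ge0//; lra.
  have b2 : p n z <= 1 by rewrite exprn_ile1//; lra.
  by rewrite exprn_ile1.
have mH : measurable [set z | torus_real k z < c].
  have mk := @continuous_borel R T _ (@torus_real_continuous R d k).
  rewrite (_ : [set _ | _] = torus_real k @^-1` `]-oo, c[); last first.
    by apply/seteqP; split => z /=; rewrite in_itv.
  by rewrite -[X in measurable X]setTI; exact: mk.
apply: (@bspan_lim _ _ _ _ _ _ rho_fin mpsi (fun n z => (p n z)%:C%C) _ 1) => //.
- exact: measurable_ind.
- by move=> z; rewrite indCE; case: ifP; rewrite ?Normc.normc1 ?Normc.normc0 ?expr0n// expr1n.
move=> z; have cp := cvg_step (u01 z).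
rewrite (_ : ind _ _ _ = ((u z < 1 / 2)%R%:R : R)%:C%C); last first.
  by rewrite uc indCE; case: ifPn; [rewrite inE => /= ->|rewrite notin_setE => /= /negP/negbTE ->].
under eq_fun do rewrite -raddfB normc2_real expr2.
rewrite -(mulr0 (0 : R)); apply: cvgM; rewrite -(subrr ((u z < 1 / 2)%R%:R : R));
  by apply: cvgB => //; exact: cvg_cst.
Qed.

Lemma bspan_ind (B : set T) : measurable B -> bspan (ind R B).
Proof.
move=> mB; have := torus_sigma_algebra (bspan_sigma_algebra rho_fin mpsi psi_unit psiM psi1).
move=> /(_ _ B mB)[]// k c; split; last exact: bspan_halfspace.
by case: (bspan_halfspace k c) => + _ _ => /measurable_cplxP/(_ true)/measurable_indicP.
Qed.

(** The sets whose indicators are approximable form a sigma-algebra that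
    contains the half spaces, hence all Borel sets. *)
Theorem torus_char_dense (f : T -> R[i]) : measurable_fun setT f ->
  (\int[rho]_x (normc (f x) ^+ 2)%:E < +oo)%E -> in_span rho (@torus_char R d) f.
Proof.
exact: (L2_in_span mpsi psi_unit psi1 bspan_ind).
Qed.

End Density.

End TorusCharacters.

Section CharacterContinuity.
Context (R : realType).

Lemma cplx_mul_continuous (T : topologicalType) (f g : T -> R[i]) :
  continuous f -> continuous g -> continuous (fun x => f x * g x).
Proof. by move=> cf cg x; apply: (@cvgM R[i] T); [exact: cf|exact: cg]. Qed.

Lemma cplx_inv_continuous (T : topologicalType) (f : T -> R[i]) :
  continuous f -> (forall x, f x != 0) -> continuous (fun x => (f x)^-1).
Proof. by move=> cf f0 x; apply: (@cvgV R[i] T); [exact: f0|exact: cf]. Qed.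

Lemma torus_char_continuous d (v : {ffun 'I_d -> int}) :
  continuous (@torus_char R d v).
Proof.
have cX i n : continuous (fun z : torus R d => torus_coord z i ^+ n).
  elim: n => [|n IH]; first exact: (@cst_continuous (torus R d) R[i] 1).
  rewrite (_ : (fun _ => _) = (fun z : torus R d => torus_coord z i * torus_coord z i ^+ n)).
    exact: (cplx_mul_continuous (@torus_coord_continuous R d i) IH).
  by apply/funext => z; rewrite exprS.
have cXz i : continuous (fun z : torus R d => torus_coord z i ^ v i).
  case: (v i) => n; first exact: cX.
  under eq_fun do rewrite NegzE -exprnN.
  by apply: cplx_inv_continuous => // z; rewrite expf_neq0// torus_coord_neq0.
rewrite /torus_char; elim: (index_enum _) => [|i s IH].
    under eq_fun do rewrite big_nil.
  exact: (@cst_continuous (torus R d) R[i] 1).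
rewrite (_ : (fun _ => _) = (fun z : torus R d => torus_coord z i ^ v i *
    \prod_(j <- s) torus_coord z j ^ v j)).
  exact: (cplx_mul_continuous (cXz i) IH).
by apply/funext => z; rewrite big_cons.
Qed.

End CharacterContinuity.

Section TorusCharConj.
Context (R : realType) (d : nat).

Lemma torus_char_conj v (z : torus R d) :
  ((torus_char v z)^*)%C = torus_char [ffun i => - v i] z.
Proof.
have v1 : torus_char v z * torus_char [ffun i => - v i] z = 1 :> R[i].
  rewrite torus_charD -[RHS](torus_char0 z); congr (torus_char _ z).
  by apply/ffunP => i; rewrite !ffunE subrr.
have v0 : torus_char v z != 0 :> R[i].
  by rewrite -normc2_eq0 normc_torus_char oner_eq0.
by apply: (mulfI v0); rewrite cplx_mul_conj normc_torus_char v1.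
Qed.

(** The reason why orthogonality at one scale is a statement about Fourier
    coefficients. *)
Lemma cinner_op_T (N : dilation d) (taut : probability (torus R d * ZA N)%type R)
    (psi : torus R d * ZA N -> R[i]) v w :
  cinner taut (op_T v psi) (op_T w psi) =
  cintegral taut (fun x => torus_char [ffun i => v i - w i] x.1 *
                           (normc (psi x) ^+ 2)%:C%C).
Proof.
apply: cintegral_ext => x; rewrite /op_T [(_ * psi x)^*%C]rmorphM /= mulrACA cplx_mul_conj torus_char_conj.
by rewrite torus_charD; congr (torus_char _ _ * _); apply/ffunP => i; rewrite !ffunE.
Qed.

End TorusCharConj.


(** * Weighted images of measures and Fourier uniqueness *)

(** The integral formulas below are proved by this induction: on both sides
    they are additive, homogeneous and monotone continuous, so that indicators
    decide. *)
Lemma ge0_measurable_ind (dX : measure_display) (X : measurableType dX)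
    (R : realType) (P : (X -> \bar R) -> Prop) :
  (forall B, measurable B -> P (fun x => (\1_B x)%:E)) ->
  (forall f g, measurable_fun setT f -> measurable_fun setT g ->
     (forall x, (0 <= f x)%E) -> (forall x, (0 <= g x)%E) ->
     P f -> P g -> P (fun x => f x + g x)%E) ->
  (forall (c : R) f, 0 <= c -> measurable_fun setT f -> (forall x, (0 <= f x)%E) ->
     P f -> P (fun x => c%:E * f x)%E) ->
  (forall (u : (X -> \bar R)^nat), (forall n, measurable_fun setT (u n)) ->
     (forall n x, (0 <= u n x)%E) ->
     (forall x, {homo u ^~ x : n m / (n <= m)%N >-> (n <= m)%E}) ->
     (forall n, P (u n)) -> P (fun x => limn (u ^~ x))) ->
  forall f, measurable_fun setT f -> (forall x, (0 <= f x)%E) -> P f.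
Proof.
move=> P1 PD PZ Plim f mf f0.
pose h := nnsfun_approx measurableT mf.
rewrite (_ : f = fun x => limn ((fun n y => (h n y)%:E) ^~ x)); last first.
  by apply/funext => x; apply/esym/cvg_lim => //; exact: cvg_nnsfun_approx.
apply: Plim.
- by move=> n; apply/measurable_EFinP.
- by move=> n x; rewrite lee_fin.
- by move=> x n m nm; rewrite lee_fin; exact/lefP/nd_nnsfun_approx.
move=> n; pose k := h n; rewrite -/k.
have [s [s0 hE]] : exists s : seq R, (forall y, y \in s -> 0 <= y) /\
    forall x, k x = \sum_(y <- s) y * \1_(k @^-1` [set y]) x.
  exists (finmap.enum_fset (fset_set (range k))); split=> [y|x].
    by rewrite in_fset_set// inE => -[x _ <-].
  by rewrite [in LHS](fimfunE k x) fsbig_finite.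
rewrite (_ : (fun _ => _) = (fun x => \sum_(y <- s) y%:E * (\1_(k @^-1` [set y]) x)%:E)%E); last first.
  by apply/funext => x; rewrite hE -sumEFin; apply: eq_bigr => y _; rewrite EFinM.
elim: s s0 {hE} => [|y s IH] s0.
  under eq_fun do rewrite big_nil.
  by have := P1 set0 measurable0; under eq_fun do rewrite indic0.
under eq_fun do rewrite big_cons.
have m1 (c : R) : measurable_fun setT (fun x => (\1_(k @^-1` [set c]) x)%:E : \bar R).
  by apply/measurable_EFinP.
have i0 (c : R) x : (0 <= (\1_(k @^-1` [set c]) x)%:E :> \bar R)%E by rewrite lee_fin.
have ys0 : 0 <= y by apply: s0; rewrite mem_head.
have ss0 c : c \in s -> 0 <= c by move=> cs; apply: s0; rewrite in_cons cs orbT.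
apply: PD.
- exact: measurable_funeM.
- by apply: emeasurable_sum => c; exact: measurable_funeM.
- by move=> x; rewrite mule_ge0.
- by move=> x; rewrite big_seq sume_ge0// => c cs; rewrite mule_ge0// lee_fin ss0.
- by apply: PZ => //; exact: P1.
- exact: IH.
Qed.

Section WeightedPushforward.
Context dX dY (X : measurableType dX) (Y : measurableType dY) (R : realType).
Variables (mu : {measure set X -> \bar R}) (g : X -> R) (phi : X -> Y).
Hypothesis mg : measurable_fun setT g.
Hypothesis g0 : forall x, 0 <= g x.
Let mgE : measurable_fun setT (EFin \o g).
Proof. exact/measurable_EFinP. Qed.
Let gE0 x : (0 <= (g x)%:E)%E.
Proof. by rewrite lee_fin. Qed.
Hypothesis mphi : measurable_fun setT phi.

Let wp (B : set Y) : \bar R := (\int[mu]_(x in phi @^-1` B) (g x)%:E)%E.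

Let mpre B : measurable B -> measurable (phi @^-1` B).
Proof. by move=> mB; rewrite -[X in measurable X]setTI; exact: mphi. Qed.

Let wp0 : wp set0 = 0%E.
Proof. by rewrite /wp preimage_set0 integral_set0. Qed.

Let wp_ge0 B : (0 <= wp B)%E.
Proof. by apply: integral_ge0 => x _. Qed.

Let wp_sigma_additive : semi_sigma_additive wp.
Proof.
move=> F mF tF mUF; rewrite /wp preimage_bigcup ge0_integral_bigcup//=.
- by apply: is_cvg_nneseries => n _ _; exact: wp_ge0.
- by move=> n; exact: mpre.
- exact: measurable_funTS.
apply/trivIsetP => i j _ _ ij; rewrite -preimage_setI.
by move/trivIsetP : tF => /(_ i j I I ij) ->; rewrite preimage_set0.
Qed.

HB.instance Definition _ := isMeasure.Build _ _ _ wp wp0 wp_ge0 wp_sigma_additive.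

(** The image under phi of the measure g mu. One construction serves for images
    (g = 1), for densities (phi = id), and for their combinations. *)
Lemma weighted_pushforward : exists rho : {measure set Y -> \bar R},
  (forall B, measurable B -> rho B = \int[mu]_(x in phi @^-1` B) (g x)%:E)%E /\
  (forall f, measurable_fun setT f -> (forall y, 0 <= f y)%E ->
     \int[rho]_y f y = \int[mu]_x (f (phi x) * (g x)%:E))%E.
Proof.
exists wp; split => // f mf f0; move: f mf f0; apply: ge0_measurable_ind.
- move=> B mB; rewrite integral_indic// setIT.
  transitivity (\int[mu]_(x in phi @^-1` B) (g x)%:E)%E => //; rewrite [LHS]integral_mkcond.
  apply: eq_integral => x _; rewrite patchE indicE.
  rewrite (_ : (x \in phi @^-1` B) = (phi x \in B)).
    by case: (phi x \in B); rewrite ?mul1e ?mul0e.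
  by apply/idP/idP; rewrite !inE.
- move=> f h mf mh f0 h0 IHf IHh.
  rewrite ge0_integralD// IHf IHh -ge0_integralD//.
  + by apply: eq_integral => x _; rewrite ge0_muleDl.
  + by move=> x _; rewrite mule_ge0.
  + by apply: emeasurable_funM => //; exact: measurableT_comp.
  + by move=> x _; rewrite mule_ge0.
  + by apply: emeasurable_funM => //; exact: measurableT_comp.
- move=> c f c0 mf f0 IHf; rewrite ge0_integralZl// IHf -ge0_integralZl//.
  + by apply: eq_integral => x _; rewrite muleA.
  + by apply: emeasurable_funM => //; exact: measurableT_comp.
  + by move=> x _; rewrite mule_ge0.
move=> u mu_ u0 nd IH.
rewrite monotone_convergence// (_ : (fun _ => _) = fun n => \int[mu]_x (u n (phi x) * (g x)%:E))%E; last first.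
  by apply/funext => n; exact: IH.
rewrite -monotone_convergence//.
- apply: eq_integral => x _; rewrite muleC -limeMl//.
    by under eq_fun do rewrite muleC.
  by apply: ereal_nondecreasing_is_cvgn => n m nm; exact: nd.
- by move=> n; apply: emeasurable_funM => //; exact: measurableT_comp.
- by move=> n x _; rewrite mule_ge0.
- by move=> x _ n m nm; rewrite lee_wpmul2r//; exact: nd.
Qed.

End WeightedPushforward.

(** The weight is nonnegative, so that the formula for nonnegative functions
    applies to the positive and negative parts of the real and imaginary
    parts. *)
Lemma cintegral_weighted d1 d2 (X : measurableType d1) (Y : measurableType d2)
    (R : realType) (mu : {measure set X -> \bar R}) (rho : {measure set Y -> \bar R})
    (g : X -> R) (phi : X -> Y) (f : Y -> R[i]) :
  (forall x, 0 <= g x) ->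
  (forall h, measurable_fun setT h -> (forall y, 0 <= h y)%E ->
     \int[rho]_y h y = \int[mu]_x (h (phi x) * (g x)%:E))%E ->
  measurable_fun setT f ->
  cintegral rho f = cintegral mu (fun x => f (phi x) * (g x)%:C%C).
Proof.
move=> g0 rhoE mf.
have E (u : Y -> R) : measurable_fun setT u ->
    \int[rho]_y u y = \int[mu]_x (u (phi x) * g x).
  move=> mu_; have mu' : measurable_fun setT (EFin \o u) by exact/measurable_EFinP.
  congr fine; rewrite integralE [RHS]integralE.
  rewrite !rhoE//; try exact: measurable_funeneg; try exact: measurable_funepos.
  have pp x : ((fun y => (u y)%:E)^\+ (phi x) * (g x)%:E = (fun x => (u (phi x) * g x)%:E)^\+ x)%E.
    by rewrite !funeposE -EFin_max -EFinM -EFin_max maxr_pMl// mul0r.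
  have nn x : ((fun y => (u y)%:E)^\- (phi x) * (g x)%:E = (fun x => (u (phi x) * g x)%:E)^\- x)%E.
    by rewrite !funenegE -!EFinN -EFin_max -EFinM -EFin_max maxr_pMl// mul0r mulNr.
  by congr (_ - _)%E; apply: eq_integral => x _.
rewrite /cintegral; congr (_ +i* _)%C.
  rewrite (E _ (measurable_Re mf)); apply: eq_Rintegral => x _.
  by rewrite cReM /= mulr0 subr0.
rewrite (E _ (measurable_Im mf)); apply: eq_Rintegral => x _.
by rewrite cImM /= mulr0 add0r.
Qed.

Section FourierUniqueness.
Context (R : realType) (d : nat).
Local Notation T := (torus R d).
Implicit Types (rho : {measure set T -> \bar R}) (p : T -> R[i]).

Lemma lincomb_char_bounded p : lincomb (@torus_char R d) p ->
  measurable_fun setT p /\ exists C : R, forall z, normc (p z) ^+ 2 <= C.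
Proof.
move=> [s [c pE]]; rewrite (funext pE); split.
  apply: measurable_cplx_sum => v; apply: measurable_cplxM; first exact: measurable_cst.
  exact: measurable_torus_char.
elim: s {p pE} => [|v s [C IH]].
  by exists 0 => z; rewrite big_nil Normc.normc0 expr0n.
exists (2 * normc (c v) ^+ 2 + 2 * C) => z; rewrite big_cons.
apply: le_trans (normc2D_le _ _) _; rewrite lerD ?ler_pM2l//.
by rewrite normc2M normc_torus_char mulr1.
Qed.

Lemma cintegral_lincomb rho s (c : {ffun 'I_d -> int} -> R[i]) : (rho setT < +oo)%E ->
  cintegral rho (fun z => \sum_(v <- s) c v * torus_char v z) =
  \sum_(v <- s) c v * cintegral rho (@torus_char R d v).
Proof.
move=> rfin.
have ci v : cintegrable rho (@torus_char R d v).
  apply: (@cintegrable_bounded _ _ _ _ _ 1) => //; first exact: measurable_torus_char.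
  by move=> z; rewrite normc_torus_char.
have [_ ->] := cintegrable_sum s (fun v => cintegrableZ (c v) (ci v)).
by apply: eq_bigr => v _; rewrite cintegralZ.
Qed.

(** If p is within e of the indicator of B in L^2, then its integral is within
    a multiple of e of the measure of B. The elementary inequality r <= e +
    r^2/e replaces the Cauchy-Schwarz inequality. *)
Lemma approx_measure rho p (B : set T) (e : R) : (rho setT < +oo)%E -> measurable B ->
  lincomb (@torus_char R d) p -> 0 < e ->
  (\int[rho]_z (normc (ind R B z - p z) ^+ 2)%:E < (e ^+ 2)%:E)%E ->
  `|fine (rho B) - complex.Re (cintegral rho p)| <= e * (fine (rho setT) + 1).
Proof.
move=> rfin mB lp e0 pe; have [mp [C pC]] := lincomb_char_bounded lp.
have [ip _] := cintegrable_bounded rfin mp pC.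
have mi := @measurable_ind _ _ R _ mB.
have i1 : rho.-integrable setT (EFin \o (fun z => complex.Re (ind R B z))).
  have [] // := @cintegrable_bounded _ _ _ rho (ind R B) 1 rfin mi.
  by move=> z; rewrite indCE; case: ifP; rewrite ?Normc.normc1 ?Normc.normc0 ?expr0n// expr1n.
have -> : fine (rho B) = \int[rho]_z complex.Re (ind R B z).
  by rewrite /Rintegral /ind /= integral_indic// setIT.
rewrite /cintegral /= -RintegralB//.
have mq : measurable_fun setT (fun z => normc (ind R B z - p z) ^+ 2).
  by apply: measurable_normc2; exact: measurable_cplxB.
have iq : rho.-integrable setT (EFin \o (fun z => normc (ind R B z - p z) ^+ 2)).
  apply/integrableP; split; first exact/measurable_EFinP.
  under eq_integral do rewrite gee0_abs ?lee_fin ?sqr_ge0//.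
  by apply: lt_trans pe _; rewrite ltry.
have ie : rho.-integrable setT (EFin \o (fun z => e + e^-1 * normc (ind R B z - p z) ^+ 2)).
  apply: (@integrableD _ _ _ rho setT measurableT (fun=> e%:E)
    (fun z => (e^-1 * normc (ind R B z - p z) ^+ 2)%:E)).
    exact: integrable_cst_EFin.
  exact: (integrableZ_EFin _ iq).
apply: le_trans (le_normr_Rintegral measurableT _) _.
  exact: (integrableB measurableT i1 ip).
apply: (@le_trans _ _ (\int[rho]_z (e + e^-1 * normc (ind R B z - p z) ^+ 2))).
  apply: le_Rintegral => //.
    have i2 : rho.-integrable setT (EFin \o (fun z => complex.Re (ind R B z) - complex.Re (p z))).
      exact: (integrableB measurableT i1 ip).
    exact: (integrable_norm i2).
  move=> z _; have := cplx_coord_le true (ind R B z - p z).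
  rewrite cplx_coordB => /le_trans; apply.
  have := normc_ge0 (ind R B z - p z); move: (normc _) => r r0.
  (* e + r^2/e - r, written as a manifestly nonnegative expression *)
  rewrite -subr_ge0 (_ : _ - _ = e^-1 * ((r - e) ^+ 2 + e * r)); last first.
    by field; rewrite gt_eqF.
  by rewrite mulr_ge0 ?invr_ge0 ?(ltW e0)// addr_ge0 ?sqr_ge0// mulr_ge0// ltW.
rewrite RintegralD//; last 2 first.
  exact: integrable_cst_EFin.
  exact: (integrableZ_EFin _ iq).
rewrite Rintegral_cst// mulrDr lerD// mulr1 RintegralZl// ler_pdivrMl// -expr2.
rewrite -lee_fin /Rintegral fineK ?(ltW pe)//.
rewrite ge0_fin_numE; first by apply: lt_trans pe _; rewrite ltry.
by apply: integral_ge0 => x _; rewrite lee_fin sqr_ge0.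
Qed.

(** Approximate the indicator of B by one trigonometric polynomial in L^2 of
    the sum of both measures, hence in L^2 of each; the integrals of the
    polynomial coincide. *)
Theorem torus_measure_eq (rho1 rho2 : {measure set T -> \bar R}) :
  (rho1 setT < +oo)%E -> (rho2 setT < +oo)%E ->
  (forall v, cintegral rho1 (@torus_char R d v) = cintegral rho2 (@torus_char R d v)) ->
  forall B, measurable B -> rho1 B = rho2 B.
Proof.
move=> f1 f2 e12 B mB.
have f12 : (measure_add rho1 rho2 setT < +oo)%E.
  by rewrite measure_addE lte_add_pinfty.
have [_ _ sB] := bspan_ind f12 mB.
have fB (rho : {measure set T -> \bar R}) : (rho setT < +oo)%E -> rho B \is a fin_num.
  move=> rf; rewrite ge0_fin_numE//; apply: le_lt_trans rf.
  by apply: le_measure; rewrite ?inE.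
rewrite -(fineK (fB _ f1)) -(fineK (fB _ f2)); congr (_%:E).
apply/eqP; rewrite -subr_eq0 -normr_eq0; apply/eqP/le_anti; rewrite normr_ge0 andbT.
pose K := fine (rho1 setT) + 1 + (fine (rho2 setT) + 1).
have K0 : 0 < K by rewrite ltr_wpDl// ?ltr_wpDl// ?addr_ge0// fine_ge0.
apply/ler_addgt0Pr => e e0; rewrite add0r.
pose t := e / K; have t0 : 0 < t by rewrite divr_gt0.
have [p lp pt] := sB _ (exprn_gt0 2 t0).
have [mp _] := lincomb_char_bounded lp.
move: pt; rewrite ge0_integral_measure_add//; last 2 first.
  by move=> z _; rewrite lee_fin sqr_ge0.
  by apply: measurable_sqn; apply: measurable_cplxB => //; exact: measurable_ind.
move=> pt.
have pos (rho : {measure set T -> \bar R}) : (0 <= \int[rho]_z (normc (ind R B z - p z) ^+ 2)%:E)%E.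
  by apply: integral_ge0 => z _; rewrite lee_fin sqr_ge0.
have a1 := approx_measure f1 mB lp t0 (le_lt_trans (leeDl _ (pos rho2)) pt).
have a2 := approx_measure f2 mB lp t0 (le_lt_trans (leeDr _ (pos rho1)) pt).
have pe : cintegral rho1 p = cintegral rho2 p.
  have [s [c pE]] := lp; rewrite (funext pE) !cintegral_lincomb//.
  by apply: eq_bigr => v _; rewrite e12.
have -> : e = t * (fine (rho1 setT) + 1) + t * (fine (rho2 setT) + 1).
  by rewrite -mulrDr /t divfK// gt_eqF.
move: a1 a2; rewrite pe => a1 a2.
apply: le_trans (lerD a1 a2); rewrite (distrC (fine (rho2 B))).
apply: le_trans (ler_normD _ _); rewrite addrA subrK//.
Qed.

End FourierUniqueness.

(** * Inverse branches of beta *)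

Section Argument.
Context (R : realType).

(** The argument divided by 2 pi, normalized to [0, 1). The truncation to [-1,
    1] makes the arccosine monotone on the whole line, hence measurable. *)
Definition carg (w : R[i]) : R :=
  let a := acos (Num.max (-1) (Num.min 1 (complex.Re w))) / (2 * pi) in
  if 0 <= complex.Im w then a else 1 - a.

Lemma cexp_eq1 (u : R) : 0 <= u < 1 -> cexp u = 1 -> u = 0.
Proof.
move=> /andP[u0 u1] /(congr1 (@complex.Re R)) /= cu.
have pi0 : 0 < pi :> R := pi_gt0 R.
have [le|lt] := leP (2 * pi * u) pi.
  have : 2 * pi * u = 0.
    apply: cos_inj; rewrite ?in_itv/= ?lexx ?le ?(ltW pi0) ?mulr_ge0 ?(ltW pi0)//.
    by rewrite cu cos0.
  by move/eqP; rewrite !mulf_eq0 (gt_eqF pi0) pnatr_eq0/= => /eqP.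
have : 2 * pi * (1 - u) = 0.
  apply: cos_inj; rewrite ?in_itv/= ?lexx ?(ltW pi0)//.
    by rewrite mulr_ge0 ?mulr_ge0 ?(ltW pi0) ?subr_ge0 ?(ltW u1)//=; nra.
  rewrite cos0 mulrBr mulr1 -[2 * pi - _]opprB cosN.
  have := cosD2pi (2 * pi * u - 2 * pi); rewrite -(mulr_natl pi 2) subrK => <-.
  by rewrite cu.
move/eqP; rewrite !mulf_eq0 (gt_eqF pi0) pnatr_eq0/= subr_eq0 => /eqP u1'.
by move: u1; rewrite -u1' ltxx.
Qed.

Lemma cexpN_mul (t : R) : cexp t * cexp (- t) = 1.
Proof. by rewrite -cexpD subrr -[0]/(0%:R) cexp_nat. Qed.

Lemma cexp_inj (s t : R) : 0 <= s < 1 -> 0 <= t < 1 -> cexp s = cexp t -> s = t.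
Proof.
wlog st : s t / t <= s => [W s1 t1 e|].
  by have [|/ltW] := leP t s; move=> ?; [exact: W|apply/esym; exact: W].
move=> /andP[s0 s1] /andP[t0 t1] e; apply/eqP; rewrite -subr_eq0; apply/eqP.
apply: cexp_eq1; first by lra.
by rewrite cexpD e cexpN_mul.
Qed.

Lemma cargP (w : R[i]) : `|w| = 1 -> 0 <= carg w < 1 /\ cexp (carg w) = w.
Proof.
rewrite normr_normc => -[nw]; have {}nw : complex.Re w ^+ 2 + complex.Im w ^+ 2 = 1.
  by rewrite -normc_sqr nw expr1n.
have pi0 : 0 < pi :> R := pi_gt0 R.
have p20 : 2 * pi != 0 :> R by rewrite mulf_neq0 ?gt_eqF.
case: w nw => a b /= nw.
have aB : -1 <= a <= 1 by rewrite -ler_norml -(@ler_pXn2r _ 2)// ?nnegrE// expr1n real_normK ?num_real//; nra.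
rewrite /carg /=.
have -> : Num.max (-1) (Num.min 1 a) = a.
  by case/andP: aB => a1 a2; rewrite (min_idPr a2) (max_idPr a1).
set x := acos a / (2 * pi).
have xE : 2 * pi * x = acos a by rewrite /x mulrC divfK.
have x0 : 0 <= x by rewrite divr_ge0 ?acos_ge0 ?mulr_ge0 ?(ltW pi0).
have x12 : x <= 1 / 2.
  by rewrite /x ler_pdivrMr ?mulr_gt0// mulrA divfK ?pnatr_eq0// mul1r acos_lepi.
have sE : sin (acos a) = `|b|.
  by rewrite sin_acos// -sqrtr_sqr; congr Num.sqrt; lra.
have cE : cos (acos a) = a by rewrite acosK// in_itv.
have [b0|b0] := leP 0 b.
  split; first lra.
  by rewrite /cexp xE sE cE ger0_norm.
split.
  have : 0 < x by rewrite divr_gt0 ?mulr_gt0// acos_gt0//; apply/andP; split; nra.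
  by move=> ?; lra.
rewrite /cexp mulrBr mulr1 xE -[2 * pi - _]opprB cosN sinN.
have c2 := cosD2pi (acos a - 2 * pi); have s2 := sinD2pi (acos a - 2 * pi).
move: c2 s2; rewrite -(mulr_natl pi 2) subrK => <- <-.
by rewrite cE sE ltr0_norm// opprK.
Qed.

(** The truncated arccosine is nonincreasing. *)
Lemma measurable_carg d (T : measurableType d) (f : T -> R[i]) :
  measurable_fun setT f -> measurable_fun setT (fun x => carg (f x)).
Proof.
move=> mf.
have macos : measurable_fun setT (fun x : R => acos (Num.max (-1) (Num.min 1 x))).
  apply: nonincreasing_measurable => // x y xy.
  set p := Num.max _ _; set q := Num.max _ _.
  have pB (t : R) : -1 <= Num.max (-1) (Num.min 1 t) <= 1.
    rewrite le_max lexx/= ge_max ge_min lexx/= andbT; lra.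
  have qp : q <= p.
    rewrite /p /q ge_max le_max lexx/= le_max le_min !ge_min lexx/= xy orbT/=.
    by rewrite orbT.
  rewrite leNgt; apply/negP => lt; move: qp; apply/negP; rewrite -ltNge.
  rewrite -(acosK (pB x) : cos (acos q) = q) -(acosK (pB y) : cos (acos p) = p).
  rewrite ltr_cos// in_itv/=.
    by rewrite acos_ge0 ?acos_lepi// pB.
  by rewrite acos_ge0 ?acos_lepi// pB.
have ma : measurable_fun setT (fun x => acos (Num.max (-1) (Num.min 1 (complex.Re (f x)))) / (2 * pi)).
  apply: measurable_funM => //; exact: (measurableT_comp macos (measurable_Re mf)).
apply: measurable_fun_ifT => //; last exact: measurable_funB.
by apply: measurable_fun_ler => //; exact: measurable_Im.
Qed.

End Argument.

Section TorusArithmetic.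
Context (R : realType) (d : nat) (N : dilation d).
Local Notation T := (torus R d).
Local Notation ZA := (ZA N).
Implicit Types (z : T) (c : digit N) (a : ZA).

Lemma N_gt0 i : 0 < (N i)%:R :> R.
Proof. by rewrite ltr0n (ltnW (diag_entry_gt1 N i)). Qed.

(** The coordinatewise arguments [carg] witness that the choice in the
    definition of the argument vector is made from a nonempty set. *)
Lemma torus_argP z : (forall i, 0 <= torus_arg z i < 1) /\ torus_e (torus_arg z) = z.
Proof.
rewrite /torus_arg; case: xgetP => // /(_ (fun i => carg (torus_coord z i))) [].
split=> [i|]; first by have [] := cargP (norm_torus_coord z i).
apply: torus_coord_inj => i; have [_] := cargP (norm_torus_coord z i).
by [].
Qed.

Lemma torus_arg01 z i : 0 <= torus_arg z i < 1.
Proof. by have [] := torus_argP z. Qed.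

Lemma torus_argK z : torus_e (torus_arg z) = z.
Proof. by have [] := torus_argP z. Qed.

Lemma cexp_torus_arg z i : cexp (torus_arg z i) = torus_coord z i.
Proof. by rewrite -[in RHS](torus_argK z). Qed.

Lemma torus_arg_uniq z i (s : R) : 0 <= s < 1 -> cexp s = torus_coord z i ->
  torus_arg z i = s.
Proof.
move=> s01 sE; apply: cexp_inj => //; first exact: torus_arg01.
by rewrite cexp_torus_arg.
Qed.

Lemma torus_arg_carg z i : torus_arg z i = carg (torus_coord z i).
Proof. by have [? ?] := cargP (norm_torus_coord z i); exact: torus_arg_uniq. Qed.

Lemma measurable_torus_arg i : measurable_fun setT (fun z : T => torus_arg z i).
Proof.
under eq_fun do rewrite torus_arg_carg.
by apply: measurable_carg; exact: measurable_torus_coord.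
Qed.

(** The right inverse of beta with image the cell of points whose leading digit
    is c. *)
Definition inv_branch c z : T :=
  torus_e (fun i => (torus_arg z i + (c i)%:R) / (N i)%:R).

(** The digit lost by beta: z is recovered from beta z and this digit, see
    [inv_branch_beta]. The default value is never reached, as the argument lies
    in [0, 1). *)
Definition last_digit z : digit N :=
  [ffun i => insubd (digit0 N i) (Num.truncn ((N i)%:R * torus_arg z i))].

Lemma last_digit_itv z i :
  ((last_digit z i)%:R : R) <= (N i)%:R * torus_arg z i < (last_digit z i)%:R + 1.
Proof.
have /andP[t0 t1] := torus_arg01 z i; have n0 := N_gt0 i.
have x0 : 0 <= (N i)%:R * torus_arg z i by rewrite mulr_ge0// ltW.
rewrite ffunE val_insubd; have /andP[h1 h2] := truncn_itv x0.
rewrite ifT ?natr1 ?h1//.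
rewrite -(ltr_nat R); apply: le_lt_trans h1 _.
by rewrite -[ltRHS]mulr1 ltr_pM2l.
Qed.

Lemma last_digitP z c : (forall i, ((c i)%:R : R) <= (N i)%:R * torus_arg z i < (c i)%:R + 1) ->
  last_digit z = c.
Proof.
move=> H; apply/ffunP => i; apply/val_inj/eqP => /=.
have /andP[a1 a2] := H i; have /andP[b1 b2] := last_digit_itv z i.
rewrite natr1 in a2; rewrite natr1 in b2.
have l1 : (last_digit z i < (c i).+1)%N by rewrite -(ltr_nat R); exact: le_lt_trans b1 a2.
have l2 : (c i < (last_digit z i).+1)%N by rewrite -(ltr_nat R); exact: le_lt_trans a1 b2.
by rewrite eqn_leq -ltnS l1 -ltnS l2.
Qed.

Lemma inv_branch_arg c z i :
  torus_arg (inv_branch c z) i = (torus_arg z i + (c i)%:R) / (N i)%:R.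
Proof.
have /andP[t0 t1] := torus_arg01 z i; have n0 := N_gt0 i.
apply: torus_arg_uniq => //; rewrite divr_ge0 ?addr_ge0 ?(ltW n0)//=.
rewrite ltr_pdivrMr// mul1r.
have : (c i).+1%:R <= (N i)%:R :> R by rewrite ler_nat.
by rewrite -natr1 => ?; lra.
Qed.

Lemma last_digit_inv_branch c z : last_digit (inv_branch c z) = c.
Proof.
apply: last_digitP => i; rewrite inv_branch_arg mulrC divfK ?gt_eqF ?N_gt0//.
by have /andP[? ?] := torus_arg01 z i; apply/andP; split; lra.
Qed.

Lemma beta_inv_branch c z : beta N (inv_branch c z) = z.
Proof.
apply: torus_coord_inj => i; rewrite /torus_coord /= -cexpMn.
rewrite divfK ?gt_eqF ?N_gt0// cexpD cexp_nat mulr1.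
exact: cexp_torus_arg.
Qed.

Lemma beta_arg z i : torus_arg (beta N z) i = (N i)%:R * torus_arg z i - (last_digit z i)%:R.
Proof.
have /andP[b1 b2] := last_digit_itv z i.
apply: torus_arg_uniq; first by apply/andP; split; lra.
have E : cexp ((N i)%:R * torus_arg z i) = torus_coord (beta N z) i.
  by rewrite mulrC cexpMn cexp_torus_arg.
rewrite -E; apply: (@mulIf _ (cexp (last_digit z i)%:R)).
  by rewrite cexp_nat oner_eq0.
by rewrite -cexpD subrK cexp_nat mulr1.
Qed.

Lemma inv_branch_beta z : inv_branch (last_digit z) (beta N z) = z.
Proof.
rewrite -[RHS]torus_argK; apply: torus_coord_inj => i.
rewrite /torus_coord /= beta_arg subrK mulrC mulKf// gt_eqF//.
exact: N_gt0.
Qed.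

Lemma branch0 z a : branch z a 0 = z.
Proof.
rewrite -[RHS]torus_argK; apply: torus_coord_inj => i.
by rewrite /torus_coord /= big_ord0 addr0 expr0 divr1.
Qed.

(** The argument of each branch point already lies in [0, 1), so that branches
    are compositions of one-digit inverse branches; no carry occurs. *)
Lemma branchS z a n : branch z a n.+1 = inv_branch (a n) (branch z a n).
Proof.
pose v n i : R := (torus_arg z i + \sum_(j < n) (N i)%:R ^+ j * (a j i)%:R) / (N i)%:R ^+ n.
have vS k i : v k.+1 i = (v k i + (a k i)%:R) / (N i)%:R.
  have n0 : (N i)%:R != 0 :> R by rewrite gt_eqF// N_gt0.
  rewrite /v big_ord_recr /= addrA exprSr.
  have k0 : (N i)%:R ^+ k != 0 :> R by rewrite expf_neq0.
  by field; rewrite n0 k0.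
have v01 k i : 0 <= v k i < 1.
  have n0 := N_gt0 i; elim: k => [|k /andP[v0 v1]].
    by rewrite /v big_ord0 addr0 expr0 divr1 torus_arg01.
  rewrite vS divr_ge0 ?addr_ge0 ?(ltW n0)//= ltr_pdivrMr// mul1r.
  have : (a k i).+1%:R <= (N i)%:R :> R by rewrite ler_nat.
  by rewrite -natr1 => ?; lra.
have vE k i : torus_arg (branch z a k) i = v k i by exact: torus_arg_uniq.
apply: torus_coord_inj => i; rewrite /torus_coord /= -/(v _ _) vS.
by rewrite vE.
Qed.

Lemma measurable_torus_e d' (S : measurableType d') (t : S -> 'I_d -> R) :
  (forall i, measurable_fun setT (fun s => t s i)) ->
  measurable_fun setT (fun s => torus_e (t s)).
Proof.
move=> mt; apply/measurable_torusP => i.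
have m2 : measurable_fun setT (fun s => 2 * pi * t s i) by exact: measurable_funM.
apply: measurable_cplx_mk.
  exact: (measurableT_comp (continuous_measurable_fun (@continuous_cos R)) m2).
exact: (measurableT_comp (continuous_measurable_fun (@continuous_sin R)) m2).
Qed.

Lemma measurable_inv_branch c : measurable_fun setT (inv_branch c).
Proof.
apply: measurable_torus_e => i; apply: measurable_funM => //.
by apply: measurable_funD => //; exact: measurable_torus_arg.
Qed.

Lemma measurable_beta : measurable_fun setT (@beta R d N).
Proof.
apply/measurable_torusP => i; apply: measurable_cplxX.
exact: measurable_torus_coord.
Qed.

Lemma measurable_last_digit c : measurable [set z : T | last_digit z = c].
Proof.
rewrite (_ : [set _ | _] = \bigcap_(i in [set: 'I_d])
   [set z : T | (c i)%:R <= (N i)%:R * torus_arg z i < (c i)%:R + 1]).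
  apply: fin_bigcap_measurable => // i _.
  rewrite (_ : [set _ | _] = (fun z : T => (N i)%:R * torus_arg z i) @^-1` `[(c i)%:R, (c i)%:R + 1[); last first.
    by apply/seteqP; split => z /=; rewrite in_itv.
  rewrite -[X in measurable X]setTI.
  by apply: measurable_funM => //; exact: measurable_torus_arg.
apply/seteqP; split => [z <- i _ /=|z zi]; first exact: last_digit_itv.
by apply: last_digitP => i; exact: zi.
Qed.

Definition digit_shift c : T := torus_e (fun i => (c i)%:R / (N i)%:R).

(** All inverse branches are translates of one of them, which is why they scale
    Haar measure by the same factor. *)
Lemma inv_branch_translate c z :
  inv_branch c z = torus_mul (digit_shift c) (inv_branch (digit0 N : digit N) z).
Proof.
apply: torus_coord_inj => i; rewrite /torus_coord /= -cexpD; congr cexp.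
by rewrite ffunE /= addr0 mulrDl addrC.
Qed.

End TorusArithmetic.

(** * Haar measure and beta *)

Section Haar.
Context (R : realType) (d : nat) (N : dilation d).
Local Notation T := (torus R d).
Variable mu : probability T R.
Hypothesis hmu : is_normalized_haar mu.
Implicit Types (z w : T) (v : {ffun 'I_d -> int}).

Lemma cintegrable_char v : cintegrable mu (@torus_char R d v).
Proof.
apply: (@cintegrable_bounded _ _ _ _ _ 1); first exact: probability_lty.
  exact: measurable_torus_char.
by move=> z; rewrite normc_torus_char.
Qed.

Lemma measurable_torus_mul w : measurable_fun setT (torus_mul w).
Proof.
apply/measurable_torusP => i; apply: measurable_cplxM; first exact: measurable_cst.
exact: measurable_torus_coord.
Qed.

Lemma torus_mul_surj w (B : set T) : torus_mul w @` (torus_mul w @^-1` B) = B.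
Proof.
apply/seteqP; split=> [_ [z Bz <-]//|z Bz].
have h i : `|(torus_coord w i)^-1 * torus_coord z i| = 1.
  by rewrite normrM normfV !norm_torus_coord invr1 mulr1.
have E : torus_mul w (mk_torus h) = z.
  apply: torus_coord_inj => i; rewrite /torus_coord /=.
  by rewrite -/(torus_coord w i) mulVKf// torus_coord_neq0.
by exists (mk_torus h); rewrite //= E.
Qed.

Lemma haar_preimage w (B : set T) : measurable B -> mu (torus_mul w @^-1` B) = mu B.
Proof.
move=> mB; rewrite -[in RHS](torus_mul_surj w B) hmu//.
by rewrite -[X in measurable X]setTI; exact: measurable_torus_mul.
Qed.

Lemma cintegral_pushforward d1 d2 (X : measurableType d1) (Y : measurableType d2)
    (m1 : {measure set X -> \bar R}) (m2 : {measure set Y -> \bar R})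
    (phi : X -> Y) (f : Y -> R[i]) :
  measurable_fun setT phi -> (forall B, measurable B -> m2 B = m1 (phi @^-1` B)) ->
  measurable_fun setT f -> cintegrable m1 (f \o phi) ->
  cintegral m2 f = cintegral m1 (f \o phi).
Proof.
move=> mphi m12 mf [i1 i2].
have E (g : Y -> R) : measurable_fun setT g -> m1.-integrable setT (EFin \o (g \o phi)) ->
    \int[m2]_y g y = \int[m1]_x g (phi x).
  move=> mg ig; congr fine.
  rewrite -(@integral_pushforward _ _ X Y R phi mphi m1 setT (EFin \o g)) //.
  - by apply: eq_measure_integral => A mA _; exact: m12.
  - exact/measurable_EFinP.
rewrite /cintegral; congr (_ +i* _)%C; apply: (E (fun y => _)) => //.
- exact: measurable_Re.
- exact: measurable_Im.
Qed.

Lemma torus_char_mul v w z : torus_char v (torus_mul w z) = torus_char v w * torus_char v z.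
Proof.
rewrite /torus_char -big_split; apply: eq_bigr => i _ /=.
by rewrite -expfzMl.
Qed.

Lemma cexp_half : cexp (1 / 2) = -1 :> R[i].
Proof.
rewrite /cexp (_ : 2 * pi * (1 / 2) = pi); last by field.
by rewrite cospi sinpi; apply/eqP; rewrite eq_complex /= oppr0 !eqxx.
Qed.

(** On the i-th coordinate, take the root of unity e(1/(2|v_i|)). *)
Lemma torus_char_nontrivial v : v != [ffun=> 0] -> exists w : T, torus_char v w = -1.
Proof.
move=> v0; have [i vi] : exists i, v i != 0.
  apply/existsP; apply: contraNT v0; rewrite negb_exists => /forallP h.
  by apply/eqP/ffunP => i; rewrite ffunE; apply/eqP; move: (h i); rewrite negbK.
pose n := `|v i|%N.
have n0 : (0 < n)%N by rewrite absz_gt0.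
exists (torus_e (fun j => if j == i then 1 / 2 / n%:R else 0)).
rewrite /torus_char (bigD1 i)//= big1 ?mulr1; last first.
  move=> j ji; rewrite /torus_coord /= (negbTE ji) (_ : 0 = 0%:R :> R)// cexp_nat.
  by rewrite exp1rz.
rewrite /torus_coord /= eqxx.
have E : cexp (1 / 2 / n%:R) ^+ n = -1 :> R[i].
  by rewrite -cexpMn divfK ?pnatr_eq0 -?lt0n// cexp_half.
move: E; rewrite /n; case: (v i) => k /= E; first exact: E.
by rewrite NegzE -exprnN E invrN invr1.
Qed.

(** Translating by w multiplies the character by -1 and does not change its
    integral. *)
Lemma haar_char v : cintegral mu (@torus_char R d v) = (v == [ffun=> 0])%:R.
Proof.
have [->|v0] := eqVneq v [ffun=> 0].
  rewrite (cintegral_ext _ (@torus_char0 R d)) /cintegral.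
  rewrite !Rintegral_cst//= mul0r mul1r.
  have mT : mu setT = 1%E := probability_setT mu.
  by rewrite mT.
have [w cw] := torus_char_nontrivial v0.
have h : cintegral mu (@torus_char R d v) = cintegral mu (@torus_char R d v \o torus_mul w).
  apply: cintegral_pushforward.
  - exact: measurable_torus_mul.
  - by move=> B mB; apply/esym; exact: haar_preimage.
  - exact: measurable_torus_char.
  - rewrite (_ : _ \o _ = fun z => (-1) * torus_char v z).
      by apply: cintegrableZ; exact: cintegrable_char.
    by apply/funext => z; rewrite /= torus_char_mul cw.
rewrite (_ : _ \o _ = fun z => (-1) * torus_char v z) in h; last first.
  by apply/funext => z; rewrite /= torus_char_mul cw.
rewrite cintegralZ in h; last exact: cintegrable_char.
have : cintegral mu (@torus_char R d v) *+ 2 = 0 by rewrite mulr2n {1}h mulN1r addNr.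
by move/eqP; rewrite mulrn_eq0 /= => /eqP.
Qed.

Lemma torus_char_beta v z : torus_char v (beta N z) = torus_char [ffun i => (N i)%:Z * v i] z.
Proof.
rewrite /torus_char; apply: eq_bigr => i _.
by rewrite ffunE -exprz_exp.
Qed.

(** The Fourier coefficients of the image measure are those of mu at the
    multiplied frequencies N_i v_i, which vanish only together with v. *)
Lemma haar_beta (B : set T) : measurable B -> mu (@beta R d N @^-1` B) = mu B.
Proof.
move=> mB; have mb := @measurable_beta R d N.
have [rho [rhoE _]] := @weighted_pushforward _ _ T T R mu (cst 1) (@beta R d N)
  (measurable_cst _) (fun=> ler01) mb.
have {}rhoE A : measurable A -> rho A = mu (@beta R d N @^-1` A).
  move=> mA; rewrite rhoE//= integral_cst ?mul1e//.
  by rewrite -[X in measurable X]setTI; exact: mb.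
rewrite -rhoE//; apply: torus_measure_eq => //.
- by rewrite rhoE// preimage_setT probability_lty.
- exact: probability_lty.
move=> v.
have -> : cintegral rho (@torus_char R d v) = cintegral mu (@torus_char R d v \o @beta R d N).
  apply: (@cintegral_pushforward _ _ T T mu rho (@beta R d N)).
  - exact: mb.
  - exact: rhoE.
  - exact: measurable_torus_char.
  - apply: (@cintegrable_bounded _ _ _ _ _ 1).
    + exact: probability_lty.
    + apply: measurableT_comp; [exact: measurable_torus_char|exact: mb].
    + by move=> z; rewrite /= normc_torus_char.
rewrite (cintegral_ext _ (torus_char_beta v)) !haar_char; congr ((nat_of_bool _)%:R).
apply/eqP/eqP => /ffunP h; apply/ffunP => i; rewrite ffunE.
  have := h i; rewrite !ffunE => /eqP; rewrite mulf_eq0 => /orP[|/eqP//].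
  by rewrite eqz_nat eqn0Ngt (ltnW (diag_entry_gt1 N i)).
by rewrite ffunE h ffunE mulr0.
Qed.

Let num : nat := \prod_i N i.

Lemma card_digit : #|{: digit N}| = num.
Proof.
rewrite [LHS]card_dep_ffun foldrE big_map enumT.
by apply: eq_bigr => i _; rewrite card_ord.
Qed.

Lemma num_gt0 : (0 < num)%N.
Proof. by apply: prodn_gt0 => i; exact: ltnW (diag_entry_gt1 N i). Qed.

Lemma measurable_cell (c : digit N) (B : set T) : measurable B ->
  measurable [set z : T | last_digit N z = c /\ B (beta N z)].
Proof.
move=> mB; apply: measurableI; first exact: measurable_last_digit.
by rewrite -[X in measurable X]setTI; exact: measurable_beta.
Qed.

(** The preimage of B under beta is the disjoint union of N cells, which are
    translates of each other. *)
Lemma haar_cell (c : digit N) (B : set T) : measurable B ->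
  (num%:R%:E * mu [set z : T | last_digit N z = c /\ B (beta N z)] = mu B)%E.
Proof.
move=> mB; pose S (c : digit N) := [set z : T | last_digit N z = c /\ B (beta N z)].
have SE e : S e = inv_branch e @` B.
  apply/seteqP; split=> [z [ze Bz]|_ [z Bz <-]].
    by exists (beta N z) => //; rewrite -ze inv_branch_beta.
  by split; rewrite ?last_digit_inv_branch ?beta_inv_branch.
have Seq e : mu (S e) = mu (S (digit0 N)).
  rewrite !SE -[RHS](hmu (digit_shift R e)); last by rewrite -SE; exact: measurable_cell.
  rewrite image_comp; congr (mu _); apply: eq_imagel => z _ /=.
  exact: inv_branch_translate.
rewrite -[in RHS](haar_beta mB).
rewrite (_ : _ @^-1` _ = \big[setU/set0]_(k < #|{: digit N}|) S (enum_val k)); last first.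
  rewrite -bigcup_seq; apply/seteqP; split=> [z Bz|z [k _ []]//].
  by exists (enum_rank (last_digit N z)); rewrite /S /= ?mem_index_enum ?enum_rankK.
rewrite measure_bigsetU_ord; last 2 first.
- by move=> k; exact: measurable_cell.
- by move=> k1 k2 _ _ [z [[zk1 _] [zk2 _]]]; apply: enum_val_inj; rewrite -zk1 -zk2.
rewrite (eq_bigr (fun=> mu (S (digit0 N)))); last by move=> k _; exact: Seq.
have fS : mu (S (digit0 N)) \is a fin_num by apply: fin_num_measure; exact: measurable_cell.
rewrite -/(S c) Seq -(fineK fS) -EFinM sumEFin; congr (_%:E).
by rewrite sumr_const card_ord card_digit mulr_natl.
Qed.

Lemma haar_change_of_variables (c : digit N) (F : T -> \bar R) :
  measurable_fun setT F -> (forall z, (0 <= F z)%E) ->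
  (num%:R%:E * \int[mu]_(z in [set z | last_digit N z = c]) F z =
   \int[mu]_z F (inv_branch c z))%E.
Proof.
move=> mF F0; have mb := @measurable_beta R d N.
have mc : measurable [set z : T | last_digit N z = c] by exact: measurable_last_digit.
have mFb : measurable_fun setT (fun z => F (inv_branch c z)).
  by apply: measurableT_comp => //; exact: measurable_inv_branch.
have [rho [rhoE rhoI]] := @weighted_pushforward _ _ T T R mu
  (\1_[set z : T | last_digit N z = c]) (@beta R d N)
  (measurable_indic mc) (fun z => ler0n _ _) mb.
have n0 : (0 <= num%:R :> R) by rewrite ler0n.
have E : (\int[rho]_z F (inv_branch c z) = \int[mu]_(z in [set z | last_digit N z = c]) F z)%E.
  rewrite rhoI// [RHS]integral_mkcond; apply: eq_integral => z _.
  rewrite patchE indicE; case: ifPn => zc; last by rewrite mule0.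
  by rewrite mule1; move: zc; rewrite inE => /= <-; rewrite inv_branch_beta.
have sE A : measurable A -> mscale (NngNum n0) rho A = mu A.
  move=> mA; rewrite -(haar_cell c mA) /mscale /=; congr (_ * _)%E.
  rewrite (rhoE A mA) integral_indic//.
  by rewrite -[X in measurable X]setTI; exact: mb.
rewrite -E -(@ge0_integral_mscale _ _ _ rho _ measurableT (NngNum n0))//.
by apply: eq_measure_integral => A mA _; exact: sE.
Qed.

End Haar.

(** * Disintegration over the torus *)

Section CylinderInduction.
Context (d : nat) (N : dilation d).
Local Notation ZA := (ZA N).

Definition cylinders : set (set ZA) :=
  [set F | F = set0 \/ exists k a, F = cylinder k a].

Lemma cylinders_generate : @measurable _ ZA = <<s cylinders >>.
Proof.
apply/seteqP; split.
  apply: smallest_sub; first exact: smallest_sigma_algebra.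
  move=> U oU; rewrite (open_ZA_cylinders oU) bigcup_mkcond.
  apply: (@countable_bigcupT_measurable _ (g_sigma_algebraType cylinders)) => // s.
  case: ifP => _; last exact: measurable0.
  by apply: sub_sigma_algebra; right; exists (size s), (ext_digits s).
apply: smallest_sub; first exact: sigma_algebra_measurable.
by move=> _ [->|[k [a ->]]]; [exact: measurable0|exact: measurable_cylinder].
Qed.

(** Two cylinders that meet can be centred at a common point. *)
Lemma cylinders_setI : setI_closed cylinders.
Proof.
move=> A B [->|[k [a ->]]]; first by rewrite set0I; left.
move=> [->|[l [b ->]]]; first by rewrite setI0; left.
have [[c [ac bc]]|no] := pselect (exists c, cylinder k a c /\ cylinder l b c).
  right; exists (maxn k l), c; apply/seteqP; split=> x.
    move=> [xa xb] j; rewrite leq_max => /orP[jk|jl]; first by rewrite xa// ac.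
    by rewrite xb// bc.
  by move=> xc; split=> j h; [rewrite -ac// xc// leq_max h|rewrite -bc// xc// leq_max h orbT].
by left; apply/seteqP; split => // c [ac bc]; apply: no; exists c.
Qed.

Lemma cylinder0 (a : ZA) : cylinder 0 a = setT.
Proof. by apply/seteqP; split => // b _ j; rewrite ltn0. Qed.

(** Dynkin's lemma for the intersection-stable family of cylinders. *)
Lemma cylinder_induction (P : set (set ZA)) :
  (forall k a, P (cylinder k a)) ->
  (forall F, measurable F -> P F -> P (~` F)) ->
  (forall F : (set ZA)^nat, (forall n, measurable (F n)) -> trivIset setT F ->
     (forall n, P (F n)) -> P (\bigcup_n F n)) ->
  forall F, measurable F -> P F.
Proof.
move=> Pc PC PU F; have PT : P setT by rewrite -(cylinder0 point).
rewrite cylinders_generate.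
apply: (@dynkin_induction _ ZA cylinders P) => //.
- exact: cylinders_generate.
- exact: cylinders_setI.
- by move=> _ [->|[k [a ->]]] //; rewrite -setCT; apply: PC.
Qed.

End CylinderInduction.

Lemma rectangle_induction d1 d2 (X : measurableType d1) (Y : measurableType d2)
    (P : set (set (X * Y))) :
  (forall A B, measurable A -> measurable B -> P (A `*` B)) ->
  (forall F, measurable F -> P F -> P (~` F)) ->
  (forall F : (set (X * Y))^nat, (forall n, measurable (F n)) -> trivIset setT F ->
     (forall n, P (F n)) -> P (\bigcup_n F n)) ->
  forall F, measurable F -> P F.
Proof.
move=> PR PC PU F; rewrite measurable_prod_measurableType.
apply: (@dynkin_induction _ (X * Y)%type [set A `*` B | A in measurable & B in measurable] P) => //.
- exact: measurable_prod_measurableType.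
- move=> _ _ [A1 mA1 [B1 mB1 <-]] [A2 mA2 [B2 mB2 <-]].
  exists (A1 `&` A2); first exact: measurableI.
  by exists (B1 `&` B2); [exact: measurableI|rewrite setXI].
- by rewrite -setXTT; apply: PR.
- by move=> _ [A mA [B mB <-]]; exact: PR.
Qed.

Section Disintegration.
Context d1 (X : measurableType d1) (d : nat) (N : dilation d) (R : realType).
Local Notation ZA := (ZA N).
Variables (mu : probability X R) (taut : probability (X * ZA)%type R).
Variable nu : X -> probability ZA R.
Hypothesis mnu : forall k a, measurable_fun setT (fun z => nu z (cylinder k a)).
Hypothesis taut_cyl : forall B k a, measurable B ->
  taut (B `*` cylinder k a) = (\int[mu]_(z in B) nu z (cylinder k a))%E.

Let nuT z : nu z setT = 1%E.
Proof. exact: probability_setT. Qed.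

Let nuC z F : measurable F -> nu z (~` F) = (1 - nu z F)%E.
Proof. by move=> mF; rewrite -probability_setC. Qed.

Let nu_fin z F : measurable F -> nu z F \is a fin_num.
Proof. exact: fin_num_measure. Qed.

Let tautT_fin F : measurable F -> (taut F < +oo)%E.
Proof. by move=> mF; rewrite -ge0_fin_numE//; exact: fin_num_measure. Qed.

(** Measurability of z |-> nu z F and the formula on rectangles are proved
    together, as the class of sets F with both properties is closed under
    complements and disjoint unions. *)
Lemma disintegration_rect F : measurable F ->
  measurable_fun setT (fun z => nu z F) /\
  forall B, measurable B -> taut (B `*` F) = (\int[mu]_(z in B) nu z F)%E.
Proof.
move: F; apply: (@cylinder_induction d N (fun F => measurable_fun setT (fun z => nu z F) /\
  forall B, measurable B -> taut (B `*` F) = (\int[mu]_(z in B) nu z F)%E)).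
- by move=> k a; split => // B mB; exact: taut_cyl.
- move=> F mF [mnuF tF]; have mC : measurable_fun setT (fun z => nu z (~` F)).
    under eq_fun do rewrite nuC//.
    by apply: emeasurable_funB.
  split=> // B mB.
  have tB : taut (B `*` setT) = mu B.
    rewrite -(cylinder0 point) taut_cyl// cylinder0.
    under eq_integral do rewrite nuT.
    by rewrite integral_cst// mul1e.
  have muB : mu B = (\int[mu]_(z in B) nu z (~` F) + \int[mu]_(z in B) nu z F)%E.
    rewrite -ge0_integralD//; last 2 first.
      exact: measurable_funTS.
      exact: measurable_funTS.
    rewrite (eq_integral (fun=> 1%E)) ?integral_cst ?mul1e// => z _.
    by rewrite nuC// subeK// nu_fin.
  have tU : (taut (B `*` ~` F) + taut (B `*` F) = mu B)%E.
    rewrite -measureU; last 3 first.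
    - by apply: measurableX => //; exact: measurableC.
    - exact: measurableX.
    - by rewrite -setXI setICl setX0.
    rewrite -tB; congr (taut _); apply/seteqP; split => [[x b] [] []//|[x b] [Bx _]].
    by have [Fb|nFb] := pselect (F b); [right|left].
  have fY : taut (B `*` F) \is a fin_num by apply: fin_num_measure; exact: measurableX.
  by rewrite -[LHS](addeK _ fY) tU muB -tF// addeK.
- move=> F mF tF PF.
  have nuU z : nu z (\bigcup_n F n) = (\sum_(n <oo) nu z (F n))%E.
    by rewrite measure_semi_bigcup//; exact: bigcup_measurable.
  have mU : measurable_fun setT (fun z => nu z (\bigcup_n F n)).
    under eq_fun do rewrite nuU.
    by apply: ge0_emeasurable_sum => // n _; case: (PF n).
  split => // B mB; rewrite setX_bigcupr measure_semi_bigcup//; last 3 first.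
  - by move=> n; exact: measurableX.
  - apply/trivIsetP => i j _ _ ij; rewrite -setXI.
    by move/trivIsetP : tF => /(_ i j I I ij) ->; rewrite setIid setX0.
  - by apply: bigcup_measurable => n _; exact: measurableX.
  under [RHS]eq_integral do rewrite nuU.
  rewrite integral_nneseries//; last first.
    by move=> n; apply: measurable_funTS; case: (PF n).
  by apply: eq_eseriesr => n _; have [_ h] := PF n; exact: h.
Qed.

Lemma disintegration_set F : measurable F ->
  measurable_fun setT (fun z => nu z (xsection F z)) /\
  taut F = (\int[mu]_z nu z (xsection F z))%E.
Proof.
move: F; apply: rectangle_induction.
- move=> A B mA mB; have [mnB tB] := disintegration_rect mB.
  have E : (fun z => nu z (xsection (A `*` B) z)) = (fun z => (\1_A z)%:E * nu z B)%E.
    apply/funext => z; rewrite indicE; have [zA|zA] := boolP (z \in A).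
      by rewrite in_xsectionX// mul1e.
    by rewrite notin_xsectionX// measure0 mul0e.
  split.
    by rewrite E; apply: emeasurable_funM => //; exact/measurable_EFinP.
  rewrite tB// E [LHS]integral_mkcond; apply: eq_integral => z _.
  by rewrite patchE indicE; case: (z \in A); rewrite ?mul1e ?mul0e.
- move=> F mF [mnF tF].
  have E z : nu z (xsection (~` F) z) = (1 - nu z (xsection F z))%E.
    rewrite -nuC; last exact: measurable_xsection.
    by congr (nu z _); apply/seteqP; split => a; rewrite /xsection /= !inE.
  have m1 : measurable_fun setT (fun z => nu z (xsection (~` F) z)).
    by under eq_fun do rewrite E; exact: emeasurable_funB.
  split=> //.
  have muT : ((1 : \bar R) = \int[mu]_z nu z (xsection (~` F) z) + \int[mu]_z nu z (xsection F z))%E.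
    rewrite -ge0_integralD//.
    rewrite (eq_integral (fun=> 1%E)) ?integral_cst ?mul1e//.
      exact/esym/probability_setT.
    move=> z _; rewrite E subeK//; apply: nu_fin; exact: measurable_xsection.
  have fY : taut F \is a fin_num by exact: fin_num_measure.
  by rewrite (probability_setC taut mF) muT -tF addeK.
- move=> F mF tF PF.
  have nuU z : nu z (xsection (\bigcup_n F n) z) = (\sum_(n <oo) nu z (xsection (F n) z))%E.
    rewrite xsection_bigcup measure_semi_bigcup//.
    - by move=> n; exact: measurable_xsection.
    - by apply: trivIset_xsection.
    - by apply: bigcup_measurable => n _; exact: measurable_xsection.
  split.
    under eq_fun do rewrite nuU.
    by apply: ge0_emeasurable_sum => // n _; case: (PF n).
  rewrite measure_semi_bigcup//; last by exact: bigcup_measurable.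
  under [RHS]eq_integral do rewrite nuU.
  rewrite integral_nneseries//; last by move=> n; case: (PF n).
  by apply: eq_eseriesr => n _; have [_ h] := PF n; exact: h.
Qed.

Lemma disintegration_ge0 (f : X * ZA -> \bar R) :
  measurable_fun setT f -> (forall x, (0 <= f x)%E) ->
  measurable_fun setT (fun z => \int[nu z]_a f (z, a))%E /\
  (\int[taut]_x f x = \int[mu]_z \int[nu z]_a f (z, a))%E.
Proof.
have mf1 (h : X * ZA -> \bar R) z : measurable_fun setT h -> measurable_fun setT (fun a => h (z, a)).
  by move=> mh; exact: (measurableT_comp mh (pair1_measurable z)).
move: f; apply: ge0_measurable_ind.
- move=> F mF; have [mnF tF] := disintegration_set mF.
  have E z : (\int[nu z]_a (\1_F (z, a))%:E = nu z (xsection F z))%E.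
    rewrite -[in RHS](setIT (xsection F z)) -integral_indic//; last exact: measurable_xsection.
    by apply: eq_integral => a _; rewrite !indicE mem_xsection.
  split; first by under eq_fun do rewrite E.
  rewrite integral_indic// setIT; apply: (etrans tF).
  by apply: eq_integral => z _; rewrite E.
- move=> f g mf mg f0 g0 [mif tf] [mig tg].
  have E z : (\int[nu z]_a (f (z, a) + g (z, a)) = \int[nu z]_a f (z, a) + \int[nu z]_a g (z, a))%E.
    by rewrite ge0_integralD//; exact: mf1.
  split; first by under eq_fun do rewrite E; exact: emeasurable_funD.
  have i0 (h : X * ZA -> \bar R) : (forall x, (0 <= h x)%E) ->
      forall z, setT z -> (0 <= \int[nu z]_a h (z, a))%E.
    by move=> h0 z _; apply: integral_ge0 => a _; exact: h0.
  rewrite (ge0_integralD taut measurableT (fun x _ => f0 x) mf (fun x _ => g0 x) mg).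
  rewrite [X in (X + _)%E]tf [X in (_ + X)%E]tg.
  rewrite -(ge0_integralD mu measurableT (i0 _ f0) mif (i0 _ g0) mig).
  by apply: eq_integral => z _; rewrite E.
- move=> c f c0 mf f0 [mif tf].
  have E z : (\int[nu z]_a (c%:E * f (z, a)) = c%:E * \int[nu z]_a f (z, a))%E.
    by rewrite ge0_integralZl//; exact: mf1.
  split; first by under eq_fun do rewrite E; exact: measurable_funeM.
  rewrite ge0_integralZl//.
  rewrite [X in (_ * X)%E]tf.
  rewrite -ge0_integralZl//.
  + by apply: eq_integral => z _; rewrite E.
  + by move=> z _; exact: integral_ge0.
move=> u mu_ u0 nd PU.
have E z : (\int[nu z]_a limn (u ^~ (z, a)) = limn (fun n => \int[nu z]_a u n (z, a)))%E.
  by rewrite monotone_convergence// => n; exact: mf1.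
have ndI z : {homo (fun n => \int[nu z]_a u n (z, a))%E : n m / (n <= m)%N >-> (n <= m)%E}.
  move=> n m nm; apply: ge0_le_integral => //; try exact: mf1.
  by move=> a _; exact: nd.
split.
  under eq_fun do rewrite E.
  apply: (@emeasurable_fun_cvg _ _ _ _ (fun n z => \int[nu z]_a u n (z, a))%E) => //.
    by move=> n; case: (PU n).
  move=> z _; apply: ereal_nondecreasing_is_cvgn; exact: ndI.
rewrite monotone_convergence//.
under [RHS]eq_integral do rewrite E.
rewrite monotone_convergence//.
- by congr (limn _); apply/funext => n; case: (PU n).
- by move=> n; case: (PU n).
- by move=> n z _; exact: integral_ge0.
Qed.

End Disintegration.

(** * Masses of cylinders in the product picture *)

Section Cells.
Context (R : realType) (d : nat) (N : dilation d).
Local Notation T := (torus R d).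
Local Notation ZA := (ZA N).
Implicit Types (a b : ZA) (B : set T).

(** The points w with beta^k w in B whose k successively lost digits are
    a_(k-1), ..., a_0: the image of B under the branch with digits a_0, ...,
    a_(k-1). *)
Fixpoint cell (k : nat) a B : set T :=
  if k is k'.+1 then [set w | last_digit N w = a k' /\ cell k' a B (beta N w)]
  else B.

Lemma measurable_beta_preimage B : measurable B -> measurable (@beta R d N @^-1` B).
Proof. by move=> mB; rewrite -[X in measurable X]setTI; exact: measurable_beta. Qed.

Lemma measurable_cell_seq k a B : measurable B -> measurable (cell k a B).
Proof.
move=> mB; elim: k => //= k IH; apply: measurableI; first exact: measurable_last_digit.
exact: measurable_beta_preimage.
Qed.

Lemma cell_branch k a b B (z : T) : B z -> cylinder k a b -> cell k a B (branch z b k).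
Proof.
move=> Bz; elim: k => [|k IH] ab /=; first by rewrite branch0.
rewrite branchS last_digit_inv_branch beta_inv_branch; split; first exact: ab.
by apply: IH => j jk; apply: ab; rewrite ltnS ltnW.
Qed.

Lemma branch_solenoid (x : solenoid R N) n :
  branch (solenoid_proj 0 x) (fun j => last_digit N (solenoid_proj j.+1 x)) n =
  solenoid_proj n x.
Proof.
have sx k : beta N (solenoid_proj k.+1 x) = solenoid_proj k x := set_valP x k.
by elim: n => [|n IH]; rewrite ?branch0// branchS IH -(sx n) inv_branch_beta.
Qed.

(** A point of the solenoid is determined by its projection to level 0 and the
    digits lost on the way up, so that Theta is onto, and the first k digits
    are read off from level k. *)
Lemma Theta_cylinder k a B :
  @Theta R d N @` (B `*` cylinder k a) = solenoid_proj k @^-1` cell k a B.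
Proof.
apply/seteqP; split=> [_ [[z b] [Bz ab] <-]|x xc].
  exact: cell_branch.
pose b : ZA := fun j => last_digit N (solenoid_proj j.+1 x).
have sx j : beta N (solenoid_proj j.+1 x) = solenoid_proj j x := set_valP x j.
have [Bz ab] : B (solenoid_proj 0 x) /\ cylinder k a b.
  move: xc => /=; elim: k => [|k IH] //= [bk]; rewrite sx => /IH[Bz ab].
  by split => // j; rewrite ltnS leq_eqVlt => /predU1P[->//|/ab].
exists (solenoid_proj 0 x, b) => //.
apply: val_inj; apply: funext => n /=.
exact: branch_solenoid.
Qed.

Lemma measurable_branch a k : measurable_fun setT (fun z : T => branch z a k).
Proof.
elim: k => [|k IH].
  by rewrite (_ : (fun _ => _) = id); [exact: measurable_id|apply/funext => z; exact: branch0].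
rewrite (_ : (fun _ => _) = inv_branch (a k) \o (fun z : T => branch z a k)).
  exact: (measurableT_comp (measurable_inv_branch (a k)) IH).
by apply/funext => z; exact: branchS.
Qed.

Variable mu : probability T R.
Hypothesis hmu : is_normalized_haar mu.

(** Each of the k inverse branches contracts Haar measure by the factor N. *)
Lemma cell_change_of_variables k a B (G : T -> \bar R) : measurable B ->
  measurable_fun setT G -> (forall z, (0 <= G z)%E) ->
  (((\prod_i N i) ^ k)%:R%:E * \int[mu]_(z in cell k a B) G z =
   \int[mu]_(z in B) G (branch z a k))%E.
Proof.
move=> mB; elim: k G => [|k IH] G mG G0.
  rewrite expn0 mul1e; apply: eq_integral => z _; by rewrite branch0.
have mc := measurable_cell_seq k a mB.
pose H z := (G z * (\1_(cell k a B) (beta N z))%:E)%E.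
have mH : measurable_fun setT H.
  apply: emeasurable_funM => //; apply/measurable_EFinP.
  exact: (measurableT_comp (measurable_indic mc) (@measurable_beta R d N)).
have H0 z : (0 <= H z)%E by rewrite mule_ge0// lee_fin.
have HE : (\int[mu]_(z in cell k.+1 a B) G z =
    \int[mu]_(z in [set z | last_digit N z = a k]) H z)%E.
  rewrite [LHS]integral_mkcond [RHS]integral_mkcond; apply: eq_integral => z _.
  rewrite !patchE /H indicE /=.
  have [c1|c1] := pselect (last_digit N z = a k); last first.
    rewrite [in LHS]memNset ?[in RHS]memNset//.
    by move=> [].
  rewrite [in RHS]mem_set//.
  have [c2|c2] := pselect (cell k a B (beta N z)).
    by rewrite !mem_set// mule1.
  by rewrite !memNset ?mule0// => -[].
rewrite HE expnS natrM EFinM -muleA muleCA.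
rewrite haar_change_of_variables//.
have mGb : measurable_fun setT (fun z => G (inv_branch (a k) z)).
  by apply: (measurableT_comp mG); exact: measurable_inv_branch.
rewrite (_ : (\int[mu]_z H (inv_branch (a k) z) =
    \int[mu]_(z in cell k a B) G (inv_branch (a k) z))%E); last first.
  rewrite [RHS]integral_mkcond; apply: eq_integral => z _.
  rewrite patchE /H beta_inv_branch indicE.
  by case: (z \in cell k a B); rewrite ?mule1 ?mule0.
by rewrite IH//; apply: eq_integral => z _; rewrite branchS.
Qed.

Variable m : T -> R[i].
Hypothesis mm : measurable_fun setT m.
Variable tau : probability (solenoid R N) R.
Hypothesis htau : is_solenoid_measure mu m tau.

(** The density of the image of tau at level k. *)
Definition weight k (z : T) : R := \prod_(j < k) normc (m (iter j (beta N) z)) ^+ 2.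

Lemma measurable_iter_beta j : measurable_fun setT (iter j (@beta R d N)).
Proof.
elim: j => [|j IH]; first exact: measurable_id.
exact: (measurableT_comp (@measurable_beta R d N) IH).
Qed.

Lemma measurable_weight k : measurable_fun setT (weight k).
Proof.
apply: measurable_prod => j _; apply: measurable_normc2.
exact: (measurableT_comp mm (measurable_iter_beta j)).
Qed.

Lemma weight_ge0 k z : 0 <= weight k z.
Proof. by apply: prodr_ge0 => j _; exact: sqr_ge0. Qed.

Lemma weight_int k : (\int[mu]_z (weight k z)%:E = 1)%E.
Proof.
have := htau k (@cst_continuous T R[i] 1).
rewrite /cintegral => /eqP; rewrite eq_complex => /andP[/eqP + _].
rewrite [LHS](_ : _ = 1); last first.
  have tT : tau setT = 1%E := probability_setT tau.
  rewrite /= Rintegral_cst// mul1r; exact: (congr1 fine tT).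
rewrite [RHS](_ : _ = fine (\int[mu]_z (weight k z)%:E)); last first.
  rewrite /=; apply: eq_Rintegral => z _.
  by rewrite mul1r mulr0 subr0.
by case: (\int[mu]_z _)%E => [r /= <-| |] //= /eqP; rewrite oner_eq0.
Qed.

Lemma measurable_solenoid_proj k : measurable_fun setT (@solenoid_proj R d N k).
Proof.
have c : continuous (@solenoid_proj R d N k).
  move=> x; apply: (@continuous_comp _ _ _ (fun x : solenoid R N => \val x : prod_topology _) (fun w => w k)).
    exact: initial_continuous.
  exact: (@proj_continuous _ _ k).
apply: (@measurable_into_borel _ _ T) => U oU; apply: sub_sigma_algebra.
by move/continuousP : c; exact.
Qed.

(** The defining property of tau, tested on characters, says that both measures
    have the same Fourier coefficients. *)
Lemma tau_proj k (C : set T) : measurable C ->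
  (tau (solenoid_proj k @^-1` C) = \int[mu]_(z in C) (weight k z)%:E)%E.
Proof.
move=> mC; have mp := measurable_solenoid_proj k.
have [r1 [r1E r1I]] := @weighted_pushforward _ _ (solenoid R N) T R tau (cst 1)
  (@solenoid_proj R d N k) (measurable_cst _) (fun=> ler01) mp.
have [r2 [r2E r2I]] := @weighted_pushforward _ _ T T R mu (weight k)
  id (measurable_weight k) (weight_ge0 k) (@measurable_id _ _ setT).
have <- : r1 C = tau (solenoid_proj k @^-1` C).
  rewrite r1E//= integral_cst ?mul1e//.
  by rewrite -[X in measurable X]setTI; exact: mp.
rewrite -(r2E C mC); apply: torus_measure_eq => //.
- rewrite r1E//= preimage_setT integral_cst// mul1e.
  exact: probability_lty.
- by rewrite r2E// preimage_setT weight_int ltry.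
move=> v; rewrite (cintegral_weighted (fun=> ler01) r1I); last exact: measurable_torus_char.
rewrite (cintegral_weighted (weight_ge0 k) r2I); last exact: measurable_torus_char.
rewrite -(htau k (@torus_char_continuous R d v)).
by apply: cintegral_ext => x /=; rewrite mulr1.
Qed.

Lemma iter_beta_branch (z : T) a k j : (j <= k)%N ->
  iter j (beta N) (branch z a k) = branch z a (k - j).
Proof.
elim: j => [|j IH] jk; first by rewrite subn0.
rewrite iterS IH 1?ltnW// -(subnSK jk) branchS beta_inv_branch.
by rewrite subnS.
Qed.

(** Running back along a branch reverses the order of the factors. *)
Lemma weight_branch (z : T) a k :
  weight k (branch z a k) = \prod_(1 <= j < k.+1) normc (m (branch z a j)) ^+ 2.
Proof.
rewrite big_add1 big_mkord /= [RHS](reindex_inj rev_ord_inj) /=.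
apply: eq_bigr => j _; rewrite iter_beta_branch ?(ltnW (ltn_ord j))//.
by rewrite subnSK.
Qed.

Variable taut : probability (T * ZA)%type R.
Hypothesis htaut : is_product_picture tau taut.

(** Theta maps the rectangle to a cell at level k, where the mass is the
    integral of the weight; the inverse branch turns it into an integral over
    B. *)
Lemma taut_cylinder k a B : measurable B ->
  taut (B `*` cylinder k a) = (\int[mu]_(z in B)
    ((((\prod_i N i) ^ k)%:R)^-1 *
       \prod_(1 <= j < k.+1) (normc (m (branch z a j))) ^+ 2)%:E)%E.
Proof.
move=> mB; rewrite htaut; last by apply: measurableX => //; exact: measurable_cylinder.
rewrite Theta_cylinder tau_proj; last exact: measurable_cell_seq.
have n0 : ((\prod_i N i) ^ k)%:R != 0 :> R.
  by rewrite pnatr_eq0 -lt0n expn_gt0 num_gt0.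
have mw : measurable_fun setT (fun z => (weight k z)%:E) by apply/measurable_EFinP; exact: measurable_weight.
have w0 z : (0 <= (weight k z)%:E)%E by rewrite lee_fin weight_ge0.
rewrite [RHS](eq_integral (fun z => ((((\prod_i N i) ^ k)%:R)^-1%:E *
  (weight k (branch z a k))%:E)%E)); last by move=> z _; rewrite EFinM weight_branch.
have mwb : measurable_fun setT (fun z => (weight k (branch z a k))%:E).
  exact: (measurableT_comp mw (measurable_branch a k)).
rewrite ge0_integralZl//.
  by rewrite -(cell_change_of_variables k a mB mw w0) muleA -EFinM mulVf// mul1e.
exact: measurable_funTS.
Qed.

End Cells.

(** * The shift scales the measure by the squared modulus of m *)

Section ProductUniqueness.
Context d1 (X : measurableType d1) (d : nat) (N : dilation d) (R : realType).
Local Notation ZA := (ZA N).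
Variables m1 m2 : {measure set (X * ZA) -> \bar R}.
Hypothesis m2_fin : (m2 setT < +oo)%E.
Hypothesis m12 : forall B k a, measurable B ->
  m1 (B `*` cylinder k.+1 a) = m2 (B `*` cylinder k.+1 a).

Let F (n : nat) : set ZA :=
  if insub n : option 'I_#|{: digit N}| is Some i then cylinder 1 (fun=> enum_val i) else set0.

Let mF n : measurable (F n).
Proof. by rewrite /F; case: insubP => [i _ _|_]; [exact: measurable_cylinder|exact: measurable0]. Qed.

Let FT : \bigcup_n F n = setT.
Proof.
apply/seteqP; split => // a _; exists (enum_rank (a 0%N)) => //.
by rewrite /F valK enum_rankK => -[].
Qed.

Let tF : trivIset setT F.
Proof.
move=> i j _ _ [b []]; rewrite /F.
case: insubP => [k _ <-|//]; case: insubP => [l _ <-|//].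
move=> /(_ 0%N isT) bk /(_ 0%N isT) bl; congr (\val _); apply: enum_val_inj.
by rewrite -bk -bl.
Qed.

Lemma trivIset_setX (B : set X) (G : nat -> set ZA) :
  trivIset setT G -> trivIset setT (fun n => B `*` G n).
Proof.
move=> tG; apply/trivIsetP => i j _ _ ij; rewrite -setXI.
by move/trivIsetP : tG => /(_ i j I I ij) ->; rewrite setX0.
Qed.

Let m12T B : measurable B -> m1 (B `*` setT) = m2 (B `*` setT).
Proof.
move=> mB; have mBF n : measurable (B `*` F n) by exact: measurableX.
have mU : measurable (\bigcup_n (B `*` F n)) by exact: bigcup_measurable.
rewrite -FT setX_bigcupr !measure_semi_bigcup//; try exact: trivIset_setX.
apply: eq_eseriesr => n _; rewrite /F; case: insubP => [i _ _|_]; first exact: m12.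
by rewrite setX0 !measure0.
Qed.

(** Rectangles over cylinders of positive length determine a finite measure;
    the whole fibre is the disjoint union of the cylinders of length one. *)
Lemma prod_ZA_measure_eq A : measurable A -> m1 A = m2 A.
Proof.
have fin2 C : measurable C -> (m2 C < +oo)%E.
  by move=> mC; apply: le_lt_trans m2_fin; apply: le_measure; rewrite ?inE.
have fin1 C : measurable C -> (m1 C < +oo)%E.
  move=> mC; apply: (@le_lt_trans _ _ (m1 setT)); first by apply: le_measure; rewrite ?inE.
  by rewrite -setXTT m12T// setXTT.
move: A; apply: rectangle_induction.
- move=> B C mB; move: C.
  apply: (@cylinder_induction d N (fun C => m1 (B `*` C) = m2 (B `*` C))).
  + by case=> [a|k a]; [rewrite cylinder0 m12T|exact: m12].
  + move=> C mC IH; have E : B `*` ~` C = (B `*` setT) `\` (B `*` C).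
      apply/seteqP; split => [[x b] [Bx nC]|[x b] [[Bx _] nBC]]; split => //.
        by move=> [].
      by move=> Cb; apply: nBC.
    have mBC : measurable (B `*` C) by exact: measurableX.
    have mBT : measurable (B `*` [set: ZA]) by exact: measurableX.
    have E2 : (B `*` [set: ZA]) `&` (B `*` C) = B `*` C by rewrite -setXI setIid setTI.
    rewrite E !measureD ?E2 ?fin1 ?fin2//.
    by congr (_ - _)%E; [exact: m12T|exact: IH].
  + move=> G mG tG IH; have mBG n : measurable (B `*` G n) by exact: measurableX.
    have mU : measurable (\bigcup_n (B `*` G n)) by exact: bigcup_measurable.
    rewrite setX_bigcupr !measure_semi_bigcup//; try exact: trivIset_setX.
    by apply: eq_eseriesr => n _; exact: IH.
- move=> C mC IH; rewrite -setTD !measureD ?setTI ?fin1 ?fin2//.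
  by congr (_ - _)%E; [rewrite -setXTT; exact: m12T|exact: IH].
- move=> G mG tG IH; have mU : measurable (\bigcup_n (G n)) by exact: bigcup_measurable.
  rewrite !measure_semi_bigcup//.
  by apply: eq_eseriesr => n _; exact: IH.
Qed.

End ProductUniqueness.

Section Shift.
Context (R : realType) (d : nat) (N : dilation d).
Local Notation T := (torus R d).
Local Notation ZA := (ZA N).
Implicit Types (a b : ZA) (z : T) (x : T * ZA).

Definition ZA_cons (c : digit N) a : ZA := fun j => if j is j'.+1 then a j' else c.
Definition ZA_tail a : ZA := fun j => a j.+1.

(** An explicit inverse of the shift: the digit lost by beta is put in
    front. *)
Definition unshift x : T * ZA := (beta N x.1, ZA_cons (last_digit N x.1) x.2).

Lemma shiftE x : Defs.shift x = (inv_branch (x.2 0%N) x.1, ZA_tail x.2).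
Proof. by rewrite /Defs.shift branchS branch0. Qed.

Lemma shiftK : cancel (@Defs.shift R d N) unshift.
Proof.
move=> [z a]; rewrite shiftE /unshift /= beta_inv_branch last_digit_inv_branch.
by congr (_, _); apply/funext => -[].
Qed.

Lemma unshiftK : cancel unshift (@Defs.shift R d N).
Proof. by move=> [z a]; rewrite shiftE /unshift /= inv_branch_beta. Qed.

Lemma shift_invE x : shift_inv x = unshift x.
Proof.
rewrite /shift_inv; case: xgetP => [y _ /= <-|/(_ (unshift x))]; first by rewrite shiftK.
by rewrite /= unshiftK.
Qed.

Lemma shift_invK : cancel (@shift_inv R d N) (@Defs.shift R d N).
Proof. by move=> x; rewrite shift_invE unshiftK. Qed.

Lemma shiftVK : cancel (@Defs.shift R d N) (@shift_inv R d N).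
Proof. by move=> x; rewrite shift_invE shiftK. Qed.

Lemma measurable_digit_of_snd j (c : digit N) :
  measurable [set x : T * ZA | x.2 j = c].
Proof.
rewrite (_ : [set _ | _] = snd @^-1` [set a : ZA | a j = c])//.
by rewrite -[X in measurable X]setTI; apply: measurable_snd => //; exact: measurable_digit.
Qed.

Lemma measurable_shift : measurable_fun setT (@Defs.shift R d N).
Proof.
rewrite (_ : @Defs.shift R d N = fun x => (inv_branch (x.2 0%N) x.1, ZA_tail x.2)); last first.
  by apply/funext => x; exact: shiftE.
apply: measurable_fun_pair.
  move=> _ B mB; rewrite setTI.
  rewrite (_ : _ @^-1` _ = \bigcup_(c in [set: digit N])
     ([set x | x.2 0%N = c] `&` fst @^-1` (inv_branch c @^-1` B))); last first.
    apply/seteqP; split => [x Bx|x [c _ [<-]]//].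
    by exists (x.2 0%N).
  apply: fin_bigcup_measurable => // c _.
  apply: measurableI; first exact: measurable_digit_of_snd.
  rewrite -[X in measurable X]setTI; apply: measurable_fst => //.
  by rewrite -[X in measurable X]setTI; exact: measurable_inv_branch.
apply: measurable_ZAP => j c; exact: measurable_digit_of_snd.
Qed.

Lemma measurable_shift_inv : measurable_fun setT (@shift_inv R d N).
Proof.
rewrite (_ : @shift_inv R d N = unshift); last by apply/funext => x; exact: shift_invE.
apply: measurable_fun_pair.
  exact: (measurableT_comp (@measurable_beta R d N) measurable_fst).
apply: measurable_ZAP => -[|j] c; last exact: measurable_digit_of_snd.
rewrite (_ : [set _ | _] = fst @^-1` [set z | last_digit N z = c])//.
rewrite -[X in measurable X]setTI; apply: measurable_fst => //.
exact: measurable_last_digit.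
Qed.

Lemma branch_tail z a j :
  branch (inv_branch (a 0%N) z) (ZA_tail a) j = branch z a j.+1.
Proof. by elim: j => [|j IH]; [rewrite branchS !branch0|rewrite branchS IH [RHS]branchS]. Qed.

(** The index drops by one: the first digit of the cylinder becomes a condition
    on the base point. This is why cylinders of positive length are used for
    uniqueness. *)
Lemma unshift_cylinder (B : set T) k a :
  unshift @^-1` (B `*` cylinder k.+1 a) = cell 1 a B `*` cylinder k (ZA_tail a).
Proof.
apply/seteqP; split => [[z b] [Bz ab]|[z b] [[zc Bz] ab]].
  by split; [split => //; exact: (ab 0%N)|move=> j jk; exact: (ab j.+1)].
by split => // -[|j] jk; [exact: zc|exact: ab].
Qed.

Variable mu : probability T R.
Hypothesis hmu : is_normalized_haar mu.
Variable m : T -> R[i].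
Hypothesis mm : measurable_fun setT m.
Variable taut : probability (T * ZA)%type R.
Variable nu : T -> probability ZA R.
Hypothesis mnu : forall k a, measurable_fun setT (fun z => nu z (cylinder k a)).

(** The prescribed mass of a cylinder in the fibre over z. *)
Definition cyl_mass k a z : R := (((\prod_i N i) ^ k)%:R)^-1 *
       \prod_(1 <= j < k.+1) (normc (m (branch z a j))) ^+ 2.

Hypothesis taut_nu : forall B k a, measurable B ->
  taut (B `*` cylinder k a) = (\int[mu]_(z in B) nu z (cylinder k a))%E.
Hypothesis taut_mass : forall B k a, measurable B ->
  taut (B `*` cylinder k a) = (\int[mu]_(z in B) (cyl_mass k a z)%:E)%E.
Hypothesis nu_mass : {ae mu, forall z, forall k a, nu z (cylinder k a) = (cyl_mass k a z)%:E}.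

Lemma measurable_cyl_mass k a : measurable_fun setT (cyl_mass k a).
Proof.
apply: measurable_funM => //; apply: measurable_prod => j _.
by apply: measurable_normc2; exact: (measurableT_comp mm (measurable_branch a j)).
Qed.

Lemma cyl_mass_ge0 k a z : 0 <= cyl_mass k a z.
Proof. by rewrite mulr_ge0 ?invr_ge0// prodr_ge0// => j _; exact: sqr_ge0. Qed.

(** The weights along the branch of a are the weight of the first branch point
    times the weights along the branch of the tail that starts there. *)
Lemma cyl_mass_rec k a z : normc (m (inv_branch (a 0%N) z)) ^+ 2 *
  cyl_mass k (ZA_tail a) (inv_branch (a 0%N) z) = (\prod_i N i)%:R * cyl_mass k.+1 a z.
Proof.
have PE : \prod_(1 <= j < k.+2) normc (m (branch z a j)) ^+ 2 =
    normc (m (inv_branch (a 0%N) z)) ^+ 2 *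
    \prod_(1 <= j < k.+1) normc (m (branch (inv_branch (a 0%N) z) (ZA_tail a) j)) ^+ 2.
  rewrite !big_add1 !big_mkord big_ord_recl /= branchS branch0; congr (_ * _).
  by apply: eq_bigr => j _; rewrite branch_tail.
have n0 : (\prod_i N i)%:R != 0 :> R by rewrite pnatr_eq0 -lt0n num_gt0.
rewrite /cyl_mass PE expnS natrM invfM.
by rewrite -[in RHS]mulrA mulVKf// mulrCA.
Qed.

(** Both sides are integrals of F against finite measures, and these agree on a
    rectangle over the cylinder of a: disintegrating over the cell of the first
    digit gives an integral of |m|^2 times the mass of the tail cylinder, and
    the inverse branch of that digit converts it by [cyl_mass_rec]. *)
Lemma shift_isometry (F : T * ZA -> \bar R) : measurable_fun setT F ->
  (forall x, 0 <= F x)%E ->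
  (\int[taut]_x (F (shift_inv x) * (normc (m x.1) ^+ 2)%:E) = \int[taut]_x F x)%E.
Proof.
move=> mF F0.
have mw : measurable_fun setT (fun x : T * ZA => normc (m x.1) ^+ 2).
  by apply: measurable_normc2; exact: (measurableT_comp mm measurable_fst).
have [rho [rhoE rhoI]] := @weighted_pushforward _ _ (T * ZA)%type (T * ZA)%type R taut
  (fun x => normc (m x.1) ^+ 2) (@shift_inv R d N) mw (fun=> sqr_ge0 _) measurable_shift_inv.
rewrite -rhoI//; apply: eq_measure_integral => A mA _.
apply: prod_ZA_measure_eq mA.
  exact: probability_lty.
move=> B k a mB; rewrite rhoE; last by apply: measurableX => //; exact: measurable_cylinder.
rewrite (_ : @shift_inv R d N = unshift); last by apply/funext => x; exact: shift_invE.
rewrite unshift_cylinder.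
have mC : measurable (cell 1 a B) by exact: measurable_cell_seq.
have mk : measurable (cylinder k (ZA_tail a)) by exact: measurable_cylinder.
pose G (x : T * ZA) : \bar R := ((\1_(cell 1 a B) x.1)%:E * ((normc (m x.1) ^+ 2)%:E * (\1_(cylinder k (ZA_tail a)) x.2)%:E))%E.
have mG : measurable_fun setT G.
  apply: emeasurable_funM.
    apply/measurable_EFinP.
    exact: (measurableT_comp (measurable_indic mC) measurable_fst).
  apply: emeasurable_funM; first exact/measurable_EFinP.
  apply/measurable_EFinP.
  exact: (measurableT_comp (measurable_indic mk) measurable_snd).
have G0 x : (0 <= G x)%E by rewrite !mule_ge0// lee_fin// sqr_ge0.
transitivity (\int[taut]_x G x)%E.
  rewrite integral_mkcond; apply: eq_integral => -[z b] _.
  rewrite patchE /G !indicE in_setX [(z, b).1]/= [(z, b).2]/=.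
  by case: (z \in _); case: (b \in _); rewrite ?mul0e ?mul1e ?mule0 ?mule1.
have [mIG ->] := disintegration_ge0 mnu taut_nu mG G0.
have IG z : (\int[nu z]_b G (z, b) = (\1_(cell 1 a B) z)%:E *
    ((normc (m z) ^+ 2)%:E * nu z (cylinder k (ZA_tail a))))%E.
  rewrite /G /= ge0_integralZl//=; last 2 first.
  - apply: measurable_funeM; apply/measurable_EFinP; exact: measurable_indic.
  - by move=> b _; rewrite mule_ge0// lee_fin// sqr_ge0.
  congr (_ * _)%E.
  rewrite ge0_integralZl//=; last by rewrite lee_fin sqr_ge0.
    by rewrite integral_indic// setIT.
  by apply/measurable_EFinP; exact: measurable_indic.
pose H z : \bar R := (normc (m z) ^+ 2 * cyl_mass k (ZA_tail a) z)%:E.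
have mH : measurable_fun setT H.
  apply/measurable_EFinP; apply: measurable_funM; first exact: measurable_normc2.
  exact: measurable_cyl_mass.
have H0 z : (0 <= H z)%E by rewrite lee_fin mulr_ge0 ?sqr_ge0// cyl_mass_ge0.
transitivity (\int[mu]_(z in cell 1 a B) H z)%E.
  rewrite [RHS]integral_mkcond; apply: ge0_ae_eq_integral => //.
  - exact/(measurable_restrictT _ _).1/measurable_funTS.
  - by move=> z _; apply: integral_ge0.
  - by move=> z _; rewrite patchE; case: ifP.
  - apply: filterS nu_mass => z nuz _.
    rewrite IG patchE indicE nuz; case: ifPn => _; last by rewrite mul0e.
    by rewrite mul1e -EFinM.
have Nr0 : (\prod_i N i)%:R != 0 :> R by rewrite pnatr_eq0 -lt0n num_gt0.
have := cell_change_of_variables hmu 1 a mB mH H0; rewrite expn1 => E.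
transitivity (\int[mu]_(z in B) (cyl_mass k.+1 a z)%:E)%E; last by rewrite -taut_mass.
transitivity ((\prod_i N i)%:R^-1%:E * \int[mu]_(z in B) H (branch z a 1))%E.
  by rewrite -E muleA -EFinM mulVf// mul1e.
have mHb : measurable_fun B (fun z => H (branch z a 1)).
  by apply: measurable_funTS; exact: (measurableT_comp mH (measurable_branch a 1)).
rewrite -ge0_integralZl ?lee_fin ?invr_ge0//.
apply: eq_integral => z _; rewrite /H branchS branch0 cyl_mass_rec.
by rewrite -EFinM mulrA mulVf// mul1r.
Qed.

End Shift.

(** * Regular fibre measures and weighted composition operators *)

Section RegularVersion.
Context (R : realType) (d : nat) (N : dilation d).
Local Notation T := (torus R d).
Local Notation ZA := (ZA N).
Variable mu : probability T R.
Variable m : T -> R[i].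
Hypothesis mm : measurable_fun setT m.
Variable taut : probability (T * ZA)%type R.
Hypothesis taut_mass : forall B k (a : ZA), measurable B ->
  taut (B `*` cylinder k a) = (\int[mu]_(z in B) (cyl_mass m k a z)%:E)%E.
Variable nu : T -> probability ZA R.
Hypothesis hnu : is_fiber_measure mu m nu.

(** On the null set where the masses of cylinders are not as prescribed, use
    any fixed fibre measure; then all masses depend measurably on z. *)
Lemma regular_version : exists nu' : T -> probability ZA R,
  [/\ forall k a, measurable_fun setT (fun z => nu' z (cylinder k a)),
      {ae mu, forall z, nu' z = nu z} &
      forall B k a, measurable B ->
        taut (B `*` cylinder k a) = (\int[mu]_(z in B) nu' z (cylinder k a))%E].
Proof.
have [Z [mZ Z0 ZP]] := hnu.
have ZN z : ~ Z z -> forall k a, nu z (cylinder k a) = (cyl_mass m k a z)%:E.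
  by move=> nZ; apply: contrapT => h; apply: nZ; exact: ZP.
pose nu' z := if z \in Z then nu point else nu z.
have nu'E k a z : nu' z (cylinder k a) =
    (fine (nu point (cylinder k a)) * \1_Z z + cyl_mass m k a z * \1_(~` Z) z)%:E.
  have mc : measurable (cylinder k a) := measurable_cylinder k a.
  rewrite !indicE in_setC /nu'; case: ifPn => zZ /=.
    by rewrite mulr1 mulr0 addr0 fineK// fin_num_measure.
  by rewrite mulr0 mulr1 add0r; apply: ZN; move/negP : zZ; rewrite inE.
have mnu' k a : measurable_fun setT (fun z => nu' z (cylinder k a)).
  rewrite (_ : (fun _ => _) = (fun z => (fine (nu point (cylinder k a)) * \1_Z z + cyl_mass m k a z * \1_(~` Z) z)%:E)); last first.
    by apply/funext => z; exact: nu'E.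
  apply/measurable_EFinP; apply: measurable_funD; apply: measurable_funM => //.
  - exact: measurable_cyl_mass.
  - by apply: measurable_indic; exact: measurableC.
exists nu'; split => //.
  exists Z; split => // z /= nE; apply: contrapT => nZ; apply: nE.
  by rewrite /nu' memNset.
move=> B k a mB; rewrite taut_mass//.
apply: ge0_ae_eq_integral => //.
- by apply: measurable_funTS; apply/measurable_EFinP; exact: measurable_cyl_mass.
- by apply: measurable_funTS; exact: mnu'.
- by move=> z _; rewrite lee_fin cyl_mass_ge0.
- exists Z; split => // z /= nE; apply: contrapT => nZ; apply: nE => Bz.
  by rewrite nu'E !indicE in_setC memNset//= mulr0 add0r mulr1.
Qed.

End RegularVersion.

Section WeightedComposition.
Context dX (X : measurableType dX) (R : realType).
Variable rho : {measure set X -> \bar R}.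
Implicit Types (S : (X -> R[i]) -> X -> R[i]) (s : X -> X) (w : X -> R[i]).

(** S acts as f |-> w * (f o s), almost everywhere since the dilation operator
    is only defined up to null sets. The isometry is stated for nonnegative
    functions in place of squared moduli, which also makes it usable for inner
    products. *)
Record weighted_composition S s w : Prop := WeightedComposition {
  wcomp_measurable_map : measurable_fun setT s ;
  wcomp_measurable_weight : measurable_fun setT w ;
  wcomp_neq0 : {ae rho, forall x, w x != 0} ;
  wcomp_isometry : forall F : X -> \bar R, measurable_fun setT F ->
    (forall x, 0 <= F x)%E ->
    (\int[rho]_x (F (s x) * (normc (w x) ^+ 2)%:E) = \int[rho]_x F x)%E ;
  wcomp_L2 : forall f, L2 rho f -> L2 rho (S f) ;
  wcompE : forall f, L2 rho f -> {ae rho, forall x, S f x = w x * f (s x)} }.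

(** The isometry applied to the indicator of a null set A shows that |w|^2
    vanishes almost everywhere on the preimage of A, so this preimage is null,
    as w is nonzero almost everywhere. *)
Lemma nonsingular_pullback s w : measurable_fun setT s -> measurable_fun setT w ->
  {ae rho, forall x, w x != 0} ->
  (forall F : X -> \bar R, measurable_fun setT F -> (forall x, 0 <= F x)%E ->
    (\int[rho]_x (F (s x) * (normc (w x) ^+ 2)%:E) = \int[rho]_x F x)%E) ->
  forall P : X -> Prop, {ae rho, forall x, P x} -> {ae rho, forall x, P (s x)}.
Proof.
move=> ms mw w0 iso P [A [mA A0 PA]].
have mF : measurable_fun setT (fun x => (\1_A x)%:E : \bar R).
  by apply/measurable_EFinP; exact: measurable_indic.
have F0 x : (0 <= (\1_A x)%:E :> \bar R)%E by rewrite lee_fin.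
have := iso _ mF F0; rewrite integral_indic// setIT A0 => I0.
have mG : measurable_fun setT (fun x => (\1_A (s x))%:E * (normc (w x) ^+ 2)%:E)%E.
  by apply: emeasurable_funM; [exact: (measurableT_comp mF ms)|exact: measurable_sqn].
have G0 x : (0 <= (\1_A (s x))%:E * (normc (w x) ^+ 2)%:E)%E.
  by rewrite mule_ge0// lee_fin sqr_ge0.
have aeG : {ae rho, forall x, setT x -> ((\1_A (s x))%:E * (normc (w x) ^+ 2)%:E = 0)%E}.
  apply: (ae_eq_integral_abs rho measurableT mG).1.
  by rewrite -[RHS]I0; apply: eq_integral => x _; rewrite gee0_abs.
apply: filterS2 aeG w0 => x /(_ I); rewrite indicE => Gx wx.
apply: contrapT => nP; have /mem_set As : A (s x) by exact: PA.
by move: Gx; rewrite As mul1e => -[] /eqP; rewrite normc2_eq0 (negbTE wx).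
Qed.

Lemma wcomp_pullback S s w : weighted_composition S s w ->
  forall P : X -> Prop, {ae rho, forall x, P x} -> {ae rho, forall x, P (s x)}.
Proof. by case=> ms mw w0 iso _ _; exact: (nonsingular_pullback ms mw w0 iso). Qed.

Lemma wcomp_id : weighted_composition id id (fun=> 1).
Proof.
split => //.
- by apply: aeW => x; exact: oner_neq0.
- move=> F mF F0; apply: eq_integral => x _.
  by rewrite normc2_1 mule1.
- by move=> f _; apply: aeW => x; rewrite mul1r.
Qed.

(** Almost everywhere equalities for the inner operator may be pulled back
    along the outer map by [nonsingular_pullback]. *)
Lemma wcomp_comp S1 s1 w1 S2 s2 w2 :
  weighted_composition S1 s1 w1 -> weighted_composition S2 s2 w2 ->
  weighted_composition (S1 \o S2) (s2 \o s1) (fun x => w1 x * w2 (s1 x)).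
Proof.
move=> W1 W2; have pull := wcomp_pullback W1.
case: W1 W2 => ms1 mw1 w10 iso1 L1 E1 [ms2 mw2 w20 iso2 L2 E2].
have mw2s : measurable_fun setT (w2 \o s1) by exact: measurableT_comp.
split.
- exact: measurableT_comp.
- exact: measurable_cplxM.
- by apply: filterS2 w10 (pull _ w20) => x w1x w2x; rewrite mulf_neq0.
- move=> F mF F0.
  have mF2 : measurable_fun setT (fun x => F (s2 x) * (normc (w2 x) ^+ 2)%:E)%E.
    by apply: emeasurable_funM; [exact: (measurableT_comp mF ms2)|exact: measurable_sqn].
  have F20 x : (0 <= F (s2 x) * (normc (w2 x) ^+ 2)%:E)%E.
    by rewrite mule_ge0// lee_fin sqr_ge0.
  rewrite -(iso2 _ mF F0) -(iso1 _ mF2 F20).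
  by apply: eq_integral => x _; rewrite normc2M -muleA -EFinM [X in (_ * X%:E)%E]mulrC.
- by move=> f f2; apply: L1; exact: L2.
- move=> f f2; apply: filterS2 (E1 _ (L2 _ f2)) (pull _ (E2 _ f2)) => x /= -> ->.
  by rewrite mulrA.
Qed.

Lemma wcomp_iter S s w : weighted_composition S s w -> forall n,
  exists w', weighted_composition (iter n S) (iter n s) w'.
Proof.
move=> W; elim=> [|n [w' IH]]; first by exists (fun=> 1); exact: wcomp_id.
exists (fun x => w x * w' (s x)).
have := wcomp_comp W IH.
rewrite (_ : iter n s \o s = iter n.+1 s)//.
by apply/funext => x; rewrite /= -iterSr.
Qed.

End WeightedComposition.

(** * Powers of the dilation operator *)

Section ShiftOperators.
Context (R : realType) (d : nat) (N : dilation d).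
Local Notation T := (torus R d).
Local Notation ZA := (ZA N).
Local Notation shift := (@Defs.shift R d N).
Local Notation shift_inv := (@shift_inv R d N).
Variable mu : probability T R.
Hypothesis hmu : is_normalized_haar mu.
Variable m : T -> R[i].
Hypothesis mm : measurable_fun setT m.
Hypothesis m0 : mu [set z | m z = 0] = 0%E.
Variable taut : probability (T * ZA)%type R.
Variable nu : T -> probability ZA R.
Hypothesis mnu : forall k (a : ZA), measurable_fun setT (fun z => nu z (cylinder k a)).
Hypothesis taut_nu : forall B k (a : ZA), measurable B ->
  taut (B `*` cylinder k a) = (\int[mu]_(z in B) nu z (cylinder k a))%E.
Hypothesis taut_mass : forall B k (a : ZA), measurable B ->
  taut (B `*` cylinder k a) = (\int[mu]_(z in B) (cyl_mass m k a z)%:E)%E.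
Hypothesis nu_mass : {ae mu, forall z, forall k (a : ZA),
  nu z (cylinder k a) = (cyl_mass m k a z)%:E}.

Lemma taut_fst B : measurable B -> taut (fst @^-1` B) = mu B.
Proof.
move=> mB; rewrite (_ : fst @^-1` B = B `*` cylinder 0 (point : ZA)); last first.
  by rewrite cylinder0; apply/seteqP; split => [[z a]|[z a] []].
rewrite taut_nu// cylinder0; transitivity (\int[mu]_(z in B) (cst 1%E z))%E.
  by apply: eq_integral => z _; exact: probability_setT.
by rewrite integral_cst// mul1e.
Qed.

Lemma ae_fst (P : T -> Prop) : {ae mu, forall z, P z} ->
  {ae taut, forall x, P x.1}.
Proof.
move=> [A [mA A0 PA]]; exists (fst @^-1` A); split.
- by rewrite -[X in measurable X]setTI; exact: measurable_fst.
- by rewrite taut_fst.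
- by move=> x /= nP; apply: PA.
Qed.

Let measurable_zeros : measurable [set z | m z = 0].
Proof.
have mn : measurable_fun setT (fun z => normc (m z) ^+ 2) by exact: measurable_normc2.
rewrite (_ : [set z | m z = 0] = (fun z => normc (m z) ^+ 2) @^-1` [set 0]).
  by rewrite -[X in measurable X]setTI; exact: mn.
apply/seteqP; split => z /= h; first by apply/eqP; rewrite normc2_eq0 h.
by apply/eqP; rewrite -normc2_eq0 h.
Qed.

(** The image of taut in the torus is Haar measure. *)
Lemma filter_neq0 : {ae taut, forall x, m x.1 != 0}.
Proof.
apply: (@ae_fst (fun z => m z != 0)); exists [set z | m z = 0]; split => //.
by move=> z /= /negP; rewrite negbK => /eqP.
Qed.

Let mw : measurable_fun setT (fun x : T * ZA => m x.1).
Proof. exact: (measurableT_comp mm measurable_fst). Qed.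

Let isoV := shift_isometry hmu mm mnu taut_nu taut_mass nu_mass.

Lemma shift_inv_wcomp :
  weighted_composition taut (op_Dinv m) shift_inv (fun x => m x.1).
Proof.
split => //.
- exact: measurable_shift_inv.
- exact: filter_neq0.
- move=> f [mf f2]; split.
    apply: measurable_cplxM => //; exact: (measurableT_comp mf (@measurable_shift_inv R d N)).
  apply: le_lt_trans f2; rewrite -(isoV (measurable_sqn mf)); last by move=> x; rewrite lee_fin sqr_ge0.
  rewrite le_eqVlt; apply/orP; left; apply/eqP; apply: eq_integral => x _.
  by rewrite /op_Dinv normc2M mulrC EFinM.
- by move=> f _; exact: aeW.
Qed.

Let w x := (m (shift x).1)^-1.

Let mv : measurable_fun setT w.
Proof. by apply: measurable_cplx_inv; exact: (measurableT_comp mw (@measurable_shift R d N)). Qed.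

Let iso (F : T * ZA -> \bar R) : measurable_fun setT F -> (forall x, 0 <= F x)%E ->
  (\int[taut]_x (F (shift x) * (normc (w x) ^+ 2)%:E) = \int[taut]_x F x)%E.
Proof.
move=> mF F0.
have mG : measurable_fun setT (fun x => F (shift x) * (normc (w x) ^+ 2)%:E)%E.
  apply: emeasurable_funM; last exact: measurable_sqn.
  exact: (measurableT_comp mF (@measurable_shift R d N)).
have G0 x : (0 <= F (shift x) * (normc (w x) ^+ 2)%:E)%E.
  by rewrite mule_ge0// lee_fin sqr_ge0.
rewrite -isoV//; apply: ge0_ae_eq_integral => //.
- apply: emeasurable_funM; last exact: measurable_sqn.
  exact: (measurableT_comp mG (@measurable_shift_inv R d N)).
- by move=> x _; rewrite mule_ge0// lee_fin sqr_ge0.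
- apply: filterS filter_neq0 => x mx _; rewrite shift_invK /w shift_invK -muleA -EFinM normc2V.
  by rewrite mulVf ?mule1// normc2_eq0.
Qed.

Let w0 : {ae taut, forall x, w x != 0}.
Proof.
have mZ : measurable [set z | m z = 0] by exact: measurable_zeros.
have mF : measurable_fun setT (fun x => (\1_[set z | m z = 0] (shift x).1)%:E : \bar R).
  apply/measurable_EFinP; apply: (measurableT_comp (measurable_indic mZ)).
  exact: (measurableT_comp measurable_fst (@measurable_shift R d N)).
have F0 x : (0 <= (\1_[set z | m z = 0] (shift x).1)%:E :> \bar R)%E by rewrite lee_fin.
have := isoV mF F0; rewrite integral0_eq => [I0|x _]; last first.
  rewrite shift_invK indicE; have [mx|mx] := pselect (m x.1 = 0); last first.
    by rewrite memNset// mul0e.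
  by rewrite mx normc2_0 mule0.
have : {ae taut, forall x, setT x -> ((\1_[set z | m z = 0] (shift x).1)%:E = 0 :> \bar R)%E}.
  apply: (ae_eq_integral_abs taut measurableT mF).1.
  by rewrite [RHS]I0; apply: eq_integral => x _; rewrite gee0_abs.
apply: filterS => x /(_ I); rewrite indicE /w invr_eq0 => -[] h.
apply/negP => /eqP mx; move: h; rewrite mem_set//= => /eqP.
by rewrite oner_eq0.
Qed.

(** The candidate for D f is f o sigma divided by m o sigma. The representative
    chosen in the definition of D agrees with it almost everywhere, since null
    sets pull back to null sets along the shift. *)
Lemma shift_wcomp : weighted_composition taut (op_D taut m) shift w.
Proof.
have pull := nonsingular_pullback (@measurable_shift R d N) mv w0 iso.
have L2D f : L2 taut f -> L2 taut (op_D taut m f) /\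
    {ae taut, forall x, op_Dinv m (op_D taut m f) x = f x}.
  move=> [mf f2]; rewrite /op_D; case: xgetP => [g _ //|].
  move=> /(_ (fun x => w x * f (shift x))) []; split; last first.
    apply: filterS filter_neq0 => x mx.
    by rewrite /op_Dinv /w shift_invK mulrA divff// mul1r.
  split; first by apply: measurable_cplxM => //; exact: (measurableT_comp mf (@measurable_shift R d N)).
  apply: le_lt_trans f2; rewrite -(iso (measurable_sqn mf)); last by move=> x; rewrite lee_fin sqr_ge0.
  rewrite le_eqVlt; apply/orP; left; apply/eqP; apply: eq_integral => x _.
  by rewrite normc2M mulrC EFinM.
split => //.
- exact: measurable_shift.
- by move=> f /L2D[].
- move=> f /L2D[_ /pull Ef].
  apply: filterS2 Ef w0 => x; rewrite /op_Dinv shiftVK /w => <-.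
  by rewrite invr_eq0 => mx; rewrite mulrA mulVf// mul1r.
Qed.

Lemma ziter_wcomp (j : int) : exists M,
  weighted_composition taut (ziter (op_D taut m) (op_Dinv m) j) (ziter shift shift_inv j) M.
Proof.
by case: j => n; [exact: (wcomp_iter shift_wcomp)|exact: (wcomp_iter shift_inv_wcomp)].
Qed.

End ShiftOperators.

(** * Square integrals over the fibres *)

Section FiberNorm.
Context (R : realType) (d : nat) (N : dilation d).
Local Notation T := (torus R d).
Local Notation ZA := (ZA N).
Variable mu : probability T R.
Hypothesis hmu : is_normalized_haar mu.
Variable taut : probability (T * ZA)%type R.
Variable nu : T -> probability ZA R.
Hypothesis mnu : forall k (a : ZA), measurable_fun setT (fun z => nu z (cylinder k a)).
Hypothesis taut_nu : forall B k (a : ZA), measurable B ->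
  taut (B `*` cylinder k a) = (\int[mu]_(z in B) nu z (cylinder k a))%E.

(** The density against mu of the image of |psi|^2 taut in the torus. *)
Definition fiber_sqn (psi : T * ZA -> R[i]) z : \bar R :=
  (\int[nu z]_a (normc (psi (z, a)) ^+ 2)%:E)%E.

Lemma fiber_sqn_ge0 psi z : (0 <= fiber_sqn psi z)%E.
Proof. by apply: integral_ge0 => a _; rewrite lee_fin sqr_ge0. Qed.

Lemma measurable_fiber (psi : T * ZA -> R[i]) z : measurable_fun setT psi ->
  measurable_fun setT (fun a => psi (z, a)).
Proof. by move=> mpsi; apply: measurableT_comp => //; exact: pair1_measurable. Qed.

Section Weighted.
Variable psi : T * ZA -> R[i].
Hypothesis mpsi : measurable_fun setT psi.

Lemma integral_fst_sqn (F : T -> \bar R) : measurable_fun setT F ->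
  (forall z, 0 <= F z)%E ->
  (\int[taut]_x (F x.1 * (normc (psi x) ^+ 2)%:E) = \int[mu]_z (F z * fiber_sqn psi z))%E.
Proof.
move=> mF F0.
have [_ ->] := @disintegration_ge0 _ _ d N R mu taut nu mnu taut_nu
    (fun x => F x.1 * (normc (psi x) ^+ 2)%:E)%E
    (emeasurable_funM (measurableT_comp mF measurable_fst) (measurable_sqn mpsi))
    (fun x => mule_ge0 (F0 x.1) (esqn_ge0 _)).
apply: eq_integral => z _ /=; rewrite ge0_integralZl//.
- exact: measurable_sqn (measurable_fiber z mpsi).
- by move=> a _; rewrite lee_fin sqr_ge0.
Qed.

Lemma measurable_fiber_sqn : measurable_fun setT (fiber_sqn psi).
Proof.
by have [] := disintegration_ge0 mnu taut_nu (measurable_sqn mpsi) (fun x => esqn_ge0 _).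
Qed.

Lemma integral_fiber_sqn :
  (\int[taut]_x (normc (psi x) ^+ 2)%:E = \int[mu]_z fiber_sqn psi z)%E.
Proof.
by have [_ ->] := disintegration_ge0 mnu taut_nu (measurable_sqn mpsi) (fun x => esqn_ge0 _).
Qed.

(** If the fibre integrals are 1, then f |-> f(z) psi(z, a) is an isometry of
    L^2(mu) into L^2(taut). *)
Lemma unit_fiber_integral (F : T -> \bar R) : {ae mu, forall z, fiber_sqn psi z = 1%E} ->
  measurable_fun setT F -> (forall z, 0 <= F z)%E ->
  (\int[mu]_z F z = \int[taut]_x (F x.1 * (normc (psi x) ^+ 2)%:E))%E.
Proof.
move=> psi1 mF F0; rewrite integral_fst_sqn//; apply: ge0_ae_eq_integral => //.
- by apply: emeasurable_funM => //; exact: measurable_fiber_sqn.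
- by move=> z _; rewrite mule_ge0// fiber_sqn_ge0.
- by apply: filterS psi1 => z -> _; rewrite mule1.
Qed.

Lemma unit_fiber_cintegral (f : T -> R[i]) : {ae mu, forall z, fiber_sqn psi z = 1%E} ->
  measurable_fun setT f ->
  cintegral mu f = cintegral taut (fun x => f x.1 * (normc (psi x) ^+ 2)%:C%C).
Proof.
move=> psi1 mf; apply: (@cintegral_weighted _ _ _ _ _ _ _ (fun x => normc (psi x) ^+ 2) fst) => //.
- by move=> x; exact: sqr_ge0.
- by move=> h mh h0; exact: unit_fiber_integral.
Qed.

(** The image of |psi|^2 taut has the Fourier coefficients of Haar measure, so
    both coincide, and so do their densities. *)
Lemma unit_fiber_of_fourier : (\int[taut]_x (normc (psi x) ^+ 2)%:E < +oo)%E ->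
  (forall v, cintegral taut (fun x => torus_char v x.1 * (normc (psi x) ^+ 2)%:C%C) =
     (v == [ffun=> 0])%:R) ->
  {ae mu, forall z, fiber_sqn psi z = 1%E}.
Proof.
move=> psi2 four.
have mg : measurable_fun setT (fun x => normc (psi x) ^+ 2) by exact: measurable_normc2.
have [rho [rhoB rhoI]] := @weighted_pushforward _ _ _ _ _ taut
  (fun x => normc (psi x) ^+ 2) fst mg (fun x => sqr_ge0 _) measurable_fst.
have rho_fin : (rho setT < +oo)%E by rewrite rhoB.
have mu_fin : (mu setT < +oo)%E.
  exact: probability_lty.
have rho_mu B : measurable B -> rho B = mu B.
  apply: torus_measure_eq => // v.
  rewrite (haar_char hmu) -four; apply: cintegral_weighted => //.
  - by move=> x; exact: sqr_ge0.
  - exact: measurable_torus_char.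
have mfib := measurable_fiber_sqn.
have : ae_eq mu setT (cst 1%E) (fiber_sqn psi).
  apply: integral_ae_eq => //; first exact: integrable_cst_EFin.
  move=> B _ mB; rewrite integral_cst// mul1e; apply: etrans (esym (rho_mu _ mB)) _; rewrite rhoB//.
  transitivity (\int[taut]_x ((\1_B x.1)%:E * (normc (psi x) ^+ 2)%:E))%E.
    rewrite integral_mkcond; apply: eq_integral => x _.
    rewrite patchE indicE /=.
    by case: (pselect (B x.1)) => h; [rewrite !mem_set// mul1e|rewrite !memNset// mul0e].
  rewrite (@integral_fst_sqn (fun z => (\1_B z)%:E))//.
    rewrite [RHS]integral_mkcond; apply: eq_integral => z _.
    by rewrite patchE indicE; case: ifP; rewrite ?mul1e ?mul0e.
  by apply/measurable_EFinP; exact: measurable_indic.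
by apply: filterS => z /(_ I) <-.
Qed.

End Weighted.

Lemma fiber_sqn_restrict (lam : T * ZA -> R[i]) E z :
  fiber_sqn (fun x => lam x * ind R E x) z =
  (\int[nu z]_(a in xsection E z) (normc (lam (z, a)) ^+ 2)%:E)%E.
Proof.
rewrite integral_mkcond; apply: eq_integral => a _.
rewrite patchE mem_xsection indCE; case: ifP => _; first by rewrite mulr1.
by rewrite mulr0 normc2_0.
Qed.

End FiberNorm.

(** * Atoms from approximation *)

(** The sum of the u_n is integrable, hence finite almost everywhere. *)
Lemma summable_ae_cvg0 dX (X : measurableType dX) (R : realType)
    (rho : {measure set X -> \bar R}) (u : nat -> X -> R) :
  (forall n, measurable_fun setT (u n)) -> (forall n x, 0 <= u n x) ->
  (forall n, (\int[rho]_x (u n x)%:E <= (1 / (2 ^ n.+1)%:R)%:E)%E) ->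
  {ae rho, forall x, u ^~ x @ \oo --> (0 : R)}.
Proof.
move=> mu u0 uI.
have mS : measurable_fun setT (fun x => \sum_(0 <= n <oo) (u n x)%:E)%E.
  apply: ge0_emeasurable_sum => n.
    by move=> x _ _; rewrite lee_fin.
  by move=> _; exact/measurable_EFinP.
have S0 x : (0 <= \sum_(0 <= n <oo) (u n x)%:E)%E by apply: nneseries_ge0 => n _ _; rewrite lee_fin.
have iS : rho.-integrable setT (fun x => \sum_(0 <= n <oo) (u n x)%:E)%E.
  apply/integrableP; split => //.
  under eq_integral do rewrite gee0_abs//.
  rewrite integral_nneseries//; first last.
  - by move=> n x _; rewrite lee_fin.
  - by move=> n; exact/measurable_EFinP.
  apply: le_lt_trans (ltry 1); apply: le_trans (@epsilon_trick0 R 1 xpredT ler01).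
  by apply: lee_nneseries => // n _ _; apply: integral_ge0 => x _; rewrite lee_fin.
apply: filterS (integrable_ae measurableT iS) => x /(_ I) Sx.
apply: cvg_series_cvg_0; apply: nondecreasing_is_cvgn.
  by apply: nondecreasing_series.
exists (fine (\sum_(0 <= n <oo) (u n x)%:E)%E) => _ [n _ <-].
rewrite -lee_fin fineK// seriesEnat /= -sumEFin.
by apply: nneseries_lim_ge => k _ _; rewrite lee_fin.
Qed.

(** Uniqueness of limits, for convergence expressed by squared moduli. *)
Lemma normc2_lim_unique (R : realType) (z w : R[i]) (q : nat -> R[i]) :
  (fun n => normc (z - q n) ^+ 2) @ \oo --> (0 : R) ->
  (fun n => normc (w - q n) ^+ 2) @ \oo --> (0 : R) -> z = w.
Proof.
move=> zq wq; apply/eqP; rewrite -subr_eq0 -normc2_eq0 eq_le sqr_ge0 andbT.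
have -> : 0 = 2 * 0 + 2 * 0 :> R by rewrite mulr0 addr0.
have c : (fun n => 2 * normc (z - q n) ^+ 2 + 2 * normc (w - q n) ^+ 2) @ \oo
    --> (2 * 0 + 2 * 0 : R).
  by apply: cvgD; apply: cvgM => //; exact: cvg_cst.
rewrite -(cvg_lim _ c)//; apply: limr_ge; first by apply/cvg_ex; eexists; exact: c.
apply: nearW => n; rewrite -[normc (w - q n)]normcNE.
apply: le_trans (normc2D_le _ _).
by rewrite opprB addrA subrK.
Qed.

Section Atoms.
Context (R : realType) (d : nat) (N : dilation d).
Local Notation ZA := (ZA N).

Lemma measurable_ZA1 (a : ZA) : measurable [set a].
Proof.
rewrite (_ : [set a] = \bigcap_k (cylinder k a)).
  by apply: bigcap_measurable => // k _; exact: measurable_cylinder.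
apply/seteqP; split => [_ -> k _ j _//|b ab].
by apply/funext => j; exact: (ab j.+1 I).
Qed.

(** The constant function 1 and numerical codes of the digits. Together they
    separate points, and the constant eliminates the unknown factor lam. *)
Definition digit_fun k (a : ZA) : R[i] :=
  if k is j.+1 then (enum_rank (a j))%:R else 1.

(** For two points a and b outside the exceptional null set, the approximation
    of the constant 1 gives lam a = lam b; then the approximations of a digit
    at a and at b have the same values, so that the digits agree. *)
Lemma fiber_atom (nu : probability ZA R) (A : set ZA) (lam : ZA -> R[i])
    (p : nat -> nat -> R[i]) : measurable A -> nu A != 0%E ->
  {ae nu, forall a, A a -> forall k,
     (fun n => normc (digit_fun k a - p k n * lam a) ^+ 2) @ \oo --> (0 : R)} ->
  exists2 a, A a & nu [set a] = nu A.
Proof.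
move=> mA nuA [Z [mZ Z0 ZP]].
have good a : A a -> ~ Z a -> forall k,
    (fun n => normc (digit_fun k a - p k n * lam a) ^+ 2) @ \oo --> (0 : R).
  by move=> Aa nZ; apply: contrapT => h; apply: nZ; apply: ZP => /= /(_ Aa).
have uniq_pt a b : A a -> ~ Z a -> A b -> ~ Z b -> a = b.
  move=> Aa Za Ab Zb; have [ga gb] := (good a Aa Za, good b Ab Zb).
  have step (z w : R[i]) (q : nat -> R[i]) : (fun n => normc (1 - q n * z) ^+ 2) @ \oo --> (0 : R) ->
      (fun n => normc (w - q n * z * w) ^+ 2) @ \oo --> (0 : R).
    move=> h; have c : (fun n => normc (1 - q n * z) ^+ 2 * normc w ^+ 2) @ \oo --> (0 * normc w ^+ 2 : R).
      by apply: cvgM => //; exact: cvg_cst.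
    rewrite mul0r in c.
    have -> // : (fun n => normc (w - q n * z * w) ^+ 2) = (fun n => normc (1 - q n * z) ^+ 2 * normc w ^+ 2).
    by apply/funext => n; rewrite -normc2M mulrBl mul1r.
  (* p_n lam(a) lam(b) converges to lam(b) and to lam(a). *)
  have lamE : lam a = lam b.
    apply: (@normc2_lim_unique R _ _ (fun n => p 0%N n * lam b * lam a)).
      exact: step (gb 0%N).
    under eq_fun do rewrite mulrAC.
    exact: step (ga 0%N).
  apply/funext => j; apply: enum_rank_inj; apply: val_inj.
  have : digit_fun j.+1 a = digit_fun j.+1 b.
    apply: (@normc2_lim_unique R _ _ (fun n => p j.+1 n * lam a)); first exact: ga.
    by rewrite lamE; exact: gb.
  by move=> /eqP; rewrite /digit_fun eqr_nat => /eqP.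
have [a [Aa Za]] : exists a, A a /\ ~ Z a.
  apply: contrapT => no; move: nuA; apply/negP; rewrite negbK; apply/eqP.
  apply/eqP; rewrite eq_le measure_ge0 andbT -Z0; apply: le_measure; rewrite ?inE//.
  by move=> a Aa; apply: contrapT => Za; apply: no; exists a.
exists a => //; apply/eqP; rewrite eq_le; apply/andP; split.
  by apply: le_measure; rewrite ?inE//; [exact: measurable_ZA1|move=> _ ->].
rewrite -[leRHS]adde0 -[X in (_ + X)%E]Z0.
have m1 := measurable_ZA1 a.
apply: (@le_trans _ _ (nu ([set a] `|` Z))).
  apply: le_measure; rewrite ?inE//; first exact: measurableU.
  move=> b Ab; have [Zb|Zb] := pselect (Z b); [by right|left].
  exact: uniq_pt.
exact: measureU2.
Qed.

End Atoms.

(** * Tilings and null sets of fibres *)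

Lemma ae_countable dX (X : measurableType dX) (R : realType)
    (rho : {measure set X -> \bar R}) (I : countType) (P : I -> X -> Prop) :
  (forall i, {ae rho, forall x, P i x}) -> {ae rho, forall x, forall i, P i x}.
Proof.
move=> aeP.
have := @ae_foralln _ _ _ rho (fun n x => if unpickle n is Some i then P i x else True).
move=> /(_ _)/wrap[n|]; first by case: (unpickle n) => [i|]; [exact: aeP|exact: aeW].
by apply: filterS => x Px i; have := Px (pickle i); rewrite pickleK.
Qed.

Section Iterates.
Context (R : realType) (d : nat) (N : dilation d).
Local Notation T := (torus R d).
Local Notation ZA := (ZA N).
Local Notation shift := (@Defs.shift R d N).
Local Notation shift_inv := (@shift_inv R d N).
Local Notation shiftz := (ziter shift shift_inv).

Lemma shiftz_opp j : cancel (shiftz j) (shiftz (- j)).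
Proof.
have iterK (f g : T * ZA -> T * ZA) n : cancel f g -> cancel (iter n f) (iter n g).
  move=> fK; elim: n => [//|n IH] x; rewrite iterSr /= fK; exact: IH.
case: j => [[|n]|n] x /=; first by [].
- exact: (iterK _ _ n.+1 (@shiftVK R d N) x).
- exact: (iterK _ _ n.+1 (@shift_invK R d N) x).
Qed.

(** Tiles are used as preimages from here on, for which measurability is
    immediate. *)
Lemma shift_image_opp (E : set (T * ZA)) j : shift_image E (- j) = shiftz j @^-1` E.
Proof.
apply/seteqP; split => [_ [y Ey <-]|x Ex]; last by exists (shiftz j x) => //; exact: shiftz_opp.
by have := @shiftz_opp (- j) y; rewrite opprK /= => ->.
Qed.

Lemma measurable_shiftz j : measurable_fun setT (shiftz j).
Proof.
have mi (f : T * ZA -> T * ZA) n : measurable_fun setT f -> measurable_fun setT (iter n f).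
  move=> mf; elim: n => [|n IH]; first exact: measurable_id.
  exact: (measurableT_comp mf IH).
case: j => n.
- exact: (mi _ n (@measurable_shift R d N)).
- exact: (mi _ n.+1 (@measurable_shift_inv R d N)).
Qed.

Variable taut : probability (T * ZA)%type R.
Variable E : set (T * ZA).
Hypothesis mE : measurable E.

Lemma measurable_shiftz_preimage j : measurable (shiftz j @^-1` E).
Proof. by rewrite -[X in measurable X]setTI; exact: measurable_shiftz. Qed.

Lemma tile_disjoint j k : shifts_tile taut E -> j != k ->
  {ae taut, forall x, E (shiftz j x) -> ~ E (shiftz k x)}.
Proof.
move=> [disj _] /eqP jk; exists (shift_image E (- j) `&` shift_image E (- k)); split.
- by rewrite !shift_image_opp; apply: measurableI; exact: measurable_shiftz_preimage.
- by apply: disj => /oppr_inj.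
- move=> x /= h; rewrite !shift_image_opp; apply: contrapT => h2; apply: h => Ej Ek.
  by apply: h2.
Qed.

Lemma tile_cover : shifts_tile taut E -> {ae taut, forall x, exists j, E (shiftz j x)}.
Proof.
move=> [_ cov]; exists (~` \bigcup_j shift_image E j); split => //.
- apply: measurableC; rewrite (_ : \bigcup_j _ = \bigcup_(n in [set: nat])
     (if unpickle n is Some j then shiftz (- j) @^-1` E else set0)).
    apply: bigcup_measurable => n _; case: (unpickle n) => // j.
    exact: measurable_shiftz_preimage.
  apply/seteqP; split => x [].
    move=> j _; rewrite -[j]opprK shift_image_opp => Ex.
    by exists (pickle j) => //=; rewrite pickleK -[j]opprK opprK.
  move=> n _; case: (unpickle n) => // j Ex; exists j => //.
  by rewrite -[j]opprK shift_image_opp.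
- move=> x /= h [j _]; rewrite -[j]opprK shift_image_opp => Ex.
  by apply: h; exists (- j).
Qed.

End Iterates.

Section FiberAE.
Context (R : realType) (d : nat) (N : dilation d).
Local Notation T := (torus R d).
Local Notation ZA := (ZA N).
Variable mu : probability T R.
Variable taut : probability (T * ZA)%type R.
Variable nu : T -> probability ZA R.
Hypothesis mnu : forall k (a : ZA), measurable_fun setT (fun z => nu z (cylinder k a)).
Hypothesis taut_nu : forall B k (a : ZA), measurable B ->
  taut (B `*` cylinder k a) = (\int[mu]_(z in B) nu z (cylinder k a))%E.

(** The measure of A is the integral of the nonnegative function z |-> nu z
    (A_z). *)
Lemma null_fiber A : measurable A ->
  taut A = 0%E <-> {ae mu, forall z, nu z (xsection A z) = 0%E}.
Proof.
move=> mA; have [mf ->] := disintegration_set mnu taut_nu mA.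
have E : (\int[mu]_z nu z (xsection A z) = \int[mu]_z `|nu z (xsection A z)|)%E.
  by apply: eq_integral => z _; rewrite gee0_abs.
rewrite E; split => [/(ae_eq_integral_abs mu measurableT mf).1|h].
  by apply: filterS => z /(_ I).
by apply/(ae_eq_integral_abs mu measurableT mf); apply: filterS h => z + _.
Qed.

Lemma ae_fiber (P : T * ZA -> Prop) : {ae taut, forall x, P x} ->
  {ae mu, forall z, {ae nu z, forall a, P (z, a)}}.
Proof.
move=> [A [mA A0 PA]]; apply: filterS ((null_fiber mA).1 A0) => z Az.
exists (xsection A z); split => //; first exact: measurable_xsection.
by move=> a /= nP; apply/mem_set; exact: PA.
Qed.

End FiberAE.

(** * Wavelets have unit fibres and atoms *)

Section Forward.
Context (R : realType) (d : nat) (N : dilation d).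
Local Notation T := (torus R d).
Local Notation ZA := (ZA N).
Local Notation shift := (@Defs.shift R d N).
Local Notation shift_inv := (@shift_inv R d N).
Variable mu : probability T R.
Hypothesis hmu : is_normalized_haar mu.
Variable m : T -> R[i].
Hypothesis mm : measurable_fun setT m.
Hypothesis m0 : mu [set z | m z = 0] = 0%E.
Variable taut : probability (T * ZA)%type R.
Variable nu : T -> probability ZA R.
Hypothesis mnu : forall k (a : ZA), measurable_fun setT (fun z => nu z (cylinder k a)).
Hypothesis taut_nu : forall B k (a : ZA), measurable B ->
  taut (B `*` cylinder k a) = (\int[mu]_(z in B) nu z (cylinder k a))%E.
Hypothesis taut_mass : forall B k (a : ZA), measurable B ->
  taut (B `*` cylinder k a) = (\int[mu]_(z in B) (cyl_mass m k a z)%:E)%E.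
Hypothesis nu_mass : {ae mu, forall z, forall k (a : ZA),
  nu z (cylinder k a) = (cyl_mass m k a z)%:E}.
Variables (lam : T * ZA -> R[i]) (E : set (T * ZA)).
Hypothesis mlam : measurable_fun setT lam.
Hypothesis mE : measurable E.

Let psi x := lam x * ind R E x.
Let fam (jv : int * {ffun 'I_d -> int}) :=
  ziter (op_D taut m) (op_Dinv m) jv.1 (op_T jv.2 psi).

Lemma measurable_psi : measurable_fun setT psi.
Proof. by apply: measurable_cplxM => //; exact: measurable_ind. Qed.

Lemma op_T_L2 v : L2 taut psi -> L2 taut (op_T v psi).
Proof.
move=> [_ psi2]; split.
  apply: measurable_cplxM; last exact: measurable_psi.
  exact: (measurableT_comp (measurable_torus_char v) measurable_fst).
rewrite (_ : (fun x => _) = (fun x => (normc (psi x) ^+ 2)%:E))//.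
by apply/funext => x; rewrite /op_T normc2M normc_torus_char mul1r.
Qed.

(** The inner products of the T_v psi with psi itself are the Fourier
    coefficients of the image of |psi|^2 taut in the torus. *)
Lemma wavelet_unit_fiber : L2 taut psi -> orthonormal_basis taut fam ->
  {ae mu, forall z, fiber_sqn nu psi z = 1%E}.
Proof.
move=> [_ psi2] [_ ortho _]; apply: (unit_fiber_of_fourier hmu mnu taut_nu) => //.
  exact: measurable_psi.
move=> v; have := ortho (0, v) (0, [ffun=> 0]); rewrite /fam /= cinner_op_T.
rewrite xpair_eqE eqxx /= => <-; congr cintegral; apply/funext => x.
by congr (torus_char _ _ * _); apply/ffunP => i; rewrite !ffunE subr0.
Qed.

(** For nonzero j, D^j T_v psi vanishes almost everywhere on E, as it lives on
    another tile. *)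
Lemma lincomb_on_tile (s : seq (int * {ffun 'I_d -> int})) c :
  L2 taut psi -> shifts_tile taut E ->
  {ae taut, forall x, E x -> \sum_(i <- s) c i * fam i x =
    (\sum_(i <- s | i.1 == 0) c i * torus_char i.2 x.1) * lam x}.
Proof.
move=> psi2 til.
have van : {ae taut, forall x, forall i : int * {ffun 'I_d -> int}, E x -> i.1 != 0 -> fam i x = 0}.
  apply: ae_countable => -[j v]; have [->|j0] := eqVneq j 0; first exact: aeW.
  have [M W] := ziter_wcomp hmu mm m0 mnu taut_nu taut_mass nu_mass j.
  have j0' : 0 != j by rewrite eq_sym.
  apply: filterS2 (wcompE W (op_T_L2 v psi2)) (tile_disjoint mE til j0') => x /=.
  rewrite /fam /= => -> nE Ex _; rewrite /op_T /psi indCE memNset ?mulr0//.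
  exact: nE Ex.
apply: filterS van => x van Ex; rewrite (bigID (fun i => i.1 == 0)) /=.
rewrite [X in _ + X]big1 ?addr0 => [|i i0]; last by rewrite van// mulr0.
rewrite mulr_suml; apply: eq_bigr => -[j v] /eqP /= ->.
by rewrite /fam /= /op_T /psi indCE mem_set// mulr1 mulrA.
Qed.

(** Off E both f and psi vanish, and on E the approximating combination has the
    form p(z) psi by [lincomb_on_tile]. *)
Lemma wavelet_approx (f : T * ZA -> R[i]) (e : R) : L2 taut psi -> shifts_tile taut E ->
  orthonormal_basis taut fam -> measurable_fun setT f -> (forall x, ~ E x -> f x = 0) ->
  L2 taut f -> 0 < e -> exists p : T -> R[i], measurable_fun setT p /\
    (\int[taut]_x (normc (f x - p x.1 * psi x) ^+ 2)%:E <= e%:E)%E.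
Proof.
move=> psi2 til [famL2 _ dense] mf fE f2 e0.
have mfam i : measurable_fun setT (fam i) by case: (famL2 i).
have [g [s [c gE]] fg] : exists2 g, lincomb fam g &
    (\int[taut]_x (normc (f x - g x) ^+ 2)%:E < e%:E)%E.
  by apply: ((in_spanP taut fam f).2 _ e e0) => eps eps0; exact: dense.
have mg : measurable_fun setT g by apply: (measurable_lincomb mfam); exists s, c.
pose p z := \sum_(i <- s | i.1 == 0) c i * torus_char i.2 z.
have mp : measurable_fun setT p.
  apply: measurable_cplx_sum => i; apply: measurable_cplxM; first exact: measurable_cst.
  exact: measurable_torus_char.
exists p; split => //; apply: le_trans (ltW fg).
apply: ae_ge0_le_integral => //; try by move=> x _; exact: esqn_ge0.
- apply: measurable_sqn; apply: measurable_cplxB => //.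
  apply: measurable_cplxM; last exact: measurable_psi.
  exact: (measurableT_comp mp measurable_fst).
- by apply: measurable_sqn; exact: measurable_cplxB.
- apply: filterS (lincomb_on_tile s c psi2 til) => x sE _; rewrite lee_fin.
  have [Ex|Ex] := pselect (E x).
    by rewrite gE sE// /psi indCE mem_set// mulr1.
  by rewrite fE// /psi indCE memNset// !mulr0 subr0 normc2_0 sqr_ge0.
Qed.

(** Approximate the digit functions on E with summable errors, so that the
    convergence holds almost everywhere on almost every fibre, and apply
    [fiber_atom]. The fibre E_z has positive measure because |lam|^2 has
    integral 1 over it. *)
Lemma wavelet_atom : L2 taut psi -> shifts_tile taut E -> orthonormal_basis taut fam ->
  {ae mu, forall z, exists2 a, xsection E z a & nu z [set a] = nu z (xsection E z)}.
Proof.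
move=> psi2 til onb; have unit := wavelet_unit_fiber psi2 onb.
pose f k (x : T * ZA) : R[i] := digit_fun R k x.2 * ind R E x.
have mdig k : measurable_fun setT (fun x : T * ZA => digit_fun R k x.2).
  case: k => [|k]; first exact: measurable_cst.
  rewrite (_ : (fun x => _) = (fun x : T * ZA => \sum_(c : digit N)
      (enum_rank c)%:R * ind R [set y : T * ZA | y.2 k = c] x)); last first.
    apply/funext => x; rewrite (bigD1 (x.2 k))//= indCE mem_set// mulr1 big1 ?addr0//.
    by move=> c ck; rewrite indCE memNset ?mulr0//= => kc; move: ck; rewrite kc eqxx.
  apply: measurable_cplx_sum => c; apply: measurable_cplxM; first exact: measurable_cst.
  by apply: measurable_ind; exact: measurable_digit_of_snd.
have mf k : measurable_fun setT (f k) by apply: measurable_cplxM => //; exact: measurable_ind.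
have f2 k : L2 taut (f k).
  split=> //; pose C : R := if k is j.+1 then #|{: digit N}|%:R ^+ 2 else 1.
  apply: (@le_lt_trans _ _ (\int[taut]_x (cst C%:E x))%E).
    apply: ge0_le_integral => //; try by move=> x _; exact: esqn_ge0.
    - exact: measurable_sqn.
    - move=> x _; rewrite lee_fin /f normc2M indCE.
      have C0 : 0 <= C by rewrite /C; case: (k) => [//|j]; exact: sqr_ge0.
      case: ifP => _; last by rewrite normc2_0 mulr0.
      rewrite normc2_1 mulr1 /C /digit_fun.
      case: (k) => [|j]; first by rewrite normc2_1.
      rewrite -(rmorph_nat (@real_complex R)) normc2_real lerXn2r ?nnegrE//.
      by rewrite ler_nat ltnW.
  rewrite integral_cst//; apply: lte_mul_pinfty => //.
    by rewrite lee_fin /C; case: (k) => [//|j]; exact: sqr_ge0.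
  exact: probability_lty.
have fE k x : ~ E x -> f k x = 0 by move=> Ex; rewrite /f indCE memNset// mulr0.
have : forall kn : nat * nat, exists p : T -> R[i], measurable_fun setT p /\
    (\int[taut]_x (normc (f kn.1 x - p x.1 * psi x) ^+ 2)%:E <= (1 / (2 ^ kn.2.+1)%:R)%:E)%E.
  move=> [k n]; apply: wavelet_approx => //; first exact: fE.
move=> /choice[p pP].
have cvg_ae : {ae taut, forall x, forall k,
    (fun n => normc (f k x - p (k, n) x.1 * psi x) ^+ 2) @ \oo --> (0 : R)}.
  apply: ae_foralln => k; apply: (@summable_ae_cvg0 _ _ _ _ (fun n x => normc (f k x - p (k, n) x.1 * psi x) ^+ 2)).
  - move=> n; apply: measurable_normc2; apply: measurable_cplxB => //.
    apply: measurable_cplxM; last exact: measurable_psi.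
    by have [mp _] := pP (k, n); exact: (measurableT_comp mp measurable_fst).
  - by move=> n x; exact: sqr_ge0.
  - by move=> n; have [_] := pP (k, n).
apply: filterS2 unit (ae_fiber mnu taut_nu cvg_ae) => z unit_z cvg_z.
have mEz : measurable (xsection E z) by exact: measurable_xsection.
apply: (@fiber_atom _ _ _ (nu z) (xsection E z) (fun a => lam (z, a)) (fun k n => p (k, n) z)) => //.
  apply/eqP => nE0; move: unit_z; rewrite fiber_sqn_restrict null_set_integral//.
    by move=> /eqP; rewrite eq_sym onee_eq0.
  by apply: measurable_funTS; exact: measurable_sqn (measurable_fiber z mlam).
apply: filterS cvg_z => a ca Ea k; have := ca k.
have /mem_set Eza : E (z, a) by exact: (set_mem Ea).
by rewrite /f /psi indCE Eza !mulr1.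
Qed.

End Forward.

(** * Functions on a fibre with a single atom *)

Section AtomIntegral.
Context (R : realType) (d : nat) (N : dilation d).
Local Notation ZA := (ZA N).
Variables (nu : probability ZA R) (A : set ZA) (a : ZA).
Hypothesis mA : measurable A.
Hypothesis Aa : A a.
Hypothesis nua : nu [set a] = nu A.

Lemma ae_atom : {ae nu, forall b, A b -> b = a}.
Proof.
have m1 := measurable_ZA1 a.
exists (A `\` [set a]); split.
- exact: measurableD.
- rewrite measureD//; last by rewrite ltey_eq fin_num_measure.
  rewrite (_ : A `&` [set a] = [set a]); last by apply/setIidr => _ ->.
  by apply/eqP; rewrite sube_eq ?fin_num_measure//= ?add0e ?nua// fin_num_adde_defl ?fin_num_measure.
- by move=> b /= /not_implyP[Ab ba].
Qed.

Lemma atom_integral (f : ZA -> \bar R) : measurable_fun setT f -> (forall b, 0 <= f b)%E ->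
  (forall b, ~ A b -> f b = 0%E) -> (\int[nu]_b f b = f a * nu A)%E.
Proof.
move=> mf f0 fA; have m1 := measurable_ZA1 a.
transitivity (\int[nu]_(b in [set a]) (cst (f a) b))%E.
  rewrite [RHS]integral_mkcond; apply: ge0_ae_eq_integral => //.
  - have mc : measurable_fun [set a] (cst (f a)) by exact: measurable_cst.
    exact: (measurable_restrictT _ m1).1 mc.
  - by move=> b _; rewrite patchE; case: ifP => // _; exact: f0.
  - apply: filterS ae_atom => b bA _; rewrite patchE.
    case: ifPn => [/set_mem -> //|/negP ba].
    by apply: fA => /bA ab; apply: ba; rewrite ab inE.
by rewrite integral_cst//; congr (_ * _)%E; exact: nua.
Qed.

Lemma atom_cintegral (f : ZA -> R[i]) : measurable_fun setT f ->
  (forall b, ~ A b -> f b = 0) -> cintegral nu f = f a * (fine (nu A))%:C%C.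
Proof.
move=> mf fA; have m1 := measurable_ZA1 a.
have -> : cintegral nu f = cintegral nu (fun b => f a * ind R [set a] b).
  apply: cintegral_ae => //.
    by apply: measurable_cplxM; [exact: measurable_cst|exact: measurable_ind].
  apply: filterS ae_atom => b bA; rewrite indCE.
  case: ifPn => [/set_mem -> |/negP ba]; first by rewrite mulr1.
  by rewrite mulr0; apply: fA => /bA ab; apply: ba; rewrite ab inE.
rewrite cintegralZ; last first.
  apply: (@cintegrable_bounded _ _ _ _ _ 1).
  - exact: probability_lty.
  - exact: measurable_ind.
  - by move=> b; rewrite normc2_real indicE; case: (_ \in _); rewrite ?expr1n ?expr0n.
congr (_ * _); rewrite /cintegral /ind /= -nua.
rewrite /Rintegral integral_indic// setIT.
by rewrite integral0.
Qed.

End AtomIntegral.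

Section FiberIntegral.
Context (R : realType) (d : nat) (N : dilation d).
Local Notation T := (torus R d).
Local Notation ZA := (ZA N).
Variable mu : probability T R.
Variable taut : probability (T * ZA)%type R.
Variable nu : T -> probability ZA R.
Hypothesis mnu : forall k (a : ZA), measurable_fun setT (fun z => nu z (cylinder k a)).
Hypothesis taut_nu : forall B k (a : ZA), measurable B ->
  taut (B `*` cylinder k a) = (\int[mu]_(z in B) nu z (cylinder k a))%E.

Lemma measurable_fiber_Rintegral (g : T * ZA -> R) : measurable_fun setT g ->
  measurable_fun setT (fun z => \int[nu z]_a g (z, a)).
Proof.
move=> mg; have mgE : measurable_fun setT (EFin \o g) by exact/measurable_EFinP.
have [mp _] := disintegration_ge0 mnu taut_nu (measurable_funepos mgE) (fun x => funepos_ge0 _ x).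
have [mn _] := disintegration_ge0 mnu taut_nu (measurable_funeneg mgE) (fun x => funeneg_ge0 _ x).
have mB := emeasurable_funB mp mn.
rewrite (_ : (fun z => _) = fine \o (fun z =>
    \int[nu z]_a (EFin \o g)^\+ (z, a) - \int[nu z]_a (EFin \o g)^\- (z, a))%E).
  by apply: measurableT_comp.
apply/funext => z; rewrite /Rintegral integralE /=; congr (fine (_ - _)%E).
  by apply: eq_integral => a _; rewrite !funeposE.
by apply: eq_integral => a _; rewrite !funenegE.
Qed.

Lemma measurable_fiber_cintegral (g : T * ZA -> R[i]) : measurable_fun setT g ->
  measurable_fun setT (fun z => cintegral (nu z) (fun a => g (z, a))).
Proof.
move=> mg; apply: measurable_cplx_mk.
  exact: (measurable_fiber_Rintegral (measurable_Re mg)).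
exact: (measurable_fiber_Rintegral (measurable_Im mg)).
Qed.

End FiberIntegral.

Section FiberCoefficient.
Context (R : realType) (d : nat) (N : dilation d).
Local Notation T := (torus R d).
Local Notation ZA := (ZA N).
Variable mu : probability T R.
Variable taut : probability (T * ZA)%type R.
Variable nu : T -> probability ZA R.
Hypothesis mnu : forall k (a : ZA), measurable_fun setT (fun z => nu z (cylinder k a)).
Hypothesis taut_nu : forall B k (a : ZA), measurable B ->
  taut (B `*` cylinder k a) = (\int[mu]_(z in B) nu z (cylinder k a))%E.
Variables (lam : T * ZA -> R[i]) (E : set (T * ZA)).
Hypothesis mlam : measurable_fun setT lam.
Hypothesis mE : measurable E.
Let psi x := lam x * ind R E x.
Hypothesis unit_psi : {ae mu, forall z, fiber_sqn nu psi z = 1%E}.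
Hypothesis atom : {ae mu, forall z,
  exists2 a, xsection E z a & nu z [set a] = nu z (xsection E z)}.

Lemma cplx_eq_measurable (f g : T * ZA -> R[i]) : measurable_fun setT f ->
  measurable_fun setT g -> measurable [set x | f x <> g x].
Proof.
move=> mf mg; have mh := measurable_normc2 (measurable_cplxB mf mg).
rewrite (_ : [set _ | _] = ~` ((fun x => normc (f x - g x) ^+ 2) @^-1` [set 0])).
  by apply: measurableC; rewrite -[X in measurable X]setTI; exact: mh.
apply/seteqP; split => x /=; apply: contra_not.
  by move=> /eqP; rewrite normc2_eq0 subr_eq0 => /eqP.
by move=> ->; apply/eqP; rewrite normc2_eq0 subrr.
Qed.

(** Over almost every z, with atom a, the normalization reads |lam(a)|^2
    nu_z{a} = 1. Hence H(z) = h(a) conj(lam(a)) nu_z{a} satisfies H(z) lam(a) =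
    h(a) and |H(z)|^2 = |h(a)|^2 nu_z{a}, the integral of |h|^2 over the fibre.
    The definition of H by an integral makes it measurable in z without a
    measurable choice of atoms. *)
Lemma fiber_coefficient (h : T * ZA -> R[i]) : measurable_fun setT h ->
  (forall x, ~ E x -> h x = 0) -> L2 taut h ->
  exists H : T -> R[i], L2 mu H /\ {ae taut, forall x, h x = H x.1 * psi x}.
Proof.
move=> mh hE [_ h2]; have mpsi := measurable_psi mlam mE.
pose g x := h x * ((psi x)^*)%C.
have mg : measurable_fun setT g by apply: measurable_cplxM => //; exact: measurable_cplx_conj.
pose H z := cintegral (nu z) (fun a => g (z, a)).
have mH : measurable_fun setT H by exact: (measurable_fiber_cintegral mnu taut_nu mg).
have psiE x : ~ E x -> psi x = 0 by move=> Ex; rewrite /psi indCE memNset ?mulr0.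
have key : {ae mu, forall z, {ae nu z, forall a, h (z, a) = H z * psi (z, a)} /\
    (normc (H z) ^+ 2)%:E = fiber_sqn nu h z}.
  apply: filterS2 unit_psi atom => z unit_z [a Ea nua].
  have mEz : measurable (xsection E z) by exact: measurable_xsection.
  have nE b : ~ xsection E z b -> ~ E (z, b) by move=> nEb Eb; apply: nEb; exact/mem_set.
  have sqnE (f : T * ZA -> R[i]) : measurable_fun setT f -> (forall x, ~ E x -> f x = 0) ->
      fiber_sqn nu f z = ((normc (f (z, a)) ^+ 2)%:E * nu z (xsection E z))%E.
    move=> mf fE; rewrite /fiber_sqn (atom_integral mEz Ea nua) => //.
    - exact: measurable_sqn (measurable_fiber z mf).
    - by move=> b; exact: esqn_ge0.
    - by move=> b /nE /fE ->; rewrite normc2_0.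
  have HE : H z = g (z, a) * (fine (nu z (xsection E z)))%:C%C.
    rewrite /H (atom_cintegral mEz Ea nua)//; first exact: measurable_fiber z mg.
    by move=> b /nE /hE h0; rewrite /g h0 mul0r.
  have nuF : nu z (xsection E z) \is a fin_num by rewrite fin_num_measure.
  have mass1 : normc (psi (z, a)) ^+ 2 * fine (nu z (xsection E z)) = 1.
    by apply: EFin_inj; rewrite EFinM fineK// -sqnE.
  split.
    apply: filterS (ae_atom mEz Ea nua) => b bA.
    have [Eb|/nE Eb] := pselect (xsection E z b); last by rewrite hE// psiE// mulr0.
    rewrite (bA Eb) HE /g; set c := (fine _)%:C%C.
    rewrite -[RHS]mulrA -[RHS]mulrA [c * _]mulrC (mulrA _ (psi _)) [_ * psi _]mulrC.
    by rewrite cplx_mul_conj /c -rmorphM mass1 rmorph1 mulr1.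
  rewrite sqnE// HE /g -[X in (_ = _ * X)%E]fineK// -EFinM; congr (_%:E).
  rewrite !normc2M normc2_real normc2_conj.
  by rewrite -mulrA; congr (_ * _); rewrite [_ ^+ 2 in LHS]expr2 mulrA mass1 mul1r.
exists H; split.
  split => //.
  rewrite (_ : (\int[mu]_z (normc (H z) ^+ 2)%:E = \int[mu]_z fiber_sqn nu h z)%E).
    by rewrite -(integral_fiber_sqn mnu taut_nu mh).
  apply: ge0_ae_eq_integral => //.
  - exact: measurable_sqn.
  - exact: (measurable_fiber_sqn mnu taut_nu mh).
  - by move=> z _; exact: esqn_ge0.
  - by move=> z _; exact: fiber_sqn_ge0.
  - by apply: filterS key => z [_ ->] _.
have mHpsi : measurable_fun setT (fun x => H x.1 * psi x).
  by apply: measurable_cplxM => //; exact: (measurableT_comp mH measurable_fst).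
have mA := cplx_eq_measurable mh mHpsi.
exists [set x | h x <> H x.1 * psi x]; split => //.
apply/(null_fiber mnu taut_nu mA); apply: filterS key => z [[A [mA' A0 hA]] _].
apply/negligibleP; first exact: measurable_xsection.
exists A; split => // b /set_mem /= hb; apply: hA.
exact: hb.
Qed.

End FiberCoefficient.

(** * Transporting and exhausting spans *)

Section SpanTransport.
Context dX (X : measurableType dX) (R : realType).
Variable rho : {measure set X -> \bar R}.

Lemma in_span_reindex (I J : eqType) (phi : I -> X -> R[i]) (psi : J -> X -> R[i]) k f :
  (forall i, phi i = psi (k i)) -> in_span rho phi f -> in_span rho psi f.
Proof.
move=> phiE fs e /fs[g [s [c gE]] ge]; exists g => //.
rewrite (_ : g = fun x => \sum_(i <- s) c i * phi i x); last by apply/funext => x; exact: gE.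
apply: lincomb_sum => i; apply: lincombZ; rewrite phiE; exact: lincomb_gen.
Qed.

(** Distances are preserved, because the isometry applies to the difference of
    g and its approximation. *)
Lemma wcomp_in_span S s M (I : countType) (phi : I -> X -> R[i]) g :
  weighted_composition rho S s M -> (forall i, L2 rho (phi i)) -> measurable_fun setT g ->
  in_span rho phi g -> in_span rho (fun i => S (phi i)) (fun x => M x * g (s x)).
Proof.
move=> W phi2 mg gs e /gs[p [q [c pE]] pe].
have [ms mM M0 iso SL2 SE] := W.
have mphi i : measurable_fun setT (phi i) by case: (phi2 i).
have mS i : measurable_fun setT (S (phi i)) by case: (SL2 _ (phi2 i)).
have mp : measurable_fun setT p by apply: (measurable_lincomb mphi); exists q, c.
exists (fun x => \sum_(i <- q) c i * S (phi i) x); first by exists q, c.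
apply: le_lt_trans pe; rewrite -(iso _ (measurable_sqn (measurable_cplxB mg mp))); last first.
  by move=> x; exact: esqn_ge0.
rewrite le_eqVlt; apply/orP; left; apply/eqP; apply: ge0_ae_eq_integral => //.
- apply: measurable_sqn; apply: measurable_cplxB.
    by apply: measurable_cplxM => //; exact: measurableT_comp.
  by apply: measurable_cplx_sum => i; apply: measurable_cplxM => //; exact: measurable_cst.
- apply: emeasurable_funM; last exact: measurable_sqn.
  exact: (measurableT_comp (measurable_sqn (measurable_cplxB mg mp)) ms).
- by move=> x _; exact: esqn_ge0.
- by move=> x _; rewrite mule_ge0// esqn_ge0.
have : {ae rho, forall x, forall i, S (phi i) x = M x * phi i (s x)}.
  by apply: ae_countable => i; exact: SE.
apply: filterS => x Sx _; rewrite -EFinM -normc2M mulrC; congr ((normc _ ^+ 2)%:E).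
rewrite mulrBl pE mulr_suml; congr (_ - _).
by apply: eq_bigr => i _; rewrite Sx mulrCA mulrC.
Qed.

(** The restrictions of f to finite unions of the A_n are in the span by
    induction, since a new set contributes the restriction to it of f cut off
    outside the previous ones; these restrictions converge to f with dominated
    distances. *)
Lemma in_span_exhaust (I : eqType) (psi : I -> X -> R[i]) (A : nat -> set X) f :
  (forall i, measurable_fun setT (psi i)) ->
  (forall n, measurable (A n)) -> {ae rho, forall x, exists n, A n x} ->
  L2 rho f ->
  (forall n g, L2 rho g -> in_span rho psi (fun x => g x * ind R (A n) x)) ->
  in_span rho psi f.
Proof.
move=> mpsi mA cov [mf f2] loc; pose U n := \bigcup_(k < n) A k.
have mU n : measurable (U n) by exact: bigcup_measurable.
have mI B : measurable B -> measurable_fun setT (ind R B) by exact: measurable_ind.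
have mfI B : measurable B -> measurable_fun setT (fun x => f x * ind R B x).
  by move=> mB; apply: measurable_cplxM => //; exact: mI.
have fI2 B : measurable B -> L2 rho (fun x => f x * ind R B x).
  move=> mB; split; first exact: mfI.
  apply: le_lt_trans f2; apply: ge0_le_integral => //.
  - by move=> x _; exact: esqn_ge0.
  - by apply: measurable_sqn; exact: mfI.
  - exact: measurable_sqn.
  - move=> x _; rewrite lee_fin normc2M normc2_real indicE.
    by case: (_ \in _); rewrite ?expr1n ?expr0n ?mulr1 ?mulr0// sqr_ge0.
have step n : in_span rho psi (fun x => f x * ind R (U n) x).
  elim: n => [|n IH].
    rewrite (_ : (fun x => _) = fun=> 0); first exact/lincomb_in_span/lincomb0.
    by apply/funext => x; rewrite indCE memNset ?mulr0// => -[].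
  rewrite (_ : (fun x => _) = fun x => f x * ind R (U n) x +
     (f x * ind R (~` U n) x) * ind R (A n) x); last first.
    apply/funext => x; rewrite !indCE in_setC /U bigcup_mkord big_ord_recr -bigcup_mkord in_setU.
    by case: (x \in _); case: (x \in _); rewrite /= ?mulr1 ?mulr0 ?addr0 ?add0r.
  apply: in_spanD => //; first exact: mfI.
    by apply: measurable_cplxM; [apply: mfI; exact: measurableC|exact: mI].
  by apply: loc; apply: fI2; exact: measurableC.
have mT : measurable (\bigcup_n A n) by exact: bigcup_measurable.
apply: (@ae_in_span _ _ _ _ _ _ mpsi (fun x => f x * ind R (\bigcup_n A n) x)) => //.
- exact: mfI.
- by apply: filterS cov => x [n Anx]; rewrite indCE mem_set ?mulr1//; exists n.
apply: (@in_span_cvg _ _ _ _ _ _ mpsi (fun n x => f x * ind R (U n) x) _ (fun x => normc (f x) ^+ 2)) => //.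
- exact: mfI.
- by move=> n; exact: mfI.
- apply/integrableP; split; first exact: measurable_sqn.
  by under eq_integral do rewrite gee0_abs ?esqn_ge0//.
- move=> n x; have [Unx|Unx] := pselect (U n x).
    by rewrite !indCE !mem_set ?subrr ?normc2_0 ?sqr_ge0//; case: Unx => k _ Ak; exists k.
  rewrite [ind R (U n) x]indCE memNset// mulr0 subr0 normc2M normc2_real indicE.
  by case: (_ \in _); rewrite ?expr1n ?expr0n ?mulr1 ?mulr0// sqr_ge0.
- move=> x; have [[n _ Anx]|Ux] := pselect ((\bigcup_n A n) x); last first.
    rewrite (_ : (fun n => _) = fun=> 0); first exact: cvg_cst.
    apply/funext => n; rewrite !indCE !memNset ?subrr ?normc2_0// => -[k _ Ak]; apply: Ux.
    by exists k.
  apply: cvg_near_cst; exists n.+1 => // k /= nk.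
  by rewrite !indCE !mem_set ?subrr ?normc2_0//; exists n.
Qed.

End SpanTransport.

(** * Atoms and unit fibres give wavelets *)

Section Converse.
Context (R : realType) (d : nat) (N : dilation d).
Local Notation T := (torus R d).
Local Notation ZA := (ZA N).
Local Notation shift := (@Defs.shift R d N).
Local Notation shift_inv := (@shift_inv R d N).
Local Notation shiftz := (ziter shift shift_inv).
Variable mu : probability T R.
Hypothesis hmu : is_normalized_haar mu.
Variable m : T -> R[i].
Hypothesis mm : measurable_fun setT m.
Hypothesis m0 : mu [set z | m z = 0] = 0%E.
Variable taut : probability (T * ZA)%type R.
Variable nu : T -> probability ZA R.
Hypothesis mnu : forall k (a : ZA), measurable_fun setT (fun z => nu z (cylinder k a)).
Hypothesis taut_nu : forall B k (a : ZA), measurable B ->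
  taut (B `*` cylinder k a) = (\int[mu]_(z in B) nu z (cylinder k a))%E.
Hypothesis taut_mass : forall B k (a : ZA), measurable B ->
  taut (B `*` cylinder k a) = (\int[mu]_(z in B) (cyl_mass m k a z)%:E)%E.
Hypothesis nu_mass : {ae mu, forall z, forall k (a : ZA),
  nu z (cylinder k a) = (cyl_mass m k a z)%:E}.
Variables (lam : T * ZA -> R[i]) (E : set (T * ZA)).
Hypothesis mlam : measurable_fun setT lam.
Hypothesis mE : measurable E.
Let psi x := lam x * ind R E x.
Let fam (jv : int * {ffun 'I_d -> int}) :=
  ziter (op_D taut m) (op_Dinv m) jv.1 (op_T jv.2 psi).
Hypothesis til : shifts_tile taut E.
Hypothesis unit_psi : {ae mu, forall z, fiber_sqn nu psi z = 1%E}.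
Hypothesis atom : {ae mu, forall z,
  exists2 a, xsection E z a & nu z [set a] = nu z (xsection E z)}.

Let mpsi : measurable_fun setT psi := measurable_psi mlam mE.

Lemma unit_fiber_L2 : L2 taut psi.
Proof.
split => //; rewrite (integral_fiber_sqn mnu taut_nu mpsi).
rewrite (_ : (\int[mu]_z fiber_sqn nu psi z = \int[mu]_z (cst 1 z))%E).
  rewrite integral_cst// mul1e.
  exact: probability_lty.
apply: ge0_ae_eq_integral => //.
- exact: (measurable_fiber_sqn mnu taut_nu mpsi).
- by move=> z _; exact: fiber_sqn_ge0.
- by apply: filterS unit_psi => z -> _.
Qed.

Let psi2 := unit_fiber_L2.
Let op2 v := op_T_L2 mlam mE v psi2.
Let Wz := ziter_wcomp hmu mm m0 mnu taut_nu taut_mass nu_mass.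

Let famL2 i : L2 taut (fam i).
Proof. by have [M W] := Wz i.1; exact: (wcomp_L2 W (op2 i.2)). Qed.

(** Different scales live on disjoint tiles. At the same scale the isometry
    reduces to scale 0, where the inner product is a Fourier coefficient of
    Haar measure. *)
Lemma tile_orthonormal i k : cinner taut (fam i) (fam k) = (i == k)%:R.
Proof.
case: i k => [j v] [l w]; rewrite xpair_eqE.
have mc : measurable_fun setT (fun x => fam (j, v) x * ((fam (l, w) x)^*)%C).
  apply: measurable_cplxM; first by case: (famL2 (j, v)).
  by apply: measurable_cplx_conj; case: (famL2 (l, w)).
have [M W] := Wz j; have Ej := wcompE W (op2 v).
have [jl|jl] := eqVneq j l; last first.
  have [M' W'] := Wz l; have El := wcompE W' (op2 w).
  rewrite /cinner (@cintegral_ae _ _ _ taut _ (fun=> 0) mc).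
  - by rewrite /cintegral /Rintegral !integral0.
  - exact: measurable_cst.
  apply: filterS3 Ej El (tile_disjoint mE til jl) => x.
  rewrite /fam /= => -> -> nE; rewrite /op_T /psi !indCE.
  have [Ejx|Ejx] := pselect (E (shiftz j x)); last by rewrite memNset// !mulr0 mul0r.
  by rewrite [shiftz l x \in E]memNset ?mulr0 ?rmorph0 ?mulr0//; exact: nE.
subst l.
pose G x := op_T v psi x * ((op_T w psi x)^*)%C.
have mG : measurable_fun setT G.
  apply: measurable_cplxM; first by case: (op2 v).
  by apply: measurable_cplx_conj; case: (op2 w).
have [ms mM _ iso _ _] := W; have Ew := wcompE W (op2 w).
rewrite /cinner (@cintegral_ae _ _ _ taut _ (fun x => G (shiftz j x) * (normc (M x) ^+ 2)%:C%C) mc).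
- rewrite -(@cintegral_weighted _ _ _ _ _ taut taut (fun x => normc (M x) ^+ 2) (shiftz j) G)//.
  + apply: etrans (cinner_op_T taut psi v w) _.
    rewrite -(unit_fiber_cintegral mnu taut_nu mpsi unit_psi (measurable_torus_char _)).
    rewrite (haar_char hmu); congr (_%:R); congr nat_of_bool.
    apply/eqP/eqP => [vw|->]; apply/ffunP => i.
      by apply/eqP; rewrite -subr_eq0; move/ffunP : vw => /(_ i); rewrite !ffunE => ->.
    by rewrite !ffunE subrr.
  + by move=> x; exact: sqr_ge0.
  + by move=> F mF F0; rewrite -iso.
- apply: measurable_cplxM; first exact: measurableT_comp.
  by apply: measurable_cplx_real; exact: measurable_normc2.
apply: filterS2 Ej Ew => x; rewrite /fam /= => -> ->.
by rewrite [(_ * op_T w _ _)^*%C]rmorphM /= mulrACA cplx_mul_conj mulrC.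
Qed.

(** Trigonometric polynomials are dense in L^2(mu), and multiplication by psi
    is isometric. *)
Lemma fiber_span (H : T -> R[i]) : L2 mu H ->
  in_span taut (fun v => op_T v psi) (fun x => H x.1 * psi x).
Proof.
move=> [mH H2] e e0.
have muT : (mu setT < +oo)%E.
  exact: probability_lty.
have [p [s [c pE]] pe] := torus_char_dense muT mH H2 e0.
have mp : measurable_fun setT p.
  by apply: (measurable_lincomb (@measurable_torus_char R d)); exists s, c.
exists (fun x => \sum_(v <- s) c v * op_T v psi x); first by exists s, c.
apply: le_lt_trans pe.
have mF := measurable_sqn (measurable_cplxB mH mp).
rewrite (unit_fiber_integral mnu taut_nu mpsi unit_psi mF (fun z => esqn_ge0 _)).
rewrite le_eqVlt; apply/orP; left; apply/eqP; apply: eq_integral => x _.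
rewrite -EFinM -normc2M mulrBl pE mulr_suml; congr ((normc (_ - _) ^+ 2)%:E).
by apply: eq_bigr => v _; rewrite /op_T mulrA.
Qed.

(** Carry g from the tile sigma^-j(E) to E by dividing by M and composing with
    sigma^-j, write the result as H(z) psi, and apply D^j to its approximations
    by combinations of the T_v psi. *)
Lemma tile_span j g : L2 taut g ->
  in_span taut fam (fun x => g x * ind R (shiftz j @^-1` E) x).
Proof.
move=> [mg g2]; have [M W] := Wz j; have [ms mM M0 iso _ _] := W.
(* chosen so that M * (h o sigma^j) = g on the tile *)
pose h y := g (shiftz (- j) y) / M (shiftz (- j) y) * ind R E y.
have mq : measurable_fun setT (fun y => g (shiftz (- j) y) / M (shiftz (- j) y)).
  apply: measurable_cplxM; first exact: (measurableT_comp mg (measurable_shiftz _)).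
  by apply: measurable_cplx_inv; exact: (measurableT_comp mM (measurable_shiftz _)).
have mh : measurable_fun setT h by apply: measurable_cplxM => //; exact: measurable_ind.
have hs x : M x != 0 -> M x * h (shiftz j x) = g x * ind R (shiftz j @^-1` E) x.
  move=> Mx; rewrite /h shiftz_opp mulrA [g x / _]mulrC mulVKf//.
have h2 : L2 taut h.
  split => //; apply: le_lt_trans g2; rewrite -(iso _ (measurable_sqn mh)); last first.
    by move=> x; exact: esqn_ge0.
  apply: ae_ge0_le_integral => //.
  - by move=> x _; rewrite mule_ge0// esqn_ge0.
  - apply: emeasurable_funM; last exact: measurable_sqn.
    exact: (measurableT_comp (measurable_sqn mh) ms).
  - by move=> x _; exact: esqn_ge0.
  - exact: measurable_sqn.
  apply: filterS M0 => x /hs hx _; rewrite -EFinM -normc2M mulrC hx lee_fin.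
  rewrite normc2M normc2_real indicE.
  by case: (_ \in _); rewrite ?expr1n ?expr0n ?mulr1 ?mulr0// sqr_ge0.
have hE x : ~ E x -> h x = 0 by move=> Ex; rewrite /h indCE memNset ?mulr0.
have [H [H2 hH]] := fiber_coefficient mnu taut_nu mlam mE unit_psi atom mh hE h2.
have mop v : measurable_fun setT (op_T v psi) by case: (op2 v).
have mHpsi : measurable_fun setT (fun x => H x.1 * psi x).
  by apply: measurable_cplxM => //; case: H2 => mH _; exact: (measurableT_comp mH measurable_fst).
have hsp : in_span taut (fun v => op_T v psi) h.
  apply: ae_in_span (fiber_span H2) => //.
  by apply: filterS hH => x ->.
have := wcomp_in_span W op2 mh hsp.
move=> /(@in_span_reindex _ _ _ _ _ _ _ fam (fun v => (j, v)) _ (fun=> erefl)).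
apply: ae_in_span.
- by move=> i; case: (famL2 i).
- by apply: measurable_cplxM => //; exact: measurableT_comp.
- by apply: measurable_cplxM => //; apply: measurable_ind; exact: measurable_shiftz_preimage.
- by apply: filterS M0 => x /hs.
Qed.

(** Functions on single tiles are in the span by [tile_span], and the countably
    many tiles exhaust the space. *)
Lemma tile_orthonormal_basis : orthonormal_basis taut fam.
Proof.
split; [exact: famL2|exact: tile_orthonormal|move=> f f2].
apply/in_spanP.
apply: (@in_span_exhaust _ _ _ taut _ fam
  (fun n => if unpickle n is Some j then shiftz j @^-1` E else set0)) => //.
- by move=> i; case: (famL2 i).
- by move=> n; case: (unpickle n) => // j; exact: measurable_shiftz_preimage.
- apply: filterS (tile_cover mE til) => x [j Ej]; exists (pickle j).
  by rewrite pickleK.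
- move=> n g g2; case: (unpickle n) => [j|]; first exact: tile_span.
  rewrite (_ : (fun x => _) = fun=> 0); first exact/lincomb_in_span/lincomb0.
  by apply/funext => x; rewrite indCE memNset ?mulr0.
Qed.

End Converse.

Theorem theorem3p7 (R : realType) (d : nat) (hd : (0 < d)%N) (N : dilation d)
    (mu : probability (torus R d) R) (hmu : is_normalized_haar mu)
    (m : torus R d -> R[i]) (hm : is_quadrature_filter N mu m)
    (tau : probability (solenoid R N) R) (htau : is_solenoid_measure mu m tau)
    (taut : probability (torus R d * ZA N)%type R)
    (htaut : is_product_picture tau taut)
    (nu : torus R d -> probability (ZA N) R) (hnu : is_fiber_measure mu m nu)
    (E : set (torus R d * ZA N)) (hE : measurable E)
    (lam : torus R d * ZA N -> R[i]) (hlam : measurable_fun setT lam) :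
  generalized_MSF_wavelet taut m lam E <->
  [/\ shifts_tile taut E,
      {ae mu, forall z,
        (\int[nu z]_(a in xsection E z) ((normc (lam (z, a))) ^+ 2)%:E)%E
          = 1%E} &
      {ae mu, forall z, exists2 a : ZA N,
        xsection E z a & nu z [set a] = nu z (xsection E z)} ].
Proof.
have [mm m0 _] := hm.
have taut_mass B k (a : ZA N) : measurable B ->
    taut (B `*` cylinder k a) = (\int[mu]_(z in B) (cyl_mass m k a z)%:E)%E.
  exact: (taut_cylinder hmu mm htau htaut).
have [nu' [mnu nuE taut_nu]] := regular_version mm taut_mass hnu.
have nu_mass : {ae mu, forall z, forall k (a : ZA N), nu' z (cylinder k a) = (cyl_mass m k a z)%:E}.
  by apply: filterS2 nuE hnu => z ->.
split=> [[psi2 onb til]|[til unit atom]].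
- split => //.
  + apply: filterS2 nuE (wavelet_unit_fiber hmu mnu taut_nu hlam hE psi2 onb) => z <-.
    by rewrite fiber_sqn_restrict.
  + have := wavelet_atom hmu mm m0 mnu taut_nu taut_mass nu_mass hlam hE psi2 til onb.
    by apply: filterS2 nuE => z <-.
- have unit' : {ae mu, forall z, fiber_sqn nu' (fun x => lam x * ind R E x) z = 1%E}.
    by apply: filterS2 nuE unit => z zE; rewrite fiber_sqn_restrict zE.
  have atom' : {ae mu, forall z, exists2 a : ZA N,
      xsection E z a & nu' z [set a] = nu' z (xsection E z)}.
    by apply: filterS2 nuE atom => z ->.
  split => //; first exact: (unit_fiber_L2 mnu taut_nu hlam hE unit').
  exact: (tile_orthonormal_basis hmu mm m0 mnu taut_nu taut_mass nu_mass hlam hE til unit' atom').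
Qed.
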